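(* Let $B_n(t)$ ($n\ge 0$, $t\ge 0$) be the ''twisted and shrunk'' random walks defined in the context. As $n\to\infty$, with probability $1$ (that is, for almost all $\omega\in\Omega$) and for all $t\in[0,\infty)$ the sample-functions $B_n(t;\omega)$ converge to a sample-function $W(t;\omega)$ such that (i) $W(0;\omega)=0$ and $W(t;\omega)$ is a continuous function of $t$ on the interval $[0,\infty)$; (ii) for any $0\le s<t$, $W(t)-W(s)$ is a normally distributed random variable with expectation $0$ and variance $t-s$; (iii) for any $0\le s<t\le u<v$, the increments $W(t)-W(s)$ and $W(v)-W(u)$ are independent random variables. (By definition, $W(t)$ ($t\ge 0$) is called the Wiener process.) Further, the following estimates hold. (a) For any $C\ge 3/2$ and $K>0$ there is $n_0(C,K)$ such that for any $n\ge n_0(C,K)$ $$\mathbf{P}\left\{\max_{0\le t\le K}|W(t)-B_n(t)|\ge n2^{-n/2}\right\}\le 6\,(K2^{2n})^{1-C}.$$ (b) For any $K>0$, $$\max_{0\le t\le K}|W(t)-B_n(t)|\le n2^{-n/2}$$ with probability $1$ for all but finitely many $n$.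
   Context: Construction. Let $X_m(k)$ ($m\ge 0$, $k\ge 1$) be independent random variables on a probability space $\Omega$ with $\mathbf{P}\{X_m(k)=1\}=\mathbf{P}\{X_m(k)=-1\}=1/2$. Put $S_m(0)=0$, $S_m(n)=X_m(1)+\cdots+X_m(n)$ ($n\ge 1$). For $m\ge 1$ put $T_m(0)=0$ and recursively $T_m(k+1)=\min\{n: n>T_m(k),\ |S_m(n)-S_m(T_m(k))|=2\}$ ($k\ge 0$); these are finite with probability $1$. ''Twisted'' walks are defined recursively in $m$: $\tilde X_0(n)=X_0(n)$, $\tilde S_0=S_0$; for $m\ge 1$, $k\ge 0$ and every integer $n$ with $T_m(k)<n\le T_m(k+1)$, set $\tilde X_m(n)=X_m(n)$ if $S_m(T_m(k+1))-S_m(T_m(k))=2\tilde X_{m-1}(k+1)$, and $\tilde X_m(n)=-X_m(n)$ otherwise; $\tilde S_m(0)=0$, $\tilde S_m(n)=\tilde S_m(n-1)+\tilde X_m(n)$ ($n\ge 1$). Each $\tilde S_m$ is extended to real $t\ge 0$ by linear interpolation between consecutive integers. ''Shrinking'': $B_m(t)=2^{-m}\tilde S_m(t2^{2m})$ for $t\ge 0$, $m\ge 0$. On the probability-zero set where the limit of $B_n(t;\omega)$ possibly does not exist, $W(t;\omega)$ is defined as $0$ for all $t\ge 0$. *)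

(* Defs.v *)
From mathcomp Require Import all_boot all_order all_algebra.
From mathcomp Require Import finmap.
From mathcomp Require Import all_classical all_reals all_analysis.

Set Implicit Arguments.
Unset Strict Implicit.
Unset Printing Implicit Defensive.

Import Order.TTheory GRing.Theory Num.Theory.
Import numFieldNormedType.Exports.

Local Open Scope classical_set_scope.
Local Open Scope ring_scope.

Definition mutually_independent (d : measure_display) (Omega : measurableType d)
    (R : realType) (P : probability Omega R) (I : choiceType) (D : set I)
    (X : I -> Omega -> R) : Prop :=
  forall (J : {fset I}) (A : I -> set R),
    [set` J] `<=` D ->
    (forall i, i \in J -> measurable (A i)) ->
    P (\bigcap_(i in [set` J]) (X i @^-1` A i)) =
      (\prod_(i <- J) P (X i @^-1` A i))%E.

Definition independent (d : measure_display) (Omega : measurableType d)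
    (R : realType) (P : probability Omega R) (Y Z : Omega -> R) : Prop :=
  forall A B : set R, measurable A -> measurable B ->
    P (Y @^-1` A `&` Z @^-1` B) = (P (Y @^-1` A) * P (Z @^-1` B))%E.

Section twist_and_shrink.
Variable R : realType.

(* Only the steps x 1, x 2, ... are used; x 0 is ignored. *)
Definition walk (x : nat -> R) (n : nat) : R := \sum_(1 <= i < n.+1) x i.

(* [None] stands for an infinite time, i.e. for the minimum of an empty set. *)
Definition next_time (S : nat -> R) (a : nat) : option nat :=
  if pselect (exists n, (a < n)%N && (`|S n - S a| == 2)) is left e
  then Some (ex_minn e) else None.

Fixpoint hitting_time (S : nat -> R) (k : nat) : option nat :=
  if k is k'.+1 then obind (next_time S) (hitting_time S k') else Some 0%N.

(* [x] holds the steps X_m and [y] the already twisted steps of level m - 1.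
   For n >= 1 there is at most one k with T_m(k) < n <= T_m(k+1).  If there is
   none, which requires some T_m(k) to be infinite, the value is -x n by
   convention; this happens only on an event of probability zero. *)
Definition twist (x y : nat -> R) (n : nat) : R :=
  let S := walk x in
  if `[< exists k a b, [/\ hitting_time S k = Some a,
                           hitting_time S k.+1 = Some b,
                           (a < n <= b)%N
                         & S b - S a = 2 * y k.+1] >]
  then x n else - x n.

Fixpoint twisted_step (x : nat -> nat -> R) (m : nat) : nat -> R :=
  if m is m'.+1 then twist (x m) (twisted_step x m') else x 0%N.

(* Used at t >= 0 only, where Num.truncn is the integer part. *)
Definition interpolate (s : nat -> R) (t : R) : R :=
  let n := Num.truncn t in s n + (t - n%:R) * (s n.+1 - s n).

Definition shrunk_path (x : nat -> nat -> R) (m : nat) (t : R) : R :=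
  2 ^- m * interpolate (walk (twisted_step x m)) (t * 2 ^+ (2 * m)).

(* The supremum is a maximum when f and g are continuous on [0, K]; in
   general [sup] would return 0 on an unbounded set. *)
Definition max_dist (K : R) (f g : R -> R) : R :=
  sup [set `|f t - g t| | t in `[0, K]].

End twist_and_shrink.

(* B X m t w = B_m(t; w) *)
Definition B (d : measure_display) (Omega : measurableType d) (R : realType)
    (X : nat -> nat -> Omega -> R) (m : nat) (t : R) (w : Omega) : R :=
  shrunk_path (fun i k => X i k w) m t.

(* Main.v *)
(* Group the steps of a walk into pairs: the times T(k) are then the ends of
   the pairs with two equal steps, and twisting flips signs between them.  On
   finitely many signs the twist is part of an involution, so the twisted steps
   of a level, together with all raw steps of later levels, are again
   independent fair signs.  The twisted walk seen at the times T(k) is twice the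
   previous level's walk, hence two successive levels differ by at most the
   displacement of a fair walk over the time lag |T(k) - 4k|.  Exponential tail
   bounds for sums of signs control both quantities, and summing over the
   levels gives uniform convergence with the stated rate.

   An increment of W is the almost sure limit of a normalized sum of N fair
   signs.  Discrete integration by parts for such sums becomes Stein's identity
   E[Z g(Z)] = (t - s) E[g'(Z)] in the limit, which characterizes the normal
   law; independence passes to the limit on intervals, whose endpoints are not
   atoms. *)

Require Import Defs.
From mathcomp Require Import all_boot all_order all_algebra.
From mathcomp Require Import finmap.
From mathcomp Require Import all_classical all_reals all_analysis.
From mathcomp Require Import measurable_realfun.
From mathcomp Require Import zify ring lra.

Set Implicit Arguments.
Unset Strict Implicit.
Unset Printing Implicit Defensive.

Import Order.TTheory GRing.Theory Num.Theory.
Import numFieldNormedType.Exports.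

Local Open Scope classical_set_scope.
Local Open Scope ring_scope.

(** The sign given to a step depends on raw signs that come later, at the end of its block, and the
    length of a block is unbounded: a twisted step is not a function of a fixed finite set of signs.
    Hence only pairs below a bound [L] are first allowed to end a block. The truncated twist acts on
    a finite box of signs, where invariance of the uniform law is a matter of counting, and it
    agrees with the true twist unless [n] consecutive pairs are all unequal, an event of probability
    $2^{-n}$. The probability to be computed does not depend on [n], so it is exactly the fair one,
    and no conditioning on stopping times is involved.

    The level errors are arranged to telescope: from level $n$ to $n+1$ the path moves by at most
    half the decrease of the rate $n2^{-n/2}$. The total from $n$ on is half the rate, and the
    factor two that remains excludes the event of (a), which is stated with a weak inequality, off
    the exceptional events. *)

(** * Twisting of boolean sequences and its inverse *)

(* Positions are counted from 0: the pair [i] consists of the steps [2i+1] and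
   [2i+2] of the paper. *)
Definition same_pair (x : nat -> bool) (i : nat) : bool := x i.*2 == x i.*2.+1.

Definition cnt (q : pred nat) (j : nat) : nat := \sum_(i < j) q i.

Definition first (q : pred nat) (i : nat) : option nat :=
  if pselect (exists j, (i <= j)%N && q j) is left e then Some (ex_minn e)
  else None.

(** [true] stands for the sign -1, so [(+)] multiplies signs. A block ends with a pair marked by
    [q]; [x j.*2.+1 (+) y (cnt q j)] tells whether the block of [p] has to be flipped for its last
    step to get the sign prescribed by [y]. With no marked pair ahead nothing is flipped. *)
Definition bit_twist (q : pred nat) (x y : nat -> bool) (p : nat) : bool :=
  if first q p./2 is Some j then x p (+) x j.*2.+1 (+) y (cnt q j) else x p.

(** The raw last sign of block [k], which twisting overwrites, is saved in place [k] of [y]; places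
    that belong to no block keep their value. *)
Definition bit_swap (q : pred nat) (x y : nat -> bool) (k : nat) : bool :=
  if pselect (exists j, q j && (cnt q j == k)) is left e
  then x (ex_minn e).*2.+1 else y k.

Lemma firstP (q : pred nat) i :
  match first q i with
  | Some j => [/\ (i <= j)%N, q j & forall l, (i <= l < j)%N -> ~~ q l]
  | None => forall j, (i <= j)%N -> ~~ q j
  end.
Proof.
rewrite /first; case: pselect => [e|ne].
  case: ex_minnP => j /andP[ij qj] jmin; split => // l /andP[il lj].
  by apply/negP => ql; have := jmin l; rewrite il ql leqNgt lj => /(_ isT).
by move=> j ij; apply/negP => qj; apply: ne; exists j; rewrite ij.
Qed.

Lemma first_eq (q : pred nat) i j : (i <= j)%N -> q j ->
  (forall l, (i <= l < j)%N -> ~~ q l) -> first q i = Some j.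
Proof.
move=> ij qj ql; have := firstP q i; case: first => [j' [ij' qj' ql']|].
  by congr Some; case: (ltngtP j' j) => // lt;
    [have := ql j'|have := ql' j]; rewrite ?ij ?ij' lt ?qj ?qj' => /(_ isT).
by move=> /(_ j ij); rewrite qj.
Qed.

Lemma first_refl (q : pred nat) j : q j -> first q j = Some j.
Proof. by move=> qj; apply: first_eq => // l; case: ltngtP. Qed.

Lemma cntS (q : pred nat) j : cnt q j.+1 = (cnt q j + q j)%N.
Proof. by rewrite /cnt big_ord_recr. Qed.

Lemma cnt0 (q : pred nat) : cnt q 0 = 0%N.
Proof. by rewrite /cnt big_ord0. Qed.

Lemma cnt_le (q : pred nat) i j : (i <= j)%N -> (cnt q i <= cnt q j)%N.
Proof.
elim: j => [|j IH]; first by rewrite leqn0 => /eqP->.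
rewrite leq_eqVlt => /predU1P[->//|]; rewrite ltnS => /IH h.
by rewrite cntS (leq_trans h)// leq_addr.
Qed.

Lemma cnt_ub (q : pred nat) j : (cnt q j <= j)%N.
Proof. by elim: j => [|j IH]; rewrite ?cnt0// cntS; case: (q j); lia. Qed.

Lemma cnt_lt (q : pred nat) i j : (i < j)%N -> q i -> (cnt q i < cnt q j)%N.
Proof. by move=> ij qi; apply: leq_trans (cnt_le q ij); rewrite cntS qi addn1. Qed.

Lemma cnt_inj (q : pred nat) i j : q i -> q j -> cnt q i = cnt q j -> i = j.
Proof. by move=> qi qj e; case: (ltngtP i j) => // /(cnt_lt (q := q)); 
  [move=> /(_ qi)|move=> /(_ qj)]; rewrite e ltnn. Qed.

Lemma cnt_gap (q : pred nat) i j : (i <= j)%N -> (forall l, (i <= l < j)%N -> ~~ q l) ->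
  cnt q j = cnt q i.
Proof.
elim: j => [|j IH]; first by rewrite leqn0 => /eqP->.
rewrite leq_eqVlt => /predU1P[->//|]; rewrite ltnS => ij ql.
rewrite cntS (negbTE (ql j _)) ?ij ?leqnn// addn0.
by apply: IH => // l /andP[il lj]; apply: ql; rewrite il ltnS ltnW.
Qed.

Lemma eq_cnt (q q' : pred nat) j : (forall i, (i < j)%N -> q i = q' i) -> cnt q j = cnt q' j.
Proof. by move=> h; apply: eq_bigr => i _; rewrite h. Qed.

Lemma bit_swap_eq (q : pred nat) x y j : q j -> bit_swap q x y (cnt q j) = x j.*2.+1.
Proof.
move=> qj; rewrite /bit_swap; case: pselect => [e|[]]; last by exists j; rewrite qj eqxx.
by case: ex_minnP => l /andP[ql /eqP cl] _; rewrite (cnt_inj ql qj cl).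
Qed.

Lemma bit_swap_neq (q : pred nat) x y k : (forall j, q j -> cnt q j != k) ->
  bit_swap q x y k = y k.
Proof.
move=> h; rewrite /bit_swap; case: pselect => // e.
by exfalso; case: e => j /andP[/h + cj]; rewrite cj.
Qed.

Lemma bit_twist_some (q : pred nat) x y p j : first q p./2 = Some j ->
  bit_twist q x y p = x p (+) x j.*2.+1 (+) y (cnt q j).
Proof. by rewrite /bit_twist => ->. Qed.

Lemma bit_twist_last (q : pred nat) x y j : q j -> bit_twist q x y j.*2.+1 = y (cnt q j).
Proof.
move=> qj; rewrite (@bit_twist_some _ _ _ _ j) ?addbb//.
by rewrite -[j.*2.+1]add1n halfD odd_double/= add0n doubleK first_refl.
Qed.

(** The flip depends on [p] only through [p./2], so both steps of a pair are flipped together. The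
    block structure can thus be read off the twisted sequence, which makes twisting invertible. *)
Lemma same_pair_twist (q : pred nat) x y : same_pair (bit_twist q x y) = same_pair x.
Proof.
apply/funext => i; rewrite /same_pair /bit_twist.
rewrite -[i.*2.+1]add1n halfD odd_double/= !add0n doubleK add1n.
case: first => // j; case: (x i.*2); case: (x i.*2.+1); case: (x _); case: (y _) => //.
Qed.

(** The two flips coincide: after twisting, the last sign of the block and the entry of [y] have
    merely exchanged their values. *)
Lemma bit_twistK (q : pred nat) x y p :
  bit_twist q (bit_twist q x y) (bit_swap q x y) p = x p.
Proof.
rewrite {1}/bit_twist; have := firstP q p./2.
case E : (first _ _) => [j|]; first case=> pj qj ql.
  rewrite bit_twist_last// bit_swap_eq// (bit_twist_some _ _ E).
  by case: (x p); case: (x _); case: (y _).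
by move=> _; rewrite /bit_twist E.
Qed.

Lemma bit_swapK (q : pred nat) x y k :
  bit_swap q (bit_twist q x y) (bit_swap q x y) k = y k.
Proof.
have [[j [qj <-]]|ne] := pselect (exists j, q j /\ cnt q j = k).
  by rewrite bit_swap_eq// bit_twist_last.
have h j : q j -> cnt q j != k by move=> qj; apply/eqP => e; apply: ne; exists j.
by rewrite !bit_swap_neq.
Qed.

Definition trunc (q : pred nat) (L : nat) : pred nat := fun j => q j && (j < L)%N.

Lemma trunc_same_pair L x x' : (forall p, (p < L.*2)%N -> x p = x' p) ->
  trunc (same_pair x) L = trunc (same_pair x') L.
Proof.
move=> xx'; apply/funext => j; rewrite /trunc /same_pair.
by have [jL|] := ltnP j L; rewrite ?andbF// !xx'//; lia.
Qed.

(** A marked pair has index [j < L], hence its number [cnt q j] is below [L] too: apart from [x p],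
    all signs that are read lie in a finite range. *)
Lemma bit_twist_trunc_local L x x' y y' p :
  (forall p, (p < L.*2)%N -> x p = x' p) -> (forall k, (k < L)%N -> y k = y' k) ->
  x p = x' p ->
  bit_twist (trunc (same_pair x) L) x y p = bit_twist (trunc (same_pair x') L) x' y' p.
Proof.
move=> xx' yy' xp; rewrite -(trunc_same_pair xx') /bit_twist.
have := firstP (trunc (same_pair x) L) p./2; case: first => [j|//].
case=> _ /andP[_ jL] _; rewrite xp xx' ?yy'//; last lia.
exact: leq_ltn_trans (cnt_ub _ _) jL.
Qed.

Lemma bit_swap_trunc_local L x x' (y y' : nat -> bool) k :
  (forall p, (p < L.*2)%N -> x p = x' p) -> y k = y' k ->
  bit_swap (trunc (same_pair x) L) x y k = bit_swap (trunc (same_pair x') L) x' y' k.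
Proof.
move=> xx' yk; rewrite -(trunc_same_pair xx') /bit_swap.
case: pselect => // e; case: ex_minnP => j /andP[/andP[_ jL] _] _.
by rewrite xx'//; lia.
Qed.

(** A marked pair between [J] and [L] makes the block of any position before [J.*2] end before [L],
    so the truncation is not felt there. *)
Lemma bit_twist_truncE (q : pred nat) J L x y p : (p < J.*2)%N ->
  (exists l, (J <= l < L)%N && q l) ->
  bit_twist (trunc q L) x y p = bit_twist q x y p.
Proof.
move=> pJ [l /andP[/andP[Jl lL] ql]].
have := firstP q p./2; case E : first => [j|]; last first.
  by move=> /(_ l); rewrite ql => /(_ ltac:(lia)).
case=> pj qj nq.
have jL : (j < L)%N.
  rewrite ltnNge; apply/negP => Lj.
  by have := nq l; rewrite ql => /(_ ltac:(lia)).
rewrite (bit_twist_some _ _ E) (@bit_twist_some _ _ _ _ j).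
  by congr (_ (+) y _); apply: eq_cnt => i ij; rewrite /trunc (ltn_trans ij jL) andbT.
apply: first_eq => //; first by rewrite /trunc qj.
by move=> i ij; rewrite /trunc negb_and nq.
Qed.

(* Row 0 holds the twisted steps of a level, row 1 the raw steps of the next
   one, which get twisted.  Keeping in row 0 the discarded signs of [x] makes
   this map an involution, hence it preserves the uniform distribution. *)
Definition twist_rows (L : nat) (z : nat * nat -> bool) (i : nat * nat) : bool :=
  let x p := z (1%N, p) in let y p := z (0%N, p) in
  let q := trunc (same_pair x) L in
  match i.1 with
  | 0%N => bit_swap q x y i.2
  | 1%N => bit_twist q x y i.2
  | _ => z i
  end.

Lemma twist_rowsK L z i : twist_rows L (twist_rows L z) i = z i.
Proof.
case: i => -[|[|i]] p//; rewrite {1}/twist_rows/=.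
  rewrite [X in trunc X _](_ : _ = same_pair (fun p => z (1%N, p))) ?bit_swapK//.
  exact: same_pair_twist.
rewrite [X in trunc X _](_ : _ = same_pair (fun p => z (1%N, p))) ?bit_twistK//.
exact: same_pair_twist.
Qed.

Lemma twist_rows_local L z z' i :
  (forall k p, (k <= maxn 1 i.1)%N -> (p < L.*2)%N || (p == i.2) ->
     z (k, p) = z' (k, p)) ->
  twist_rows L z i = twist_rows L z' i.
Proof.
case: i => -[|[|i]] p zz'; rewrite /twist_rows/= in zz' *.
- apply: bit_swap_trunc_local => [k kL|]; apply: zz'; rewrite ?eqxx ?orbT// kL//.
- apply: bit_twist_trunc_local => [k kL|k kL|]; apply: zz';
    rewrite ?eqxx ?orbT//; lia.
- by apply: zz'; rewrite ?eqxx ?orbT//; lia.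
Qed.

(** * Families of independent fair signs *)

Section measurable_predicates.
Context d (T : measurableType d).

Lemma measurable_ex (p : nat -> T -> Prop) :
  (forall k, measurable [set w | p k w]) -> measurable [set w | exists k, p k w].
Proof.
move=> mp; rewrite (_ : [set _ | _] = \bigcup_k [set w | p k w]).
  exact: bigcupT_measurable.
by apply/seteqP; split => w /= [k]; [exists k|exists k].
Qed.

Lemma measurable_all (p : nat -> T -> Prop) :
  (forall k, measurable [set w | p k w]) -> measurable [set w | forall k, p k w].
Proof.
move=> mp; rewrite (_ : [set _ | _] = \bigcap_k [set w | p k w]).
  exact: bigcapT_measurable.
by apply/seteqP; split => w /= h k; [move=> _|]; exact: h.
Qed.

Lemma measurable_conj (p q : T -> Prop) : measurable [set w | p w] ->
  measurable [set w | q w] -> measurable [set w | p w /\ q w].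
Proof. exact: measurableI. Qed.

Lemma measurable_notp (p : T -> Prop) : measurable [set w | p w] ->
  measurable [set w | ~ p w].
Proof. exact: measurableC. Qed.

Lemma measurable_constp (p : Prop) : measurable [set w : T | p].
Proof.
have [hp|hp] := pselect p.
  by rewrite (_ : [set _ | _] = setT)//; apply/seteqP; split.
by rewrite (_ : [set _ | _] = set0)//; apply/seteqP; split.
Qed.

Lemma measurable_impl (p q : T -> Prop) : measurable [set w | p w] ->
  measurable [set w | q w] -> measurable [set w | p w -> q w].
Proof.
move=> mp mq; rewrite (_ : [set _ | _] = ~` [set w | p w] `|` [set w | q w]).
  by apply: measurableU => //; exact: measurableC.
apply/seteqP; split => w /=; last by case.
by move=> pq; have [/pq|] := pselect (p w); [right|left].
Qed.

Lemma measurable_seq_all (I : eqType) (s : seq I) (p : I -> T -> bool) :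
  (forall i, i \in s -> measurable [set w | p i w]) ->
  measurable [set w | all (p ^~ w) s].
Proof.
elim: s => [_|i s IH mp] /=.
  by rewrite (_ : [set _ | _] = setT)//; apply/seteqP; split.
rewrite (_ : [set _ | _] = [set w | p i w] `&` [set w | all (p ^~ w) s]).
  apply: measurableI; first by apply: mp; rewrite mem_head.
  by apply: IH => j js; apply: mp; rewrite in_cons js orbT.
by apply/seteqP; split => w /= /andP.
Qed.

End measurable_predicates.

Section fair.
Context d (Omega : measurableType d) (R : realType) (P : probability Omega R).

Definition agree (I : eqType) (s : seq I) (e x : I -> bool) : bool :=
  all (fun i => x i == e i) s.

(** Prescribing the probability of every finite pattern states independence and uniformity at
    once. *)
Definition fair (I : choiceType) (zeta : I -> Omega -> bool) : Prop :=
  forall (s : seq I) (e : I -> bool), uniq s ->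
    P [set w | agree s e (zeta ^~ w)] = ((2^-1 : R) ^+ size s)%:E.

Variables (I : choiceType) (zeta : I -> Omega -> bool).
Hypothesis mzeta : forall i, measurable [set w | zeta i w].

Lemma measurable_bit_eq i b : measurable [set w | zeta i w == b].
Proof.
case: b.
  rewrite (_ : [set _ | _] = [set w | zeta i w])//.
  by apply/seteqP; split => w /=; case: (zeta i w).
rewrite (_ : [set _ | _] = ~` [set w | zeta i w]); first exact: measurableC.
by apply/seteqP; split => w /=; case: (zeta i w).
Qed.

Lemma measurable_agree s e : measurable [set w | agree s e (zeta ^~ w)].
Proof. by apply: measurable_seq_all => i _; exact: measurable_bit_eq. Qed.

Section box.
Variable box : seq I.
Hypothesis ubox : uniq box.
Local Notation F := {ffun seq_sub box -> bool}.

Let extend (f : F) (i : I) : bool := if insub i is Some j then f j else false.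
Let restr (x : I -> bool) : F := [ffun j => x (val j)].

Let local_ (Q : (I -> bool) -> bool) :=
  forall x x', (forall i, i \in box -> x i = x' i) -> Q x = Q x'.

Let extend_restr x i : i \in box -> extend (restr x) i = x i.
Proof. by move=> ib; rewrite /extend insubT ffunE. Qed.

Let restr_extend f : restr (extend f) = f.
Proof. by apply/ffunP => j; rewrite ffunE /extend valK. Qed.

Let preim Q : local_ Q -> [set w | Q (zeta ^~ w)] =
  \bigcup_(f in [set` enum [pred f : F | Q (extend f)]])
    [set w | agree box (extend f) (zeta ^~ w)].
Proof.
move=> lQ; apply/seteqP; split => w /=.
  move=> Qw; exists (restr (zeta ^~ w)) => /=.
    by rewrite mem_enum inE (lQ _ (zeta ^~ w))// => i ib; rewrite extend_restr.
  by apply/allP => i ib; rewrite extend_restr.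
move=> [f /= ]; rewrite mem_enum inE => Qf /allP h.
by rewrite (lQ _ (extend f))// => i /h/eqP.
Qed.

Lemma measurable_local Q : local_ Q -> measurable [set w | Q (zeta ^~ w)].
Proof.
move=> lQ; rewrite preim//; apply: fin_bigcup_measurable => // f _.
exact: measurable_agree.
Qed.

Let fair_prob_local Q : fair zeta -> local_ Q -> P [set w | Q (zeta ^~ w)] =
  ((2^-1 : R) ^+ size box *+ #|[pred f : F | Q (extend f)]|)%:E.
Proof.
move=> fz lQ; rewrite preim// measure_fin_bigcup//; last first.
- by move=> f _; exact: measurable_agree.
- move=> f g /= _ _ [w /= [/allP wf /allP wg]].
  apply/ffunP => j; have jb : val j \in box by exact: valP.
  by rewrite -(restr_extend f) -(restr_extend g) !ffunE -(eqP (wf _ jb)) -(eqP (wg _ jb)).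
rewrite -fsbig_seq ?enum_uniq// (eq_bigr (fun=> ((2^-1 : R) ^+ size box)%:E)); last first.
  by move=> f _; exact: fz.
by rewrite sumEFin big_const_seq count_predT -cardE iter_addr_0.
Qed.

(** The patterns on the box are disjoint and equally likely, so an event read off the box is
    measured by counting patterns; [Phi], whose values on the box depend only on the box, permutes
    them. *)
Lemma fair_involution (Phi : (I -> bool) -> I -> bool) (Q : (I -> bool) -> bool) :
  fair zeta -> local_ Q ->
  (forall x x', (forall i, i \in box -> x i = x' i) ->
     forall i, i \in box -> Phi x i = Phi x' i) ->
  (forall x i, Phi (Phi x) i = x i) ->
  P [set w | Q (Phi (zeta ^~ w))] = P [set w | Q (zeta ^~ w)].
Proof.
move=> fz lQ lPhi PhiK.
rewrite fair_prob_local// (@fair_prob_local (Q \o Phi))//; last first.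
  by move=> x x' xx' /=; apply: lQ; exact: lPhi.
congr ((_ *+ _)%:E); pose psi (f : F) := restr (Phi (extend f)).
have psiK : cancel psi psi.
  move=> f; rewrite -[RHS]restr_extend; apply/ffunP => j.
  rewrite !ffunE -[in RHS](PhiK (extend f)); apply: lPhi; last exact: valP.
  by move=> i ib; rewrite extend_restr.
rewrite -(fintype.card_image (can_inj psiK)); apply: eq_card => f.
rewrite [RHS]inE/=; apply/fintype.imageP/idP => [[g]|Qf].
  rewrite inE /= => Qg ->.
  by rewrite (lQ _ (Phi (extend g)))// => i ib; rewrite extend_restr.
exists (psi f); last by rewrite psiK.
rewrite inE /= (lQ _ (extend f))// => i ib.
rewrite -[in RHS](PhiK (extend f)); apply: lPhi => // k kb.
by rewrite extend_restr.
Qed.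

End box.
End fair.

(** * Sums of fair signs *)

Section mean.
Variable R : realType.
Implicit Types (f g : R -> R) (n : nat).

(** The expectation of [f] at the sum of [n] independent fair signs, by conditioning on one sign.
    The recursion keeps the identities below free of measure theory. *)
Fixpoint mean n f : R :=
  if n is n'.+1 then (mean n' (fun x => f (x + 1)) + mean n' (fun x => f (x - 1))) / 2
  else f 0.

Lemma meanS n f :
  mean n.+1 f = (mean n (fun x => f (x + 1)) + mean n (fun x => f (x - 1))) / 2.
Proof. by []. Qed.

Lemma eq_mean n f g : f =1 g -> mean n f = mean n g.
Proof. by move=> /funext->. Qed.

Lemma le_mean n f g : (forall x, f x <= g x) -> mean n f <= mean n g.
Proof.
elim: n f g => [|n IH] f g fg /=; first exact: fg.
by rewrite ler_pM2r// lerD// IH.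
Qed.

Lemma meanD n f g : mean n (fun x => f x + g x) = mean n f + mean n g.
Proof. by elim: n f g => [//|n IH] f g /=; rewrite !IH; field. Qed.

Lemma meanZ n c f : mean n (fun x => c * f x) = c * mean n f.
Proof. by elim: n f => [//|n IH] f /=; rewrite !IH; field. Qed.

Lemma meanN n f : mean n (fun x => - f x) = - mean n f.
Proof.
rewrite -mulN1r -meanZ; congr mean; apply/funext => x; by rewrite mulN1r.
Qed.

(* Discrete integration by parts, the source of the Gaussian limit law. *)
Lemma mean_id_mul n f : mean n.+1 (fun x => x * f x) =
  n.+1%:R / 2 * (mean n (fun x => f (x + 1)) - mean n (fun x => f (x - 1))).
Proof.
elim: n f => [|n IH] f; first by rewrite /=; field.
have e1 : mean n.+1 (fun x => (x + 1) * f (x + 1)) =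
    mean n.+1 (fun x => x * f (x + 1)) + mean n.+1 (fun x => f (x + 1)).
  by rewrite -meanD; apply: eq_mean => x; rewrite mulrDl mul1r.
have e2 : mean n.+1 (fun x => (x - 1) * f (x - 1)) =
    mean n.+1 (fun x => x * f (x - 1)) - mean n.+1 (fun x => f (x - 1)).
  by rewrite -meanN -meanD; apply: eq_mean => x; rewrite mulrBl mul1r.
rewrite [LHS]meanS e1 e2 (IH (fun x => f (x + 1))) (IH (fun x => f (x - 1))) !meanS.
have h1 : mean n (fun x => f (x - 1 + 1)) = mean n (fun x => f (x + 1 - 1)).
  by apply: eq_mean => x; congr f; ring.
by rewrite h1 -[n.+2%:R]natr1; field.
Qed.

(** The exponential moment factors over the signs; the shift [a] absorbs the sign that the induction
    splits off. *)
Lemma mean_expR n u a : mean n (fun x => expR (u * (x + a))) =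
  expR (u * a) * ((expR u + expR (- u)) / 2) ^+ n.
Proof.
elim: n a => [|n IH] a /=; first by rewrite add0r expr0 mulr1.
rewrite (_ : (fun x => expR (u * (x + 1 + a))) = fun x => expR (u * (x + (a + 1)))); last first.
  by apply/funext => x; congr (expR (u * _)); ring.
rewrite (_ : (fun x => expR (u * (x - 1 + a))) = fun x => expR (u * (x + (a - 1)))); last first.
  by apply/funext => x; congr (expR (u * _)); ring.
by rewrite !IH !mulrDr !expRD exprS !mulr1 mulrN1; field.
Qed.

(** The constant 2 replaces the sharp $1/2$, which costs only a constant in the tails. For $|u|>1/2$
    one has $|u|\le 2u^2$; otherwise $e^v\le 1+v+2v^2$ is applied to $u$ and $-u$, whose linear
    terms cancel. *)
Lemma cosh_le_expR u : (expR u + expR (- u)) / 2 <= expR (2 * u ^+ 2) :> R.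
Proof.
have [u1|u1] := lerP `|u| 2^-1; last first.
  have h v : v <= `|u| -> expR v <= expR (2 * u ^+ 2).
    move=> vu; rewrite ler_expR (le_trans vu)// -(real_normK (num_real u)).
    by have := normr_ge0 u; nra.
  have := h u (ler_norm u); have := h (- u).
  by rewrite -{1}(normrN u) ler_norm => /(_ isT); lra.
have h (v : R) : `|v| <= 2^-1 -> expR v <= 1 + v + 2 * v ^+ 2.
  rewrite ler_norml => /andP[v1 v2].
  (* $e^v=1/e^{-v}$ with $e^{-v}\ge 1-v$, and $(1+v+2v^2)(1-v)=1+v^2(1-2v)\ge 1$. *)
  rewrite -[v in expR v]opprK expRN.
  have e := expR_ge1Dx (- v).
  rewrite -[leLHS]mul1r ler_pdivrMr ?expR_gt0//.
  have pos : 0 <= 1 + v + 2 * v ^+ 2 by nra.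
  apply: (le_trans _ (ler_wpM2l pos e)).
  have : 0 <= v ^+ 2 * (1 - 2 * v) by rewrite mulr_ge0 ?sqr_ge0//; lra.
  by lra.
have h1 := h u u1; have := h (- u); rewrite normrN sqrrN => /(_ u1) h2.
have := expR_ge1Dx (2 * u ^+ 2); lra.
Qed.

(** Chernoff bound. [D] is any bound on the number of signs, and $u=l/(4D)$ minimizes the exponent
    $2Du^2-ul$, with minimum $-l^2/(8D)$. *)
Lemma mean_tail n (D l : R) : 0 < D -> n%:R <= D -> 0 <= l ->
  mean n (fun x => (l <= `|x|)%R%:R) <= 2 * expR (- (l ^+ 2 / (8 * D))).
Proof.
move=> D0 nD l0; pose u := l / (4 * D).
have u0 : 0 <= u by rewrite /u divr_ge0//; lra.
pose c := (expR u + expR (- u)) / 2.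
have : mean n (fun x => (l <= `|x|)%R%:R) <=
    mean n (fun x => expR (- (u * l)) * (expR (u * (x + 0)) + expR ((- u) * (x + 0)))).
  apply: le_mean => x; rewrite addr0; have [lx|_] := boolP (l <= _); last first.
    by rewrite mulr_ge0 ?addr_ge0 ?expR_ge0.
  rewrite mulr1n mulrDr -!expRD.
  have [x0|x0] := leP 0 x.
    have := expR_ge0 (- (u * l) + - u * x).
    have : 1 <= expR (- (u * l) + u * x).
      by rewrite -expR0 ler_expR; move: lx; rewrite ger0_norm//; nra.
    by lra.
  have := expR_ge0 (- (u * l) + u * x).
  have : 1 <= expR (- (u * l) + - u * x).
    by rewrite -expR0 ler_expR; move: lx; rewrite ltr0_norm//; nra.
  by lra.
move/le_trans; apply.
rewrite meanZ meanD !mean_expR !mulr0 expR0 !mul1r opprK [expR (- u) + _]addrC -/c.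
have : c ^+ n <= expR (l ^+ 2 / (8 * D)).
  have c0 : 0 <= c by rewrite divr_ge0 ?addr_ge0 ?expR_ge0.
  have cl : c <= expR (2 * u ^+ 2) by exact: cosh_le_expR.
  apply: (le_trans (lerXn2r n _ _ cl)); rewrite ?nnegrE ?expR_ge0//.
  rewrite -expRM_natr ler_expR /u.
  rewrite (_ : 2 * (l / (4 * D)) ^+ 2 * n%:R = l ^+ 2 / (8 * D) * (n%:R / D)); last first.
    by field; rewrite gt_eqF.
  by rewrite ler_piMr ?divr_ge0 ?sqr_ge0// ?ler_pdivrMr ?mul1r//; lra.
have -> : - (l ^+ 2 / (8 * D)) = - (u * l) + l ^+ 2 / (8 * D).
  by rewrite /u; field; rewrite gt_eqF.
rewrite expRD => h; rewrite -mulr2n mulrCA ler_pM2l ?expR_gt0//.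
by rewrite -[c ^+ n *+ 2]mulr_natl ler_pM2l.
Qed.

End mean.

Section sign_sums.
Context d (Omega : measurableType d) (R : realType) (P : probability Omega R).

Definition signsum (x : nat -> bool) (n : nat) : R := \sum_(k < n) (-1) ^+ x k.

Lemma signsumS x n : signsum x n.+1 = signsum x n + (-1) ^+ x n.
Proof. by rewrite /signsum big_ord_recr. Qed.

Lemma signsum0 x : signsum x 0 = 0.
Proof. by rewrite /signsum big_ord0. Qed.

Variable eta : nat -> Omega -> bool.
Hypothesis meta : forall k, measurable [set w | eta k w].

Lemma measurable_sign k : measurable_fun setT (fun w => (-1) ^+ eta k w : R).
Proof.
apply: (@eq_measurable_fun _ _ _ _ _ (fun w => if eta k w then -1 else 1 : R)).
  by move=> w _; case: (eta k w); rewrite ?expr1 ?expr0.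
apply: measurable_fun_ifT => //; apply: (measurable_fun_bool true).
by rewrite setTI; exact: meta.
Qed.

Lemma measurable_signsum n : measurable_fun setT (fun w => signsum (eta ^~ w) n).
Proof. by apply: measurable_sum => k; exact: measurable_sign. Qed.

(** [A] is an event of mass [p] independent of the first [n] signs, which is what the last
    hypothesis expresses. The induction needs this generality, since it intersects [A] with the
    value of the last sign and halves [p]; it also yields the independence of blocks later. *)
Lemma mean_integral n (A : set Omega) (p : R) (f : R -> R) :
  measurable A -> measurable_fun setT f ->
  (forall e, P (A `&` [set w | agree (iota 0 n) e (eta ^~ w)]) =
     (p * 2^-1 ^+ n)%:E) ->
  (\int[P]_(w in A) (f (signsum (eta ^~ w) n))%:E = (p * mean n f)%:E)%E.
Proof.
elim: n A p f => [|n IH] A p f mA mf pA.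
  under eq_integral do rewrite signsum0.
  rewrite [LHS](_ : _ = (f 0)%:E * P A)%E; last exact: integral_cst.
  have := pA (fun=> false); rewrite [X in _ `&` X](_ : _ = setT); last first.
    by apply/seteqP; split.
  by rewrite setIT expr0 mulr1 => ->; rewrite /= -EFinM mulrC.
have mAb b : measurable (A `&` [set w | eta n w == b]).
  by apply: measurableI => //; exact: measurable_bit_eq.
have {1}-> : A = (A `&` [set w | eta n w == false]) `|` (A `&` [set w | eta n w == true]).
  rewrite -setIUr (_ : _ `|` _ = setT) ?setIT//.
  by apply/seteqP; split => w //= _; case: (eta n w); [right|left].
rewrite integral_setU//; last 2 first.
- apply/measurable_EFinP; apply: measurable_funTS.
  by apply: measurableT_comp => //; exact: measurable_signsum.
- by apply/disj_setPS => w /= [[_ /eqP->] [_]].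
have step (b : bool) (g : R -> R) : measurable_fun setT g ->
    (forall x, g x = f (x + (-1) ^+ b)) ->
    (\int[P]_(w in A `&` [set w | eta n w == b]) (f (signsum (eta ^~ w) n.+1))%:E =
    (p / 2 * mean n g)%:E)%E.
  move=> mg gf; rewrite -(IH (A `&` [set w | eta n w == b]))//.
    by apply: eq_integral => w; rewrite inE => -[_ /eqP wb]; rewrite signsumS gf wb.
  move=> e; rewrite -mulrA -exprS -(pA (fun k => if k == n then b else e k)) -setIA.
  have E : iota 0 n.+1 = iota 0 n ++ [:: n] by rewrite -addn1 iotaD.
  congr (P (_ `&` _)); rewrite /agree E; apply/seteqP; split => w; rewrite /= all_cat/= andbT eqxx.
    move=> [wb ag]; rewrite wb andbT; apply/allP => k kn.
    move: (kn); rewrite mem_iota => /= kn'; rewrite (_ : k == n = false) ?(allP ag)//.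
    by apply/negP => /eqP; lia.
  move=> /andP[ag wb]; split => //; apply/allP => k kn.
  have := allP ag _ kn; move: kn; rewrite mem_iota => /= kn.
  by rewrite (_ : k == n = false)//; apply/negP => /eqP; lia.
rewrite (step false (fun x => f (x + 1)))//; last first.
  apply: (@measurableT_comp _ _ _ _ _ _ f) => //.
  exact: measurable_funD.
rewrite (step true (fun x => f (x - 1)))//; last first.
  apply: (@measurableT_comp _ _ _ _ _ _ f) => //.
  exact: measurable_funB.
by rewrite -EFinD meanS; congr (_%:E); field.
Qed.

Lemma mean_prob n (A : set Omega) (p : R) (B : set R) :
  measurable A -> measurable B ->
  (forall e, P (A `&` [set w | agree (iota 0 n) e (eta ^~ w)]) =
     (p * 2^-1 ^+ n)%:E) ->
  P (A `&` [set w | B (signsum (eta ^~ w) n)]) = (p * mean n \1_B)%:E.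
Proof.
move=> mA mB pA; rewrite -(mean_integral mA _ pA)//.
rewrite setIC -integral_indic//.
rewrite -[X in measurable X]setTI; exact: measurable_signsum.
Qed.

End sign_sums.

Section tails.
Context d (Omega : measurableType d) (R : realType) (P : probability Omega R).
Variable eta : nat -> Omega -> bool.
Hypothesis meta : forall k, measurable [set w | eta k w].
Hypothesis feta : fair P eta.

Lemma signsum_tail (a n : nat) (D l : R) : 0 < D -> n%:R <= D -> 0 <= l ->
  (P [set w | l <= `|signsum R (eta ^~ w) (a + n) - signsum R (eta ^~ w) a|]%R <=
   (2 * expR (- (l ^+ 2 / (8 * D))))%:E)%E.
Proof.
move=> D0 nD l0.
rewrite [X in P X](_ : _ = setT `&`
    [set w | [set x : R | l <= `|x|] (signsum R (fun k => eta (a + k) w) n)]).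
  rewrite (@mean_prob _ _ _ _ _ _ n setT 1)//.
  - rewrite mul1r lee_fin; apply: le_trans (mean_tail D0 nD l0).
    by apply: le_mean => x; rewrite indicE mem_setE.
  - rewrite (_ : [set _ | _] = [set` `]-oo, -l] ] `|` [set` `[l, +oo[]).
      by apply: measurableU; exact: measurable_itv.
    by apply/seteqP; split => x /=; rewrite !in_itv/= andbT ler_normr lerNr;
      [move=> /orP[]; [right|left]|case=> ->; rewrite ?orbT].
  - move=> e; rewrite setTI mul1r -[in RHS](size_iota a n).
    rewrite -(feta (fun k => e (k - a)%N) (iota_uniq a n)).
    congr (P _); apply/seteqP; split => w /allP h; apply/allP => k; rewrite mem_iota => kn.
      have := h (k - a)%N; rewrite mem_iota subnKC//=; [apply; lia|lia].
    have := h (a + k)%N; rewrite mem_iota addKn/=; apply; lia.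
rewrite setTI; apply/seteqP; split => w /=; rewrite /signsum big_split_ord/= addrAC subrr add0r//.
Qed.

End tails.

(** * Twisted walks *)

Section hitting.
Variable R : realType.
Implicit Types (S x : nat -> R) (b c : nat -> bool).

Lemma next_timeP S a n : next_time S a = Some n <->
  [/\ (a < n)%N, `|S n - S a| = 2 &
      forall i, (a < i < n)%N -> `|S i - S a| <> 2].
Proof.
rewrite /next_time; case: pselect => [e|ne]; last first.
  by split=> // -[an Sn _]; exfalso; apply: ne; exists n; rewrite an Sn eqxx.
case: ex_minnP => m /andP[am /eqP Sm] mmin; split => [[<-]|[an Sn nS]].
  split => // i /andP[ai im] Si.
  by have := mmin i; rewrite ai Si eqxx leqNgt im => /(_ isT).
congr Some; case: (ltngtP m n) => // mn.
  by have := nS m; rewrite am mn => /(_ isT).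
by have := mmin n; rewrite an Sn eqxx leqNgt mn => /(_ isT).
Qed.

Lemma hitting_timeSP S k n : hitting_time S k.+1 = Some n <->
  exists a, hitting_time S k = Some a /\ next_time S a = Some n.
Proof.
rewrite /=; case: (hitting_time S k) => [a|] /=; last by split => // -[a []].
by split => [h|[a' [[->]]]//]; exists a.
Qed.

Lemma hitting_time_le S k l a a' : (k <= l)%N -> hitting_time S k = Some a ->
  hitting_time S l = Some a' -> (a <= a')%N.
Proof.
elim: l a' => [|l IH] a'; first by rewrite leqn0 => /eqP-> -> [->].
rewrite leq_eqVlt => /predU1P[-> -> [->]//|]; rewrite ltnS => kl ha.
move=> /hitting_timeSP[a'' [ha'' /next_timeP[aa' _ _]]].
exact: leq_trans (IH _ kl ha ha'') (ltnW aa').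
Qed.

Lemma walk_signsum x b : (forall k, x k.+1 = (-1) ^+ b k) -> walk x = signsum R b.
Proof.
move=> xb; apply/funext => n; rewrite /walk /signsum big_add1 big_mkord.
by apply: eq_bigr => k _.
Qed.

Lemma signsum_pair b i : signsum R b i.+1.*2 =
  signsum R b i.*2 + (if same_pair b i then 2 * (-1) ^+ b i.*2.+1 else 0).
Proof.
rewrite doubleS !signsumS -addrA; congr (_ + _); rewrite /same_pair.
by case: (b i.*2); case: (b i.*2.+1); rewrite /= ?expr0 ?expr1; ring.
Qed.

Lemma signsum_gap b i j : (i <= j)%N ->
  (forall l, (i <= l < j)%N -> ~~ same_pair b l) ->
  signsum R b j.*2 = signsum R b i.*2.
Proof.
elim: j => [|j IH]; first by rewrite leqn0 => /eqP->.
rewrite leq_eqVlt => /predU1P[->//|]; rewrite ltnS => ij nb.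
rewrite signsum_pair (negbTE (nb j _)) ?ij ?leqnn// addr0.
by apply: IH => // l /andP[il lj]; apply: nb; rewrite il ltnS ltnW.
Qed.

(** Before the first equal pair is complete, the walk is back at its start at even times and at
    distance 1 from it at odd times; the equal pair then moves it by 2. *)
Lemma next_time_pair b i j : (i <= j)%N -> same_pair b j ->
  (forall l, (i <= l < j)%N -> ~~ same_pair b l) ->
  next_time (signsum R b) i.*2 = Some j.+1.*2.
Proof.
move=> ij bj nb; apply/next_timeP; split; first lia.
  rewrite signsum_pair bj (signsum_gap ij nb) addrAC subrr add0r normrM.
  by rewrite normrX normrN1 expr1n mulr1 ger0_norm.
move=> n /andP[iN nj].
have nb' l : (i <= l < n./2)%N -> ~~ same_pair b l by move=> h; apply: nb; lia.
rewrite -(odd_double_half n); case: (odd n) => /=; last first.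
  rewrite add0n (signsum_gap _ nb'); last lia.
  by rewrite subrr normr0 => /eqP; rewrite eq_sym pnatr_eq0.
rewrite add1n signsumS (signsum_gap _ nb'); last lia.
rewrite addrAC subrr add0r normrX normrN1 expr1n; lra.
Qed.

(** The witness is the start of the block that contains pair [l]: the origin or the end of the
    preceding equal pair. *)
Lemma last_pair b l : exists i, [/\ (i <= l)%N,
    i = 0%N \/ (exists2 k, i = k.+1 & same_pair b k) &
    forall k, (i <= k < l)%N -> ~~ same_pair b k].
Proof.
elim: l => [|l [i [il hi nb]]]; first by exists 0%N; split; [|left|move=> k; rewrite ltn0 andbF].
have [bl|bl] := boolP (same_pair b l).
  by exists l.+1; split; [|right; exists l|move=> k; lia].
exists i; split => //; first exact: leqW.
by move=> k; have [->//|kl h] := eqVneq k l; apply: nb; lia.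
Qed.

Lemma hitting_time_pair b j : j = 0%N \/ (exists2 l, j = l.+1 & same_pair b l) ->
  hitting_time (signsum R b) (cnt (same_pair b) j) = Some j.*2.
Proof.
elim/ltn_ind: j => j IH [->|[l jl bl]]; first by rewrite cnt0.
rewrite jl cntS bl addn1; apply/hitting_timeSP.
have [i [il hi nb]] := last_pair b l.
have -> : cnt (same_pair b) l = cnt (same_pair b) i by exact: cnt_gap.
exists i.*2; split; last exact: next_time_pair.
by apply: IH => //; rewrite jl ltnS.
Qed.

(** Step [p.+1] sits at position [p], and its block ends with the first equal pair from there on.
    Such a pair is assumed to exist because the conventions differ otherwise: [twist] then gives the
    opposite of the step, [bit_twist] the step itself. *)
Lemma twist_bit_twist x y b c p :
  (forall k, x k.+1 = (-1) ^+ b k) -> (forall k, y k.+1 = (-1) ^+ c k) ->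
  (exists2 j, (p./2 <= j)%N & same_pair b j) ->
  twist x y p.+1 = (-1) ^+ bit_twist (same_pair b) b c p.
Proof.
move=> xb yc [j0 pj0 bj0]; rewrite /twist (walk_signsum xb).
have := firstP (same_pair b) p./2.
case E : first => [j|]; last by move=> /(_ j0 pj0); rewrite bj0.
case=> pj bj nb; rewrite (bit_twist_some _ _ E).
set k := cnt (same_pair b) j.
have [i [il hi nb']] := last_pair b p./2.
have ki : cnt (same_pair b) i = k.
  rewrite /k -(cnt_gap il nb') (cnt_gap pj nb)//.
have gap l : (i <= l < j)%N -> ~~ same_pair b l.
  by move=> /andP[h1 h2]; have [h|h] := ltnP l p./2; [apply: nb'|apply: nb]; lia.
have hk : hitting_time (signsum R b) k = Some i.*2.
  by rewrite -ki; exact: hitting_time_pair.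
have hk1 : hitting_time (signsum R b) k.+1 = Some j.+1.*2.
  apply/hitting_timeSP; exists i.*2; split => //.
  by apply: next_time_pair => //; lia.
(* Hitting times increase, so only block [k] can contain step [p.+1]. *)
have ub (k' a' b' : nat) : hitting_time (signsum R b) k' = Some a' ->
    hitting_time (signsum R b) k'.+1 = Some b' -> (a' < p.+1 <= b')%N -> k' = k.
  move=> h h1 pab; case: (ltngtP k' k) => // kk.
    have := hitting_time_le kk h1 hk; lia.
  by have := hitting_time_le kk hk1 h; lia.
have inc : signsum R b j.+1.*2 - signsum R b i.*2 = 2 * (-1) ^+ b j.*2.+1.
  rewrite signsum_pair bj (signsum_gap _ gap); last lia.
  by rewrite addrAC subrr add0r.
rewrite xb; case: asboolP => [[k' [a [b' [h h1 pab]]]]|nex].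
  have kk := ub _ _ _ h h1 pab; move: h h1; rewrite kk hk hk1 => -[<-] [<-].
  rewrite inc yc => e; have : (-1) ^+ b j.*2.+1 = (-1) ^+ c k :> R by lra.
  by case: (b j.*2.+1) (c k) (b p) => -[] [] //=; rewrite ?expr0 ?expr1 //; lra.
(* Block [k] exists, so only the sign condition can have failed. *)
have ne : b j.*2.+1 <> c k.
  move=> e; apply: nex; exists k, i.*2, j.+1.*2; split => //; last by rewrite inc yc e.
  lia.
by case: (b j.*2.+1) (c k) (b p) ne => -[] [] //=; rewrite ?expr0 ?expr1 ?opprK.
Qed.

(** An unequal pair does not move the walk; an equal one moves it by twice its last sign, which
    twisting has set to the next sign of [c]. *)
Lemma signsum_twist b c j : signsum R (bit_twist (same_pair b) b c) j.*2 =
  2 * signsum R c (cnt (same_pair b) j).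
Proof.
elim: j => [|j IH]; first by rewrite cnt0 !signsum0 mulr0.
rewrite signsum_pair IH same_pair_twist cntS; have [bj|_] := ifPn.
  by rewrite bit_twist_last// addn1 signsumS mulrDr.
by rewrite addn0 addr0.
Qed.

(** The product of the two signs of a pair is 1 if they are equal and -1 if not. The number of
    completed blocks is thus governed by a sum of signs, which opens the random time change to the
    tail bounds. *)
Lemma signsum_same_pair b j :
  (cnt (same_pair b) j)%:R *+ 2 = j%:R + signsum R (fun i => b i.*2 (+) b i.*2.+1) j.
Proof.
elim: j => [|j IH]; first by rewrite cnt0 signsum0 mul0rn addr0.
rewrite cntS natrD mulrnDl IH signsumS -natr1 /same_pair.
by case: (b j.*2); case: (b _); rewrite /= ?expr0 ?expr1; ring.
Qed.

End hitting.

(** * Fair families obtained from fair families *)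

Section fair_constructions.
Context d (Omega : measurableType d) (R : realType) (P : probability Omega R).

Lemma seq_ub (s : seq nat) : exists N, forall i, i \in s -> (i < N)%N.
Proof.
exists (\max_(i <- s) i).+1 => i si; rewrite ltnS.
exact: (leq_bigmax_seq (F := id)).
Qed.

Lemma fair_relabel (I J : choiceType) (f : J -> I) (g : I -> J)
  (zeta : I -> Omega -> bool) : cancel f g -> fair P zeta ->
  fair P (fun j => zeta (f j)).
Proof.
move=> fK fz s e us; rewrite -(size_map f) -(fz _ (e \o g)).
  congr (P _); apply/seteqP; split => w; rewrite /agree/= all_map;
  by apply: sub_all => i /=; rewrite fK.
by rewrite map_inj_uniq//; exact: can_inj fK.
Qed.

(** Replacing the first sign of each pair by the product of the pair, and keeping the second, is an
    involution. *)
Lemma fair_pairs (eta : nat -> Omega -> bool) :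
  (forall k, measurable [set w | eta k w]) -> fair P eta ->
  fair P (fun k w => eta k.*2 w (+) eta k.*2.+1 w).
Proof.
move=> meta feta s e us; have [N sN] := seq_ub s.
pose Phi (z : nat -> bool) p := if odd p then z p else z p (+) z p.+1.
pose Q := agree (map double s) (e \o half).
rewrite -(size_map double) -(feta _ (e \o half)); last first.
  by rewrite map_inj_uniq//; exact: double_inj.
rewrite -(@fair_involution _ _ _ _ _ _ meta (iota 0 N.*2) (iota_uniq _ _) Phi Q feta).
- congr (P _); apply/seteqP; split => w; rewrite /Q /agree/= all_map;
  by apply: sub_all => i /=; rewrite /Phi odd_double doubleK.
- move=> x x' xx'; apply: eq_in_all => p /mapP[i /sN iN ->].
  by rewrite xx'// mem_iota; lia.
- move=> x x' xx' p; rewrite mem_iota /Phi => pN.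
  by case: ifPn => op; rewrite !xx' ?mem_iota//; lia.
- move=> x p; rewrite /Phi /=; case: (boolP (odd p)) => //= op.
  by rewrite -addbA addbb addbF.
Qed.

Lemma probability_diff (A A' C : set Omega) (c : R) :
  measurable A -> measurable A' -> measurable C -> (P C <= c%:E)%E ->
  (forall w, ~ C w -> A w <-> A' w) ->
  `|fine (P A) - fine (P A')| <= c.
Proof.
move=> mA mA' mC Cc AA'.
have h (B B' : set Omega) : measurable B -> measurable B' ->
    (forall w, ~ C w -> B w <-> B' w) -> fine (P B) <= fine (P B') + c.
  move=> mB mB' BB'; rewrite -lee_fin EFinD !fineK ?fin_num_measure//.
  apply: (@le_trans _ _ (P B' + P C)%E); last by rewrite leeD2l.
  apply: le_trans (measureU2 _ _ _) => //.
  apply: le_measure; rewrite ?inE//; first exact: measurableU.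
  by move=> w Bw; have [|/BB' h] := pselect (C w); [right|left; apply/h].
have h1 := h A A' mA mA' AA'.
have h2 := h A' A mA' mA (fun w nC => iff_sym (AA' w nC)).
by rewrite ler_norml; lra.
Qed.

End fair_constructions.

(** * Joint law of the twisted steps of a level and the raw steps of later levels *)

Section levels.
Context d (Omega : measurableType d) (R : realType) (P : probability Omega R).
Variable X : nat -> nat -> Omega -> R.
Hypothesis mX : forall m k, measurable_fun setT (X m k).
Hypothesis X_law : forall m k : nat, (1 <= k)%N ->
  P (X m k @^-1` [set 1]) = (1 / 2)%:E /\ P (X m k @^-1` [set -1]) = (1 / 2)%:E.
Hypothesis X_indep : mutually_independent P [set i : nat * nat | (1 <= i.2)%N]
  (fun i : nat * nat => X i.1 i.2).

Definition steps m n w : R := twisted_step (fun i k => X i k w) m n.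

Lemma measurable_preimage1 (f : Omega -> R) (r : R) :
  measurable_fun setT f -> measurable [set w | f w = r].
Proof.
by move=> mf; rewrite -[X in measurable X]setTI; exact: (mf measurableT [set r]).
Qed.

Lemma measurable_walk (x : nat -> Omega -> R) n :
  (forall k, measurable_fun setT (x k)) ->
  measurable_fun setT (fun w => walk (x ^~ w) n).
Proof. by move=> mx; exact: (@measurable_sum _ _ _ _ _ (index_iota 1 n.+1) x). Qed.

Lemma measurable_hitting_time (S : nat -> Omega -> R) k a :
  (forall k, measurable_fun setT (S k)) ->
  measurable [set w | hitting_time (S ^~ w) k = Some a].
Proof.
move=> mS; elim: k a => [|k IH] a; first exact: (measurable_constp _ (Some 0%N = Some a)).
rewrite (_ : [set _ | _] = [set w | exists a', hitting_time (S ^~ w) k = Some a' /\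
    ((a' < a)%N /\ (`|S a w - S a' w| = 2 /\
     forall i, (a' < i < a)%N -> ~ (`|S i w - S a' w| = 2)))]); last first.
  apply/seteqP; split => w /=.
    by move=> /hitting_timeSP[a' [ha' /next_timeP[? ? ?]]]; exists a'.
  move=> [a' [ha' [? [? ?]]]]; apply/hitting_timeSP; exists a'; split => //.
  exact/next_timeP.
have mdist i j : measurable [set w | `|S i w - S j w| = 2].
  apply: measurable_preimage1; apply: measurableT_comp => //.
  exact: measurable_funB.
apply: measurable_ex => a'; apply: measurable_conj => //.
apply: measurable_conj; first exact: measurable_constp.
apply: measurable_conj => //; apply: measurable_all => i.
apply: measurable_impl; first exact: measurable_constp.
by apply: measurable_notp; exact: mdist.
Qed.

Lemma measurable_steps m n : measurable_fun setT (steps m n).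
Proof.
elim: m n => [|m IH] n; first exact: mX.
rewrite /steps /= /twist; apply: measurable_fun_ifT; last 2 first.
- exact: mX.
- exact: measurableT_comp.
apply: (measurable_fun_bool true); rewrite setTI.
rewrite (_ : _ @^-1` _ = [set w | exists k a b,
    hitting_time (fun i => walk (fun k => X m.+1 k w) i) k = Some a /\
    (hitting_time (fun i => walk (fun k => X m.+1 k w) i) k.+1 = Some b /\
    ((a < n <= b)%N /\ walk (fun k => X m.+1 k w) b - walk (fun k => X m.+1 k w) a =
     2 * steps m k.+1 w))]); last first.
  apply/seteqP; split => w /=.
    by move/asboolP => [k [a [b [? ? ? ?]]]]; exists k, a, b.
  by move=> [k [a [b [? [? [? ?]]]]]]; apply/asboolP; exists k, a, b.
have mw i := @measurable_walk (X m.+1) i (mX m.+1).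
apply: measurable_ex => k; apply: measurable_ex => a; apply: measurable_ex => b.
apply: measurable_conj; first exact: measurable_hitting_time.
apply: measurable_conj; first exact: measurable_hitting_time.
apply: measurable_conj; first exact: measurable_constp.
rewrite (_ : [set _ | _] = [set w |
   walk (fun k => X m.+1 k w) b - walk (fun k => X m.+1 k w) a - 2 * steps m k.+1 w = 0]).
  apply: measurable_preimage1; apply: measurable_funB; first exact: measurable_funB.
  exact: measurable_funM.
apply/seteqP; split => w /=; first by move->; rewrite subrr.
by move/eqP; rewrite subr_eq0 => /eqP.
Qed.

(** [true] codes the value -1, and position [k] is step [k.+1], since step 0 has no prescribed
    law. *)
Definition raw_bit (i : nat * nat) w : bool := X i.1 i.2.+1 w == -1.

(* Row 0 holds the twisted steps of level [m], row [i > 0] the raw steps of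
   level [m + i]. *)
Definition level_bit m (i : nat * nat) w : bool :=
  if i.1 == 0%N then steps m i.2.+1 w == -1 else raw_bit (m + i.1, i.2)%N w.

Lemma measurable_level_bit m i : measurable [set w | level_bit m i w].
Proof.
case: i => -[|i] k; rewrite /level_bit/= ?/raw_bit/=.
  rewrite (_ : [set _ | _] = [set w | steps m k.+1 w = -1]).
    exact/measurable_preimage1/measurable_steps.
  by apply/seteqP; split => w /= /eqP.
rewrite (_ : [set _ | _] = [set w | X (m + i.+1)%N k.+1 w = -1]).
  exact/measurable_preimage1.
by apply/seteqP; split => w /= /eqP.
Qed.

Lemma fair_raw_bit : fair P raw_bit.
Proof.
move=> s e us; pose f (i : nat * nat) := (i.1, i.2.+1).
(* The bit [false] means any value other than -1, so its event is a complement and no exceptional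
   set enters. The predecessor undoes the index shift of [f]. *)
pose A (i : nat * nat) : set R := if e (i.1, i.2.-1) then [set -1] else ~` [set -1].
have mA i : measurable (A i).
  by rewrite /A; case: ifP => _ //; apply: measurableC.
have uf : uniq (map f s) by rewrite map_inj_uniq// => -[a b] [a' b'] [-> ->].
pose J := seq_fset tt (map f s).
have Js : perm_eq J (map f s) by rewrite -[X in perm_eq _ X](undup_id uf); exact: seq_fset_perm.
have JE i : (i \in J) = (i \in map f s) by rewrite (perm_mem Js).
have half i : i \in map f s -> P (X i.1 i.2 @^-1` A i) = (2^-1)%:E.
  move=> /mapP[[m k] ks ->]; rewrite /A /=.
  have [_ h] := X_law m (ltn0Sn k); rewrite div1r in h.
  case: ifP => _ //; rewrite -preimage_setC probability_setC.
    by rewrite h -EFinB; congr (_%:E); field.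
  exact: measurable_preimage1.
rewrite (_ : [set w | _] = \bigcap_(i in [set` J]) (X i.1 i.2 @^-1` A i)).
  have -> := X_indep (J := J) (A := A); [|by move=> i /=; rewrite JE => /mapP[j _ ->]|by []].
  rewrite (perm_big (map f s))/=; last exact: Js.
  rewrite (eq_big_seq (fun=> (2^-1)%:E)); last exact: half.
  by rewrite prodEFin big_const_seq count_predT iter_mulr_1 size_map.
apply/seteqP; split => w.
  move=> /allP h i /=; rewrite JE => /mapP[[m k] ks ->] /=.
  by have := h _ ks; rewrite /raw_bit /A /=; case: (e _) => /eqP; case: eqP.
move=> h; apply/allP => -[m k] ks; have := h (m, k.+1).
rewrite /= JE => /(_ (map_f f ks)); rewrite /A /raw_bit /=.
case: (e _) => /= [->|h']; first by rewrite eqxx.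
by apply/eqP/negbTE/eqP.
Qed.

Definition bad_values : set Omega :=
  [set w | exists m k, ~ (X m k.+1 w = 1) /\ ~ (X m k.+1 w = -1)].

Lemma measurable_bad_values : measurable bad_values.
Proof.
apply: measurable_ex => m; apply: measurable_ex => k; apply: measurable_conj;
by apply: measurable_notp; exact: measurable_preimage1.
Qed.

Lemma bad_values0 : P bad_values = 0%E.
Proof.
have h m k : P [set w | ~ (X m k.+1 w = 1) /\ ~ (X m k.+1 w = -1)] = 0%E.
  rewrite (_ : [set _ | _] = ~` ((X m k.+1 @^-1` [set 1]) `|` (X m k.+1 @^-1` [set -1]))).
    have [h1 h2] := X_law m (ltn0Sn k).
    have m1 r : measurable (X m k.+1 @^-1` [set r]) by exact: measurable_preimage1.
    rewrite probability_setC; last exact: measurableU.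
    rewrite measureU//; last first.
      by apply/seteqP; split => w //= [-> ]; lra.
    by rewrite [X in (_ - (X + _))%E]h1 [X in (_ - (_ + X))%E]h2 -EFinD -splitr subrr.
  by rewrite setCU.
have mh m k : measurable [set w | ~ (X m k.+1 w = 1) /\ ~ (X m k.+1 w = -1)].
  by apply: measurable_conj; apply: measurable_notp; exact: measurable_preimage1.
rewrite (_ : bad_values = \bigcup_m \bigcup_k
    [set w | ~ (X m k.+1 w = 1) /\ ~ (X m k.+1 w = -1)]); last first.
  by apply/seteqP; split => w; [move=> [m [k h']]; exists m => //; exists k|move=> [m _ [k _ h']]; exists m, k].
apply/negligibleP; first by do 2! (apply: bigcupT_measurable => ?).
apply: negligible_bigcup => m; apply: negligible_bigcup => k.
apply/negligibleP; [exact: mh|exact: h].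
Qed.

Lemma raw_signs w : ~ bad_values w ->
  forall m k, X m k.+1 w = (-1) ^+ raw_bit (m, k) w.
Proof.
move=> nb m k; rewrite /raw_bit/=; have [->|h] := eqVneq; first by rewrite expr1.
apply: contrapT => h1; apply: nb; exists m, k; split; first by rewrite expr0 in h1.
exact/eqP.
Qed.

Lemma steps_signs w : ~ bad_values w ->
  forall m k, steps m k.+1 w = (-1) ^+ level_bit m (0%N, k) w.
Proof.
move=> nb m k; rewrite /level_bit /=.
suff [->|->] : steps m k.+1 w = 1 \/ steps m k.+1 w = -1.
- by rewrite (_ : _ == _ = false)//; apply/negP => /eqP; lra.
- by rewrite eqxx expr1.
have hX m' k' : X m' k'.+1 w = 1 \/ X m' k'.+1 w = -1.
  by rewrite (raw_signs nb); case: raw_bit; [right|left].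
case: m => [|m]; first exact: hX.
rewrite /steps /= /twist; case: ifP => _; have [->|->] := hX m.+1 k;
  rewrite ?opprK; first [by left | by right].
Qed.

(** Off this event some block ends among the [n] pairs from [J] on, so a truncation after them does
    not affect the positions before [J.*2]. *)
Definition pairs_differ m (J n : nat) : set Omega :=
  [set w | agree (iota J n) (fun=> true)
     (fun l => raw_bit (m, l.*2) w (+) raw_bit (m, l.*2.+1) w)].

Lemma measurable_raw_bit i : measurable [set w | raw_bit i w].
Proof.
rewrite (_ : [set _ | _] = [set w | X i.1 i.2.+1 w = -1]).
  exact: measurable_preimage1.
by apply/seteqP; split => w /= /eqP.
Qed.

Lemma fair_row_pairs m :
  fair P (fun l w => raw_bit (m, l.*2) w (+) raw_bit (m, l.*2.+1) w).
Proof.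
apply: (@fair_pairs _ _ _ _ (fun k => raw_bit (m, k))) => [k|].
  exact: measurable_raw_bit.
exact: (@fair_relabel _ _ _ _ _ _ (pair m) snd _ _ fair_raw_bit).
Qed.

Lemma measurable_row_pairs m l :
  measurable [set w | raw_bit (m, l.*2) w (+) raw_bit (m, l.*2.+1) w].
Proof.
have mr i b : measurable [set w | raw_bit i w == b].
  by apply: measurable_bit_eq => j; exact: measurable_raw_bit.
rewrite (_ : [set _ | _] =
  ([set w | raw_bit (m, l.*2) w == true] `&` [set w | raw_bit (m, l.*2.+1) w == false]) `|`
  ([set w | raw_bit (m, l.*2) w == false] `&` [set w | raw_bit (m, l.*2.+1) w == true])).
  by apply: measurableU; apply: measurableI.
apply/seteqP; split => w /=; case: raw_bit; case: raw_bit => //=; [left|right| |] => //;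
  by move=> [] [].
Qed.

Lemma measurable_pairs_differ m J n : measurable (pairs_differ m J n).
Proof. by apply: measurable_agree => l; exact: measurable_row_pairs. Qed.

Lemma pairs_differ_prob m J n : P (pairs_differ m J n) = (2^-1 ^+ n)%:E.
Proof. by rewrite (fair_row_pairs m)// ?size_iota// iota_uniq. Qed.

Lemma steps_bit_twist m p w : ~ bad_values w ->
  (exists2 j, (p./2 <= j)%N & same_pair (fun k => raw_bit (m.+1, k) w) j) ->
  level_bit m.+1 (0%N, p) w =
  bit_twist (same_pair (fun k => raw_bit (m.+1, k) w)) (fun k => raw_bit (m.+1, k) w)
    (fun k => level_bit m (0%N, k) w) p.
Proof.
move=> nb hp; rewrite {1}/level_bit/= {1}/steps/=.
rewrite (@twist_bit_twist _ _ _ (fun k => raw_bit (m.+1, k) w)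
  (fun k => level_bit m (0%N, k) w))//.
- case: bit_twist; rewrite ?expr1 ?eqxx// expr0.
  by apply/negP => /eqP; lra.
- exact: raw_signs.
- exact: steps_signs.
Qed.

(** Induction on the level. Up to truncation, rows 1, 2, ... of [twist_rows] applied to level [m]
    are rows 0, 1, ... of level [m.+1]; the shift [f] drops row 0, which holds the discarded
    signs. *)
Lemma fair_level_bit m : fair P (level_bit m).
Proof.
elim: m => [|m IH].
  rewrite (_ : level_bit 0 = raw_bit); first exact: fair_raw_bit.
  by apply/funext => -[[|i] k].
move=> s e us.
have [J sJ] := seq_ub (map snd s); have [M sM] := seq_ub (map fst s).
pose f (i : nat * nat) := (i.1.+1, i.2); pose g (i : nat * nat) := (i.1.-1, i.2).
have fK : cancel f g by case.
pose Q := agree (map f s) (e \o g).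
pose A := [set w | agree s e (level_bit m.+1 ^~ w)].
have mA : measurable A by apply: measurable_agree => i; exact: measurable_level_bit.
(* Neither term of the difference depends on [n], so an error of $2^{-n}$ for every [n] proves
   equality. *)
have close n : `|fine (P A) - 2^-1 ^+ size s| <= 2^-1 ^+ n.
  pose L := (J + n)%N.
  (* The columns below [L.*2] serve the truncated twist, and [J] bounds the positions in [s]; [M.+2]
     rows leave room for the shift by [f] and for rows 0 and 1, which are always read. *)
  pose box := [seq (k, p) | k <- iota 0 M.+2, p <- iota 0 (L.*2 + J)].
  have boxE k p : ((k, p) \in box) = (k < M.+2)%N && (p < L.*2 + J)%N.
    apply/allpairsP/andP => [[[k' p'] []]|[kM pL]].
      by rewrite !mem_iota => /= kM pL [-> ->].
    by exists (k, p); rewrite !mem_iota.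
  have ubox : uniq box by apply: allpairs_uniq; rewrite ?iota_uniq// => -[? ?] [? ?].
  have fsbox i : i \in map f s -> i \in box.
    move=> /mapP[[k p] ks ->]; rewrite boxE /=.
    have := sJ p (map_f snd ks); have := sM k (map_f fst ks); lia.
  have lQ : forall x x' : nat * nat -> bool, (forall i, i \in box -> x i = x' i) -> Q x = Q x'.
    by move=> x x' xx'; apply: eq_in_all => i /fsbox/xx'->.
  pose A' := [set w | Q (twist_rows L (level_bit m ^~ w))].
  have lT : forall x x' : nat * nat -> bool, (forall i, i \in box -> x i = x' i) ->
      forall i, i \in box -> twist_rows L x i = twist_rows L x' i.
    move=> x x' xx' [k p]; rewrite boxE => /andP[kM pL].
    by apply: twist_rows_local => k' p' /= hk hp; apply: xx'; rewrite boxE; lia.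
  have PA' : P A' = (2^-1 ^+ size s)%:E.
    rewrite /A' (@fair_involution _ _ _ _ _ _ (measurable_level_bit m) box ubox)//.
      by rewrite /Q IH ?size_map// map_inj_uniq//; exact: can_inj fK.
    by move=> x i; exact: twist_rowsK.
  rewrite (_ : 2^-1 ^+ size s = fine (P A')); last by rewrite PA'.
  apply: (@probability_diff _ _ _ _ _ _ (bad_values `|` pairs_differ m.+1 J n)) => //.
  - rewrite /A' (_ : [set _ | _] = [set w | (Q \o twist_rows L) (level_bit m ^~ w)])//.
    apply: (@measurable_local _ _ _ _ (measurable_level_bit m) box).
    by move=> x x' xx' /=; apply: lQ; exact: lT.
  - by apply: measurableU; [exact: measurable_bad_values|exact: measurable_pairs_differ].
  - apply: le_trans (measureU2 _ _ _) _; [exact: measurable_bad_values|exact: measurable_pairs_differ|].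
    by rewrite [X in (X + _)%E]bad_values0 add0e [X in (X <= _)%E]pairs_differ_prob.
  move=> w /not_orP[nb np].
  have [l ls sl] : exists2 l, (J <= l < J + n)%N & same_pair (fun k => raw_bit (m.+1, k) w) l.
    move: np => /negP; rewrite /agree -has_predC => /hasP[l]; rewrite mem_iota => lJ /=.
    by move=> h; exists l => //; move: h; rewrite /same_pair; case: raw_bit; case: raw_bit.
  have key i : i \in s -> level_bit m.+1 i w = twist_rows L (level_bit m ^~ w) (f i).
    case: i => -[|k] p ks; rewrite /twist_rows /f /=; last first.
      by rewrite /level_bit/= addSnnS.
    have pJ := sJ p (map_f snd ks).
    have -> : (fun p => level_bit m (1%N, p) w) = (fun k => raw_bit (m.+1, k) w).
      by apply/funext => k; rewrite /level_bit/= addn1.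
    rewrite (@bit_twist_truncE _ J); [|lia|by exists l; rewrite ?ls].
    by apply: steps_bit_twist => //; exists l => //; lia.
  rewrite /A /A' /Q /agree /= all_map; apply: iff_sym.
  have -> : all (preim f (fun i => twist_rows L (level_bit m ^~ w) i == (e \o g) i)) s =
     all (fun i => level_bit m.+1 i w == e i) s.
    by apply: eq_in_all => i si /=; rewrite (key i si) fK.
  by [].
have : fine (P A) = 2^-1 ^+ size s.
  apply/eqP; rewrite -subr_eq0 -normr_le0; apply/ler_addgt0Pl => r r0; rewrite addr0.
  have [n nr] : exists n, (2^-1 : R) ^+ n <= r.
    have h1 : `|2^-1 : R| < 1 by rewrite ger0_norm//; lra.
    have /cvgrPdist_le/(_ _ r0)[n _ h] := cvg_expr h1.
    exists n; have := h n (leqnn n); rewrite /= sub0r normrN.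
    by apply: le_trans; exact: ler_norm.
  exact: le_trans (close n) nr.
by move=> h; rewrite -h fineK ?fin_num_measure.
Qed.
End levels.

(** * Distance between successive levels *)

Section time_change.
Variable R : realType.
Implicit Types (b c x : nat -> bool).

Lemma cnt_surj (q : pred nat) k j : (k <= cnt q j)%N ->
  exists2 i, (i <= j)%N & cnt q i = k.
Proof.
elim: j => [|j IH]; first by rewrite cnt0 leqn0 => /eqP->; exists 0%N; rewrite ?cnt0.
have [/IH[i ij <-] _|kj] := leqP k (cnt q j); first by exists i => //; exact: leqW.
rewrite cntS => h; exists j.+1 => //; rewrite cntS.
by move: h kj; case: (q j); lia.
Qed.

Lemma signsum_lip x i r : `|signsum R x (i + r) - signsum R x i| <= r%:R.
Proof.
elim: r => [|r IH]; first by rewrite addn0 subrr normr0.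
rewrite addnS signsumS addrAC -natr1; apply: le_trans (ler_normD _ _) _.
by rewrite lerD// normrX normrN1 expr1n.
Qed.

(* The pair index [j] at which the [k]-th coinciding pair has just been seen
   satisfies [2 k = j + U j], where [U j] is a sum of [j] signs. *)
Lemma time_change_close b c M (Lam Gam : R) :
  let S := signsum R (bit_twist (same_pair b) b c) in
  Lam <= M%:R *+ 2 ->
  (forall j, (j <= 4 * M)%N ->
     `|signsum R (fun i => b i.*2 (+) b i.*2.+1) j| < Lam) ->
  (forall i r, (i <= 8 * M)%N -> (r <= 8 * M)%N -> r%:R <= Lam *+ 2 ->
     `|S (i + r)%N - S i| < Gam) ->
  forall k, (k <= M)%N -> `|S (4 * k)%N - 2 * signsum R c k| <= Gam.
Proof.
move=> S LamM H1 H2 k kM.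
(* The sum of signs at [4 * M] is above [- 2 M], so at least [M] of the first [4 * M] pairs are
   equal and [k] blocks are complete by then. *)
have cM : (M <= cnt (same_pair b) (4 * M))%N.
  have := signsum_same_pair R b (4 * M); have := H1 (4 * M)%N (leqnn _).
  rewrite ltr_norml => /andP[h1 _] h2.
  rewrite -(ler_nat R); move: h1 h2 LamM; rewrite natrM; lra.
have [j jM cj] := cnt_surj (leq_trans kM cM).
have Uj := signsum_same_pair R b j; rewrite cj in Uj.
have := H1 j jM; rewrite ltr_norml => /andP[h1 h2].
have e : 2 * signsum R c k = S j.*2 by rewrite /S signsum_twist cj.
(* The pair end [j.*2], where [k] blocks are complete, differs from [4 * k] by twice the sum of
   signs at [j], hence by less than [2 Lam]. *)
rewrite e; have [jk|jk] := leqP j.*2 (4 * k)%N.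
  have -> : (4 * k = j.*2 + (4 * k - j.*2))%N by lia.
  apply: ltW; apply: H2; [lia|lia|rewrite natrB// natrM -muln2 natrM].
  by lra.
have -> : (j.*2 = 4 * k + (j.*2 - 4 * k))%N by lia.
rewrite distrC; apply: ltW; apply: H2; [lia|lia|].
rewrite natrB; last exact: ltnW.
by rewrite natrM -muln2 natrM; lra.
Qed.

Lemma interpolate_lip x (t : R) k : 0 <= t -> k%:R <= t ->
  `|interpolate (signsum R x) t - signsum R x k| <= t - k%:R.
Proof.
move=> t0 kt; rewrite /interpolate; have /andP[n1 n2] := truncn_itv t0.
set n := Num.truncn t in n1 n2 *.
have -> : signsum R x n.+1 - signsum R x n = (-1) ^+ x n by rewrite signsumS addrC addKr.
have kn : (k <= n)%N by rewrite -ltnS -(ltr_nat R) (le_lt_trans kt).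
rewrite addrAC; apply: le_trans (ler_normD _ _) _.
rewrite normrM normrX normrN1 expr1n mulr1 (ger0_norm (_ : 0 <= t - _)) ?subr_ge0//.
have := signsum_lip x k (n - k)%N; rewrite subnKC// natrB//; lra.
Qed.

(** The 6 is the interpolation error: 4 for the fine walk, whose time $4u$ exceeds $4k$ by less than
    4, and twice 1 for the coarse walk. *)
Lemma levels_close x c K n (Gam : R) :
  (forall k, (k <= K * 4 ^ n)%N ->
     `|signsum R x (4 * k)%N - 2 * signsum R c k| <= Gam) ->
  forall t : R, 0 <= t <= K%:R ->
  `|2 ^- n.+1 * interpolate (signsum R x) (t * 2 ^+ (2 * n.+1)) -
    2 ^- n * interpolate (signsum R c) (t * 2 ^+ (2 * n))| <=
  2 ^- n.+1 * (Gam + 6).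
Proof.
move=> H t /andP[t0 tK].
set u := t * 2 ^+ (2 * n); have u0 : 0 <= u by rewrite mulr_ge0// exprn_ge0.
have -> : t * 2 ^+ (2 * n.+1) = 4 * u.
  by rewrite /u mulnS exprD; ring.
have /andP[k1 k2] := truncn_itv u0; set k := Num.truncn u in k1 k2 *.
have kM : (k <= K * 4 ^ n)%N.
  rewrite -(ler_nat R) (le_trans k1)// natrM natrX /u exprM -[(2 : R) ^+ 2]natrX.
  by rewrite ler_wpM2r// exprn_ge0.
have hx : `|interpolate (signsum R x) (4 * u) - signsum R x (4 * k)%N| <= 4.
  apply: le_trans (interpolate_lip _ _ _) _; rewrite ?natrM; last by rewrite -natr1 in k2; lra.
  by rewrite mulr_ge0.
  by rewrite ler_pM2l.
have hc : `|interpolate (signsum R c) u - signsum R c k| <= 1.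
  by apply: le_trans (interpolate_lip _ _ _) _ => //; rewrite -natr1 in k2; lra.
have := H k kM; set A := interpolate _ _ in hx *; set C := interpolate _ _ in hc *.
set a := signsum _ _ _ in hx *; set b := signsum _ _ _ in hc *.
have -> : 2 ^- n = 2 ^- n.+1 * 2 :> R by rewrite exprS; field; rewrite expf_neq0.
rewrite -mulrA -mulrBr normrM ger0_norm ?invr_ge0 ?exprn_ge0// => h.
rewrite ler_wpM2l ?invr_ge0 ?exprn_ge0//.
by move: hx hc h; rewrite !ler_norml; lra.
Qed.

End time_change.

(** * Arithmetic of the rate $n2^{-n/2}$ *)

Section rate.
Variable R : realType.

Definition rate (n : nat) : R := n%:R * 2 `^ (- (n%:R / 2)).

Lemma powR_half_sq n : ((2 : R) `^ (- (n%:R / 2))) ^+ 2 = 2 ^- n.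
Proof.
rewrite -powR_mulrn ?powR_ge0// -powRrM mulNr divfK// powRN.
by rewrite powR_mulrn.
Qed.

(** The left side is the error allowed to one level, the right side makes the errors telescope.
    Since $2^{-1/2}\le 3/4$, the right side divided by $2^{-n/2}$ is at least $n/8-3/8$, which
    reaches $n/16$ at $n=6$. *)
Lemma rate_step n : (6 <= n)%N -> rate n / 16 <= rate n / 2 - rate n.+1 / 2.
Proof.
move=> n6; rewrite /rate -[n.+1%:R]natr1.
set a := _ `^ - (n%:R / 2).
have -> : (2 : R) `^ (- ((n%:R + 1) / 2)) = a * 2 `^ (- (1 / 2)).
  by rewrite /a -powRD ?pnatr_eq0 ?implybT//; congr (_ `^ _); ring.
have q0 : 0 <= (2 : R) `^ (- (1 / 2)) by exact: powR_ge0.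
have q2 := powR_half_sq 1; rewrite expr1 in q2.
set q := _ `^ _ in q0 q2 *.
have q34 : q <= 3 / 4 by nra.
have a0 : 0 <= a by exact: powR_ge0.
have n6' : 6 <= n%:R :> R by rewrite ler_nat.
have : 0 <= a * (n%:R / 16 - 3 / 8) by rewrite mulr_ge0//; lra.
have : 0 <= a * ((n%:R + 1) * (3 / 4 - q)) by rewrite !mulr_ge0//; lra.
lra.
Qed.

Lemma rate_gt0 n : (0 < n)%N -> 0 < rate n.
Proof. by move=> n0; rewrite mulr_gt0 ?ltr0n ?powR_gt0. Qed.

(** $3\cdot 2^{-n}=6\cdot 2^{-(n+1)}$ is the interpolation error in [levels_close]; the bound
    amounts to $96\cdot 2^{-n/2}\le n$. *)
Lemma rate_lb n : (96 <= n)%N -> 3 * 2 ^- n <= rate n / 32.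
Proof.
move=> n96; rewrite /rate; have := powR_half_sq n; set a := _ `^ _.
have a0 : 0 <= a by exact: powR_ge0.
have a1 : a <= 1.
  rewrite /a -[leRHS](powRr0 2) ler_powR// ?ler1n// oppr_le0 divr_ge0//.
move=> <-; have n96' : 96 <= n%:R :> R by rewrite ler_nat.
have : 0 <= a * (n%:R - 96 * a) by rewrite mulr_ge0// subr_ge0; nra.
lra.
Qed.

End rate.

(** * Probability of a large displacement between two levels *)

Section level_event.
Context d (Omega : measurableType d) (R : realType) (P : probability Omega R).

Lemma union_bound (p : nat -> Omega -> Prop) N (c : R) :
  (forall k, measurable [set w | p k w]) ->
  (forall k, (k < N)%N -> (P [set w | p k w] <= c%:E)%E) ->
  (P [set w | exists k, (k < N)%N /\ p k w] <= (N%:R * c)%:E)%E.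
Proof.
move=> mp; elim: N => [|N IH] pc.
  rewrite (_ : [set _ | _] = set0) ?measure0 ?mul0r//.
  by apply/seteqP; split => w //= [k []].
rewrite (_ : [set _ | _] = [set w | exists k, (k < N)%N /\ p k w] `|` [set w | p N w]).
  apply: le_trans (measureU2 _ _ _) _ => //.
    apply: measurable_ex => k; apply: measurable_conj => //.
    exact: measurable_constp.
  rewrite -natr1 mulrDl mul1r EFinD leeD//; last exact: pc.
  by apply: IH => k kN; apply: pc; exact: ltnW.
apply/seteqP; split => w /=.
  move=> [k [+ pk]]; rewrite ltnS leq_eqVlt => /predU1P[<-|kN]; first by right.
  by left; exists k.
by move=> [[k [kN pk]]|pN]; [exists k; split => //; exact: ltnW|exists N].
Qed.

Variable X : nat -> nat -> Omega -> R.
Hypothesis mX : forall m k, measurable_fun setT (X m k).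
Hypothesis X_law : forall m k : nat, (1 <= k)%N ->
  P (X m k @^-1` [set 1]) = (1 / 2)%:E /\ P (X m k @^-1` [set -1]) = (1 / 2)%:E.
Hypothesis X_indep : mutually_independent P [set i : nat * nat | (1 <= i.2)%N]
  (fun i : nat * nat => X i.1 i.2).

(** With $n^{1/4}$ as unit, the exponents $3/4$, $5/4$ and $3/2$ become natural powers. *)
Definition fourth_root (n : nat) : R := Num.sqrt (Num.sqrt n%:R).

Lemma fourth_rootX n : fourth_root n ^+ 4 = n%:R.
Proof. by rewrite (exprM _ 2 2) !sqr_sqrtr ?sqrtr_ge0. Qed.

Lemma fourth_root_ge0 n : 0 <= fourth_root n. Proof. exact: sqrtr_ge0. Qed.

Lemma fourth_root_ge (r : R) n : 0 <= r -> r ^+ 4 <= n%:R -> r <= fourth_root n.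
Proof.
by move=> r0; rewrite -fourth_rootX ler_pXn2r// nnegrE fourth_root_ge0.
Qed.

(* The exponent 3/4 makes both tail exponents superlinear, [n^(3/2)] for the
   time change and [n^(5/4)] for the displacement, so that they beat the
   union bounds over [O(4^n)] indices. *)
Definition time_gap (n : nat) : R := 2 ^+ n * fourth_root n ^+ 3.
Definition space_gap (n : nat) : R := rate R n * 2 ^+ n / 16.

(** With [M = K * 4 ^ n], the number of steps of level [n] up to time [K], this event and the next
    are the failures of the two sign-sum hypotheses of [time_change_close]. *)
Definition time_event (K n : nat) : set Omega :=
  [set w | exists j, (j < (4 * (K * 4 ^ n)).+1)%N /\
     time_gap n <= `|signsum R (fun l => raw_bit X (n.+1, l.*2) w (+)
                                         raw_bit X (n.+1, l.*2.+1) w) j|].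

Definition space_event (K n : nat) : set Omega :=
  [set w | exists i, (i < (8 * (K * 4 ^ n)).+1)%N /\
    exists r, (r < (8 * (K * 4 ^ n)).+1)%N /\
    (r%:R <= time_gap n *+ 2 /\
     space_gap n <= `|signsum R (fun k => level_bit X n.+1 (0%N, k) w) (i + r) -
                      signsum R (fun k => level_bit X n.+1 (0%N, k) w) i|)].

Definition level_event K n := time_event K n `|` space_event K n.

Lemma measurable_norm_ge (f : Omega -> R) (r : R) : measurable_fun setT f ->
  measurable [set w | r <= `|f w|].
Proof.
move=> mf; rewrite -[X in measurable X]setTI.
rewrite (_ : [set w | _] = (fun w => `|f w|) @^-1` `[r, +oo[%classic).
  have mn : measurable_fun setT (fun w => `|f w|) by exact: measurableT_comp.
  by apply: mn => //; exact: measurable_itv.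
by apply/seteqP; split => w /=; rewrite in_itv/= andbT.
Qed.

Let meas_time n j : measurable [set w | time_gap n <=
  `|signsum R (fun l => raw_bit X (n.+1, l.*2) w (+) raw_bit X (n.+1, l.*2.+1) w) j|].
Proof.
apply: measurable_norm_ge.
apply: (@measurable_signsum _ _ _
  (fun l w => raw_bit X (n.+1, l.*2) w (+) raw_bit X (n.+1, l.*2.+1) w)) => l.
exact: measurable_row_pairs.
Qed.

Let mlevel m k : measurable [set w | level_bit X m (0%N, k) w].
Proof. exact: measurable_level_bit. Qed.

Let meas_space n i r : measurable [set w | r%:R <= time_gap n *+ 2 /\
     space_gap n <= `|signsum R (fun k => level_bit X n.+1 (0%N, k) w) (i + r) -
                      signsum R (fun k => level_bit X n.+1 (0%N, k) w) i|].
Proof.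
apply: measurable_conj; first exact: measurable_constp.
apply: measurable_norm_ge; apply: measurable_funB;
exact: (@measurable_signsum _ _ _ (fun k w => level_bit X n.+1 (0%N, k) w)).
Qed.

Let meas_space1 K n i : measurable [set w | exists r, (r < (8 * (K * 4 ^ n)).+1)%N /\
    (r%:R <= time_gap n *+ 2 /\
     space_gap n <= `|signsum R (fun k => level_bit X n.+1 (0%N, k) w) (i + r) -
                      signsum R (fun k => level_bit X n.+1 (0%N, k) w) i|)].
Proof.
by apply: measurable_ex => r; apply: measurable_conj => //; exact: measurable_constp.
Qed.

Lemma measurable_level_event K n : measurable (level_event K n).
Proof.
apply: measurableU; apply: measurable_ex => j; apply: measurable_conj => //;
exact: measurable_constp.
Qed.

(** The factor $4^n$ of the squared gap cancels against the bound $4K4^n$ on the number of signs,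
    leaving the exponent $n^{3/2}/(32K)$. *)
Lemma time_event_prob K n : (0 < K)%N -> (P (time_event K n) <=
  ((4 * (K * 4 ^ n)).+1%:R * (2 * expR (- (fourth_root n ^+ 6 / (32 * K%:R)))))%:E)%E.
Proof.
move=> K0; apply: union_bound => // j; rewrite ltnS => jM.
have M0 : 0 < (4 * (K * 4 ^ n))%:R :> R by rewrite ltr0n !muln_gt0 K0 expn_gt0.
have := @signsum_tail _ _ _ _ _ (fun l => measurable_row_pairs mX n.+1 l)
  (fair_row_pairs mX X_law X_indep n.+1) 0 j _ (time_gap n) M0.
rewrite ler_nat => /(_ jM); rewrite mulr_ge0 ?exprn_ge0 ?fourth_root_ge0// => /(_ isT).
rewrite add0n (_ : time_gap n ^+ 2 / _ = fourth_root n ^+ 6 / (32 * K%:R)); last first.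
  rewrite /time_gap exprMn -!exprM !natrM natrX (_ : (4 : R) = 2 ^+ 2); last by rewrite -natrX.
  rewrite -exprM (mulnC n 2) [(3 * 2)%N]/=; field.
  by rewrite pnatr_eq0 -lt0n K0 expf_neq0.
apply: le_trans; rewrite le_eqVlt; apply/orP; left; apply/eqP; congr (P _).
by apply/seteqP; split => w /=; rewrite signsum0 subr0.
Qed.

(** At most [2 * time_gap n] signs are summed, so the exponent is the square of [space_gap n] over
    [16 * time_gap n]: the powers of 2 that depend on $n$ cancel and $n^2/n^{3/4}=n^{5/4}$
    remains. *)
Lemma space_event_prob K n : (0 < n)%N -> (P (space_event K n) <=
  ((8 * (K * 4 ^ n)).+1%:R * ((8 * (K * 4 ^ n)).+1%:R *
    (2 * expR (- (fourth_root n ^+ 5 / 4096)))))%:E)%E.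
Proof.
move=> n0; apply: union_bound => // i _; apply: union_bound => // r _.
have s0 : 0 < fourth_root n by rewrite !sqrtr_gt0 ltr0n.
have D0 : 0 < time_gap n *+ 2 by rewrite pmulrn_lgt0// mulr_gt0 ?exprn_gt0.
have [rD|rD] := leP r%:R (time_gap n *+ 2); last first.
  rewrite (_ : [set _ | _] = set0) ?measure0 ?lee_fin ?mulr_ge0 ?expR_ge0//.
  by apply/seteqP; split => w //= [].
have G0 : 0 <= space_gap n by rewrite !mulr_ge0 ?powR_ge0 ?exprn_ge0.
have := @signsum_tail _ _ _ _ _ (mlevel n.+1)
  (@fair_relabel _ _ _ _ _ _ (pair 0%N) snd _ (fun _ => erefl) (fair_level_bit mX X_law X_indep n.+1))
  i r _ (space_gap n) D0 rD G0.
rewrite (_ : space_gap n ^+ 2 / _ = fourth_root n ^+ 5 / 4096); last first.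
  rewrite /space_gap /rate /time_gap; have := powR_half_sq R n; set a := _ `^ _ => a2.
  rewrite !exprMn a2 -fourth_rootX; field.
  by rewrite gt_eqF//= expf_neq0.
set E := [set w | space_gap n <= _].
have mE : measurable E.
  apply: measurable_norm_ge; apply: measurable_funB;
  exact: (@measurable_signsum _ _ _ (fun k w => level_bit X n.+1 (0%N, k) w)).
apply: le_trans; apply: le_measure; rewrite ?inE//; last by move=> w [].
by apply: measurable_conj => //; exact: measurable_constp.
Qed.

Lemma expn4_sq n : ((4 ^ n) ^ 2 = 2 ^ (4 * n))%N.
Proof. by rewrite -[(4 ^ n)%N](expnM 2 2) -expnM; congr expn; lia. Qed.

Lemma level_event_prob K (L : nat) : (0 < K)%N ->
  exists n0, forall n, (n0 <= n)%N -> (P (level_event K n) <= (2^-1 ^+ (L * n))%:E)%E.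
Proof.
(* In [T], the summand [L] is for the target, 4 for the squared index count $(4^n)^2=2^{4n}$, and
   [c] for the constant factor, since $c\le 2^{cn}$. The 9 comes from $8M+1\le 9M$. *)
move=> K0; pose c := (4 * (9 * K) ^ 2)%N; pose T := (L + 4 + c)%N.
(* Large enough for both exponents: with $s=n^{1/4}\ge A$, both $s^6/(32K)$ and $s^5/4096$ are at
   least $Ts^4=Tn$. *)
pose A : R := 4096 * K%:R * T%:R.
have A0 : 0 <= A by exact: (mulr_ge0 (mulr_ge0 (ler0n R _) (ler0n R _)) (ler0n R _)).
have [n1 An1] : exists n1, A ^+ 4 <= n1%:R.
  by exists (Num.truncn (A ^+ 4)).+1; exact/ltW/truncnS_gt.
exists n1.+1 => n n0.
have ngt0 : (0 < n)%N by apply: leq_ltn_trans n0.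
have K1 : 1 <= K%:R :> R by rewrite ler1n.
set s := fourth_root n.
have sT : A <= s.
  by apply: fourth_root_ge => //; apply: (le_trans An1); rewrite ler_nat ltnW.
rewrite /A in sT.
have s1 : 1 <= s by apply: fourth_root_ge => //; rewrite expr1n ler1n.
have T0 : 0 <= T%:R :> R by [].
have expT (y : R) : (T * n)%:R <= y -> expR (- y) <= 2^-1 ^+ (T * n).
  move=> Ty; apply: (@le_trans _ _ (expR (- 1) ^+ (T * n))).
    by rewrite -expRM_natr ler_expR mulN1r lerN2.
  rewrite lerXn2r ?nnegrE ?expR_ge0// expRN lef_pV2 ?posrE ?expR_gt0//.
  exact: (expR_ge1Dx 1).
have s4 : 0 <= s ^+ 4 by rewrite exprn_ge0//; lra.
have e1 : expR (- (s ^+ 6 / (32 * K%:R))) <= 2^-1 ^+ (T * n).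
  apply: expT; rewrite natrM -(fourth_rootX n) -/s ler_pdivlMr; last by lra.
  have -> : s ^+ 6 = s ^+ 4 * s ^+ 2 by rewrite -exprD.
  rewrite -[T%:R * _]mulrC -mulrA ler_wpM2l//; nra.
have e2 : expR (- (s ^+ 5 / 4096)) <= 2^-1 ^+ (T * n).
  apply: expT; rewrite natrM -(fourth_rootX n) -/s ler_pdivlMr; last by lra.
  have -> : s ^+ 5 = s ^+ 4 * s by rewrite -exprSr.
  rewrite -[T%:R * _]mulrC -mulrA ler_wpM2l//; nra.
apply: le_trans (measureU2 _ _ _) _.
- apply: measurable_ex => j; apply: measurable_conj => //; exact: measurable_constp.
- apply: measurable_ex => j; apply: measurable_conj => //; exact: measurable_constp.
apply: le_trans (leeD (time_event_prob n K0) (space_event_prob K ngt0)) _.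
rewrite -EFinD lee_fin.
have hN : (4 * (9 * (K * 4 ^ n)) ^ 2 * 2 ^ (L * n) <= 2 ^ (T * n))%N.
  have h1 : (c <= 2 ^ (c * n))%N.
    by apply: leq_trans (ltnW (ltn_expl _ (ltnSn 1))) _; rewrite leq_exp2l// leq_pmulr.
  have -> : (4 * (9 * (K * 4 ^ n)) ^ 2 = c * 2 ^ (4 * n))%N.
    by rewrite (mulnA 9) expnMn expn4_sq mulnA.
  have -> : (T * n = L * n + 4 * n + c * n)%N by rewrite /T (mulnDl _ c) (mulnDl L).
  rewrite (expnD _ (_ + _)) (expnD _ (L * n)).
  move: h1; generalize (2 ^ (4 * n))%N (2 ^ (L * n))%N (2 ^ (c * n))%N c.
  by move=> u v y z zy; rewrite -mulnA mulnC (mulnC v) leq_mul2l zy orbT.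
set x := 2^-1 ^+ (T * n) in e1 e2 *.
have x0 : 0 <= x by rewrite exprn_ge0.
set N := (8 * (K * 4 ^ n)).+1%:R : R.
set N' := (4 * (K * 4 ^ n)).+1%:R : R.
have M1 : (1 <= K * 4 ^ n)%N by rewrite muln_gt0 K0 expn_gt0.
have N1 : 1 <= N by rewrite ler1n.
have N'N : N' <= N by rewrite ler_nat ltnS leq_mul2r orbT.
have N'0 : 0 <= N' by [].
have NM : N <= (9 * (K * 4 ^ n))%:R 
  by rewrite ler_nat -[9%N]/(8 + 1)%N mulnDl mul1n -addn1 leq_add2l.
apply: (@le_trans _ _ (4 * (9 * (K * 4 ^ n))%:R ^+ 2 * x)).
  apply: (@le_trans _ _ (N * (2 * x) + N * (N * (2 * x)))).
    apply: lerD; first by apply: ler_pM; rewrite ?mulr_ge0 ?expR_ge0 ?ler_pM2l.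
    by rewrite !ler_wpM2l ?(le_trans ler01 N1)// ler_pM2l.
  apply: (@le_trans _ _ (4 * N ^+ 2 * x)).
    have : 0 <= (N - 1) * N * x by rewrite !mulr_ge0 ?subr_ge0//; lra.
    lra.
  by rewrite ler_wpM2r// ler_pM2l// lerXn2r ?nnegrE//; lra.
have : (4 * (9 * (K * 4 ^ n)) ^ 2 * 2 ^ (L * n))%:R <= (2 ^ (T * n))%:R :> R by rewrite ler_nat.
rewrite 2!natrM !natrX => h.
rewrite /x !exprVn ler_pdivrMr ?exprn_gt0// [leRHS]mulrC ler_pdivlMr ?exprn_gt0//.
Qed.

End level_event.

(** * The limit process *)

Section paths.
Variable R : realType.
Implicit Types (f g h : R -> R) (s : nat -> R).

Definition cont_on (K : R) f := forall t, 0 <= t <= K -> forall e, 0 < e ->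
  exists2 dl, 0 < dl & forall u, 0 <= u <= K -> `|u - t| < dl -> `|f u - f t| <= e.

Lemma interpolate_lipschitz s (N : nat) (C : R) :
  (forall k, (k <= N)%N -> `|s k.+1 - s k| <= C) ->
  forall u t, 0 <= u -> u <= t -> t <= N%:R ->
  `|interpolate s t - interpolate s u| <= C * (t - u).
Proof.
move=> sC u t u0 ut tN; have t0 : 0 <= t by exact: le_trans ut.
have /andP[n1 n2] := truncn_itv u0; have /andP[m1 m2] := truncn_itv t0.
rewrite /interpolate; set n := Num.truncn u in n1 n2 *; set m := Num.truncn t in m1 m2 *.
have C0 : 0 <= C := le_trans (normr_ge0 _) (sC 0%N (leq0n N)).
have nm : (n <= m)%N by rewrite -ltnS -(ltr_nat R) (le_lt_trans n1)// (le_lt_trans ut).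
have mN : (m <= N)%N by rewrite -(ler_nat R) (le_trans m1).
have := sC m mN; have := sC n (leq_trans nm mN).
move: nm; rewrite leq_eqVlt => /predU1P[nm|nm].
  rewrite nm => _ h.
  have -> : s m + (t - m%:R) * (s m.+1 - s m) - (s m + (u - m%:R) * (s m.+1 - s m))
    = (s m.+1 - s m) * (t - u) by ring.
  by rewrite normrM (ger0_norm (_ : 0 <= t - u)) ?subr_ge0// ler_wpM2r ?subr_ge0.
have chain j : (n.+1 + j <= N.+1)%N -> `|s (n.+1 + j)%N - s n.+1| <= C * j%:R.
  elim: j => [_|j IH jN]; first by rewrite addn0 subrr normr0 mulr0.
  have h := IH (ltnW _); rewrite addnS in jN *.
  have -> : s (n.+1 + j).+1 - s n.+1 = (s (n.+1 + j).+1 - s (n.+1 + j)%N) + (s (n.+1 + j)%N - s n.+1) by ring.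
  rewrite (le_trans (ler_normD _ _))// -natr1 mulrDr mulr1 addrC lerD ?h//.
  by apply: sC.
move=> hn hm.
have := chain (m - n.+1)%N; rewrite subnKC// => /(_ (leqW mN)); rewrite natrB// => hnm.
have -> : s m + (t - m%:R) * (s m.+1 - s m) - (s n + (u - n%:R) * (s n.+1 - s n)) =
  (t - m%:R) * (s m.+1 - s m) + (s m - s n.+1) + (n.+1%:R - u) * (s n.+1 - s n).
  by rewrite -[n.+1%:R]natr1; ring.
rewrite (le_trans (ler_normD _ _))//.
have -> : C * (t - u) = C * (t - m%:R) + C * (m%:R - n.+1%:R) + C * (n.+1%:R - u) by ring.
apply: lerD.
  rewrite (le_trans (ler_normD _ _))//; apply: lerD => //.
  rewrite normrM (ger0_norm (_ : 0 <= t - m%:R)) ?subr_ge0// [leLHS]mulrC.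
  by rewrite ler_wpM2r ?subr_ge0.
have nu : 0 <= n.+1%:R - u by rewrite subr_ge0 ltW.
by rewrite normrM (ger0_norm nu) [leLHS]mulrC ler_wpM2r.
Qed.

Lemma cont_on_lipschitz K f (C : R) : 0 <= C ->
  (forall u t, 0 <= u -> u <= t -> t <= K -> `|f t - f u| <= C * (t - u)) ->
  cont_on K f.
Proof.
move=> C0 fC t /andP[t0 tK] e e0; exists (e / (C + 1)).
  by rewrite divr_gt0//; lra.
move=> u /andP[u0 uK]; rewrite ltr_pdivlMr; last by lra.
have [ut|tu] := leP u t.
  rewrite (distrC u t) (distrC (f u)) (ger0_norm (_ : 0 <= t - u)) ?subr_ge0// => h.
  by apply: le_trans (fC _ _ u0 ut tK) _; nra.
have tu0 : 0 <= u - t by rewrite subr_ge0 ltW.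
rewrite (ger0_norm tu0) => h.
by apply: le_trans (fC _ _ t0 (ltW tu) uK) _; nra.
Qed.

(** The steps are arbitrary reals here, so that the result applies to every [w]; the sum of the
    finitely many increments met up to time [K] serves as Lipschitz constant of the walk. *)
Lemma cont_on_shrunk (x : nat -> nat -> R) m (K : R) : cont_on K (shrunk_path x m).
Proof.
pose s := walk (twisted_step x m).
pose N := (Num.truncn (K * 2 ^+ (2 * m))).+1.
pose C := \sum_(k < N.+1) `|s k.+1 - s k|.
have sC k : (k <= N)%N -> `|s k.+1 - s k| <= C.
  move=> kN; rewrite /C (bigD1 (Ordinal (kN : (k < N.+1)%N)))//= lerDl.
  by apply: sumr_ge0.
have C0 : 0 <= C by apply: sumr_ge0.
apply: (@cont_on_lipschitz _ _ (2 ^- m * (C * 2 ^+ (2 * m)))).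
  by rewrite !mulr_ge0 ?invr_ge0 ?exprn_ge0.
move=> u t u0 ut tK; rewrite /shrunk_path -mulrBr normrM ger0_norm ?invr_ge0 ?exprn_ge0//.
rewrite -mulrA ler_wpM2l ?invr_ge0 ?exprn_ge0//.
rewrite -mulrA [X in _ <= _ * X]mulrC mulrBl.
apply: (interpolate_lipschitz sC).
- by rewrite mulr_ge0 ?exprn_ge0.
- by rewrite ler_wpM2r ?exprn_ge0.
- apply: (@le_trans _ _ (K * 2 ^+ (2 * m))); first by rewrite ler_wpM2r ?exprn_ge0.
  exact/ltW/truncnS_gt.
Qed.

Lemma cont_onB K f g : cont_on K f -> cont_on K g -> cont_on K (fun t => f t - g t).
Proof.
move=> cf cg t tK e e0; have e20 : 0 < e / 2 by lra.
have [d1 d10 h1] := cf t tK _ e20; have [d2 d20 h2] := cg t tK _ e20.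
exists (Num.min d1 d2) => [|u uK]; first by rewrite lt_min d10.
rewrite lt_min => /andP[/(h1 u uK) + /(h2 u uK)].
by rewrite !ler_norml; lra.
Qed.

Lemma cont_on_uniform K f (F : nat -> R -> R) (rho : nat -> R) :
  (forall n, cont_on K (F n)) -> rho @ \oo --> (0 : R) ->
  (\forall n \near \oo, forall t, 0 <= t <= K -> `|f t - F n t| <= rho n) ->
  cont_on K f.
Proof.
move=> cF r0 fF t tK e e0; have e30 : 0 < e / 3 by lra.
have [n [hn rn]] : exists n, (forall t, 0 <= t <= K -> `|f t - F n t| <= rho n) /\ rho n <= e / 3.
  have /cvgrPdist_le/(_ _ e30) rn := r0.
  have [n _ h] := filterI fF rn; exists n; have [h1 h0] := h n (leqnn n); split => //.
  by apply: le_trans h0; rewrite sub0r normrN ler_norm.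
have [dl dl0 h] := cF n t tK _ e30; exists dl => // u uK ut.
have := h u uK ut; have := hn u uK; have := hn t tK.
by rewrite !ler_norml; lra.
Qed.

Lemma cont_on_within f : (forall K, 0 < K -> cont_on K f) ->
  {within `[0, +oo[, continuous f}.
Proof.
move=> cf; apply/subspace_continuousP => t /=; rewrite in_itv/= andbT => t0.
apply/cvgrPdist_le => e e0.
have tK : 0 <= t <= t + 1 by lra.
have t10 : 0 < t + 1 by lra.
have [dl dl0 h] := cf _ t10 t tK e e0.
rewrite near_withinE; near=> u; rewrite /= in_itv/= andbT => u0.
have ut : `|u - t| < Num.min dl 1.
  rewrite distrC; near: u; apply: cvgr_dist_lt; first exact: cvg_id.
  by rewrite lt_min dl0 ltr01.
move: ut; rewrite lt_min => /andP[ud u1]; rewrite distrC; apply: h => //.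
by move: u1; rewrite u0 ltr_norml /=; lra.
Unshelve. all: by end_near. Qed.

Lemma max_dist_le K f g (r : R) : 0 <= K ->
  (forall t, 0 <= t <= K -> `|f t - g t| <= r) -> max_dist K f g <= r.
Proof.
move=> K0 h; apply: ge_sup.
  by exists `|f 0 - g 0|; exists 0 => //=; rewrite in_itv/= lexx.
by move=> _ [t + <-]; rewrite /= in_itv/= => /h.
Qed.

(** The multiples of $K/(j+1)$; [minn] keeps the point in $[0,K]$ for all [i] and [j]. *)
Definition grid (K : R) (i j : nat) : R := K * ((minn i j.+1)%:R / j.+1%:R).

Lemma grid_itv K i j : 0 <= K -> 0 <= grid K i j <= K.
Proof.
move=> K0; rewrite /grid mulr_ge0 ?divr_ge0//= ler_piMr// ler_pdivrMr ?ltr0n// mul1r.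
by rewrite ler_nat geq_minr.
Qed.

Lemma grid_dense K (t dl : R) : 0 < K -> 0 <= t <= K -> 0 < dl ->
  exists i j, `|grid K i j - t| < dl.
Proof.
move=> K0 /andP[t0 tK] dl0.
pose j := Num.truncn (K / dl); pose y := t / K * j.+1%:R.
have y0 : 0 <= y by rewrite mulr_ge0 ?divr_ge0// ltW.
exists (Num.truncn y), j.
have /andP[n1 n2] := truncn_itv y0; set i := Num.truncn y in n1 n2 *.
have j0 : 0 < j.+1%:R :> R by rewrite ltr0n.
have ij : (i <= j.+1)%N.
  rewrite -(ler_nat R) (le_trans n1)// /y; apply: ler_piMl; first exact: ltW.
  by rewrite ler_pdivrMr// mul1r.
rewrite /grid (minn_idPl ij).
have jK : K < dl * j.+1%:R by rewrite mulrC -ltr_pdivrMr// truncnS_gt.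
have ty : t = K * (y / j.+1%:R) by rewrite /y; field; rewrite !gt_eqF.
rewrite ty -mulrBr -mulrBl normrM (gtr0_norm K0) normrM (gtr0_norm (_ : 0 < j.+1%:R^-1)) ?invr_gt0//.
rewrite mulrA ltr_pdivrMr//; apply: le_lt_trans jK.
apply: ler_piMr; first exact: ltW.
rewrite ler0_norm ?subr_le0// opprB.
by rewrite -natr1 in n2; lra.
Qed.

Lemma max_dist_leP K f g (r : R) : 0 < K -> cont_on K f -> cont_on K g ->
  (forall i j, `|f (grid K i j) - g (grid K i j)| <= r) ->
  forall t, 0 <= t <= K -> `|f t - g t| <= r.
Proof.
move=> K0 cf cg h t tK; apply/ler_addgt0Pl => e e0.
have [dl dl0 hd] := cont_onB cf cg tK e0.
have [i [j ij]] := grid_dense K0 tK dl0.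
have := hd _ (grid_itv i j (ltW K0)) ij; have := h i j.
by rewrite !ler_norml; lra.
Qed.

Lemma le_max_dist K f g t : (exists r, forall t, 0 <= t <= K -> `|f t - g t| <= r) ->
  0 <= t <= K -> `|f t - g t| <= max_dist K f g.
Proof.
move=> [r h] tK; apply: ub_le_sup.
  by exists r => _ [u + <-]; rewrite /= in_itv/= => /h.
by exists t => //=; rewrite in_itv.
Qed.

End paths.

(** By continuity the supremum over $[0,K]$ can be tested on the countable grid: it reaches [r] when
    no $r-1/(m+1)$ bounds the grid values. *)
Lemma measurable_max_dist d (Omega : measurableType d) (R : realType)
    (K r : R) (F G : R -> Omega -> R) : 0 < K -> 0 < r ->
  (forall t, measurable_fun setT (F t)) -> (forall t, measurable_fun setT (G t)) ->
  (forall w, cont_on K (F ^~ w)) -> (forall w, cont_on K (G ^~ w)) ->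
  measurable [set w | r <= max_dist K (F ^~ w) (G ^~ w)].
Proof.
move=> K0 r0 mF mG cF cG.
have mh i j : measurable_fun setT (fun w => `|F (grid K i j) w - G (grid K i j) w|).
  by apply: measurableT_comp => //; exact: measurable_funB.
have mgt i j (c : R) : measurable [set w | c < `|F (grid K i j) w - G (grid K i j) w|].
  rewrite -[X in measurable X]setTI.
  rewrite (_ : [set w | _] = (fun w => `|F (grid K i j) w - G (grid K i j) w|) @^-1`
    `]c, +oo[%classic).
    by apply: mh => //; exact: measurable_itv.
  by apply/seteqP; split => w /=; rewrite in_itv/= andbT.
(* The first conjunct excludes unbounded sets, whose [sup] is 0. *)
rewrite (_ : [set _ | _] = [set w |
    (exists b : nat, forall i j, ~ (b%:R < `|F (grid K i j) w - G (grid K i j) w|)) /\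
    ~ (exists m : nat, forall i j,
         ~ (r - m.+1%:R^-1 < `|F (grid K i j) w - G (grid K i j) w|))]).
  apply: measurable_conj.
    apply: measurable_ex => m; apply: measurable_all => i.
    by apply: measurable_all => j; apply: measurable_notp; exact: mgt.
  apply: measurable_notp; apply: measurable_ex => m; apply: measurable_all => i.
  by apply: measurable_all => j; apply: measurable_notp; exact: mgt.
apply/seteqP; split => w /=.
  move=> rm; split; last first.
    move=> [m h]; have : max_dist K (F ^~ w) (G ^~ w) <= r - m.+1%:R^-1.
      apply: max_dist_le; first exact: ltW.
      by apply: max_dist_leP => // i j; rewrite leNgt; apply/negP/h.
    move=> /(le_trans rm); apply/negP; rewrite -ltNge ltrBlDr ltrDl.
    by rewrite invr_gt0 ltr0n.
  have [[_ [b hb]]|ns] := pselect (has_sup [set `|F t w - G t w| | t in `[0, K]]).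
    exists (Num.truncn b).+1 => i j; apply/negP; rewrite -leNgt.
    apply/ltW/(le_lt_trans _ (truncnS_gt b))/hb => /=; exists (grid K i j) => //.
    by rewrite /= in_itv/= grid_itv// ltW.
  by move: rm; rewrite /max_dist sup_out//; lra.
move=> [[b hb] nm]; rewrite leNgt; apply/negP => mr; apply: nm.
have mr0 : 0 < r - max_dist K (F ^~ w) (G ^~ w) by rewrite subr_gt0.
pose m := Num.truncn ((r - max_dist K (F ^~ w) (G ^~ w))^-1).
have mm : m.+1%:R^-1 < r - max_dist K (F ^~ w) (G ^~ w).
  by rewrite invf_plt ?posrE ?ltr0n// truncnS_gt.
exists m => i j; apply/negP; rewrite -leNgt.
have := @le_max_dist _ K (F ^~ w) (G ^~ w) (grid K i j).
have bb : exists r0, forall t, 0 <= t <= K -> `|F t w - G t w| <= r0.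
  by exists b%:R; apply: max_dist_leP => // k l; rewrite leNgt; apply/negP/hb.
move=> /(_ bb (grid_itv _ _ (ltW K0))) h; apply: (le_trans h).
by rewrite lerBrDr addrC -lerBrDr ltW.
Qed.

(** [rate_step] rearranges to a contraction by $7/8$ from $n=6$ on. *)
Lemma rate_cvg0 (R : realType) : (fun n => rate R n / 2) @ \oo --> (0 : R).
Proof.
have h k : 0 <= rate R (k + 6) <= (7 / 8) ^+ k * rate R 6.
  elim: k => [|k /andP[h0 h1]]; first by rewrite add0n expr0 mul1r lexx ltW// rate_gt0.
  have := @rate_step R (k + 6) (leq_addl _ _); rewrite -addSn => h2.
  rewrite ltW ?rate_gt0//= exprS -mulrA; lra.
have c0 : (fun k => (7 / 8) ^+ k * rate R 6) @ \oo --> (0 : R).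
  have h1 : `|7 / 8 : R| < 1 by rewrite ger0_norm; lra.
  by have := @cvgMr_tmp _ _ _ _ _ _ (rate R 6) (cvg_expr h1); rewrite mul0r; apply.
have c1 : (fun k => rate R (k + 6)) @ \oo --> (0 : R).
  by apply: (squeeze_cvgr _ (cvg_cst 0) c0); near=> k; exact: h.
rewrite -(cvg_shiftn 6) /=.
by have := @cvgMr_tmp _ _ _ _ _ _ (2^-1) c1; rewrite mul0r; apply.
Unshelve. all: by end_near. Qed.

Section limit_process.
Context d (Omega : measurableType d) (R : realType) (P : probability Omega R).
Variable X : nat -> nat -> Omega -> R.
Hypothesis mX : forall m k, measurable_fun setT (X m k).
Hypothesis X_law : forall m k : nat, (1 <= k)%N ->
  P (X m k @^-1` [set 1]) = (1 / 2)%:E /\ P (X m k @^-1` [set -1]) = (1 / 2)%:E.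
Hypothesis X_indep : mutually_independent P [set i : nat * nat | (1 <= i.2)%N]
  (fun i : nat * nat => X i.1 i.2).

(** Off this event every position of every row has an equal pair at or after it, so that
    [steps_bit_twist] applies everywhere once the steps are signs. *)
Definition bad_pairs : set Omega :=
  [set w | exists m J, forall l, (J <= l)%N ->
     raw_bit X (m, l.*2) w (+) raw_bit X (m, l.*2.+1) w].

Let mpairs m l : measurable [set w | raw_bit X (m, l.*2) w (+) raw_bit X (m, l.*2.+1) w].
Proof. exact: measurable_row_pairs. Qed.

Let meas_bad m J : measurable [set w | forall l, (J <= l)%N ->
     raw_bit X (m, l.*2) w (+) raw_bit X (m, l.*2.+1) w].
Proof.
apply: measurable_all => l; apply: measurable_impl => //.
exact: measurable_constp.
Qed.

Lemma measurable_bad_pairs : measurable bad_pairs.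
Proof. by apply: measurable_ex => m; exact: measurable_ex. Qed.

Lemma le_half_pow0 (A : set Omega) (n0 : nat) :
  (forall n, (n0 <= n)%N -> (P A <= (2^-1 ^+ n)%:E)%E) -> P A = 0%E.
Proof.
move=> h; apply/eqP; rewrite eq_le measure_ge0 andbT.
apply/lee_addgt0Pr => e e0; rewrite add0e.
have h1 : `|2^-1 : R| < 1 by rewrite ger0_norm//; lra.
have /cvgrPdist_le/(_ _ e0)[n _ hn] := cvg_expr h1.
apply: le_trans (h (maxn n n0) (leq_maxr _ _)) _; rewrite lee_fin.
have := hn (maxn n n0) (leq_maxl _ _); rewrite /= sub0r normrN.
by apply: le_trans; exact: ler_norm.
Qed.

Lemma bad_pairs0 : P bad_pairs = 0%E.
Proof.
apply/negligibleP; first exact: measurable_bad_pairs.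
rewrite (_ : bad_pairs = \bigcup_m \bigcup_J [set w | forall l, (J <= l)%N ->
     raw_bit X (m, l.*2) w (+) raw_bit X (m, l.*2.+1) w]); last first.
  by apply/seteqP; split => w; [move=> [m [k h']]; exists m => //; exists k|move=> [m _ [k _ h']]; exists m, k].
apply: negligible_bigcup => m; apply: negligible_bigcup => J.
apply/negligibleP; first exact: meas_bad.
apply: (@le_half_pow0 _ 0) => n _; rewrite -(pairs_differ_prob mX X_law X_indep m J n).
apply: le_measure; rewrite ?inE//; first exact: measurable_pairs_differ.
move=> w h; apply/allP => l; rewrite mem_iota => /andP[Jl _].
by rewrite eqb_id; exact: h.
Qed.

(** From level [n] on, the single bounds decrease at least like $2^{-j}$, whence the factor 2. *)
Lemma level_tail_prob K (L : nat) : (0 < K)%N -> (0 < L)%N ->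
  exists n0, forall n, (n0 <= n)%N ->
    (P (\bigcup_(j >= n) level_event X K j) <= (2 * 2^-1 ^+ (L * n))%:E)%E.
Proof.
move=> K0 L0; have [n0 h] := level_event_prob mX X_law X_indep L K0.
exists n0 => n n0n.
have mE j : measurable (level_event X K j) by exact: measurable_level_event.
rewrite (_ : \bigcup_(j >= n) _ = \bigcup_j level_event X K (n + j)); last first.
  apply/seteqP; split => w [j nj Ej]; first by exists (j - n)%N; rewrite ?subnKC.
  by exists (n + j)%N => //=; rewrite leq_addr.
apply: le_trans (generalized_Boole_inequality _ _ _) _ => //.
  by apply: bigcupT_measurable => j.
have c := @cvg_geometric_eseries_half R (2 * 2^-1 ^+ (L * n)) 0.
rewrite expr0 divr1 in c; rewrite -(cvg_lim _ c)//.
apply: lee_nneseries => // j _; apply: le_trans (h (n + j)%N _) _.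
  exact: leq_trans n0n (leq_addr _ _).
have -> : 2 * 2^-1 ^+ (L * n) / (2 ^ (j + 1))%:R = 2^-1 ^+ (L * n) * 2^-1 ^+ j :> R.
  by rewrite addn1 natrX exprS (exprVn _ j); field; rewrite expf_neq0.
rewrite lee_fin mulnDr exprD ler_wpM2l ?exprn_ge0//.
by apply: ler_wiXn2l; rewrite ?leq_pmull//; lra.
Qed.

(** Integer horizons dominate the real ones and keep the union countable; each limit superior is
    null by the Borel-Cantelli argument. *)
Definition bad_set : set Omega := bad_values X `|` bad_pairs `|`
  \bigcup_K lim_sup_set (level_event X K.+1).

Let mlimsup K : measurable (lim_sup_set (level_event X K)).
Proof.
apply: bigcap_measurable => // k _; apply: bigcup_measurable => j _.
exact: measurable_level_event.
Qed.

Lemma measurable_bad_set : measurable bad_set.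
Proof.
apply: measurableU; last exact: bigcupT_measurable.
by apply: measurableU; [exact: measurable_bad_values|exact: measurable_bad_pairs].
Qed.

Lemma bad_set0 : P bad_set = 0%E.
Proof.
apply/negligibleP; first exact: measurable_bad_set.
apply: negligibleU.
  apply: negligibleU.
    by apply/negligibleP; [exact: measurable_bad_values|exact: bad_values0].
  by apply/negligibleP; [exact: measurable_bad_pairs|exact: bad_pairs0].
apply: negligible_bigcup => K; apply/negligibleP; first exact: mlimsup.
have [n0 h] := @level_tail_prob K.+1 1 isT isT.
apply: (@le_half_pow0 _ n0) => n n0n.
apply: le_trans (lim_sup_set_ub P n.+1 _) _; first by move=> k; exact: measurable_level_event.
apply: le_trans (h n.+1 (leqW n0n)) _.
by rewrite mul1n exprS mulrA mulfV// mul1r.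
Qed.

Lemma B_signsum n t w : ~ bad_values X w -> B X n t w =
  2 ^- n * interpolate (signsum R (fun k => level_bit X n (0%N, k) w)) (t * 2 ^+ (2 * n)).
Proof.
move=> nb; rewrite /B /shrunk_path; congr (_ * interpolate _ _).
by apply: walk_signsum => k; exact: (steps_signs nb).
Qed.

Lemma time_gap_le K n : (0 < K)%N -> (0 < n)%N ->
  time_gap R n <= (K * 4 ^ n)%:R *+ 2.
Proof.
move=> K0 n0; have s1 : 1 <= fourth_root R n by apply: fourth_root_ge => //; rewrite expr1n ler1n.
have s3 : fourth_root R n ^+ 3 <= 2 ^+ n.
  apply: (@le_trans _ _ n%:R).
    by rewrite -fourth_rootX ler_weXn2l.
  by rewrite -natrX ler_nat ltnW// ltn_expl.
apply: (@le_trans _ _ (K * 4 ^ n)%:R); last by rewrite mulr2n lerDl.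
apply: (@le_trans _ _ (4 ^ n)%:R); last by rewrite ler_nat leq_pmull.
have -> : (4 ^ n)%:R = 2 ^+ n * 2 ^+ n :> R.
  by rewrite -exprMn -natrM natrX.
by rewrite /time_gap ler_wpM2l// exprn_ge0.
Qed.

Lemma B_step K n t w : ~ bad_values X w -> ~ bad_pairs w -> (0 < K)%N -> (96 <= n)%N ->
  ~ level_event X K n w -> 0 <= t <= K%:R ->
  `|B X n.+1 t w - B X n t w| <= rate R n / 2 - rate R n.+1 / 2.
Proof.
move=> nb np K0 n96 /not_orP[nt ns] tK.
rewrite !B_signsum//.
have e : (fun k => level_bit X n.+1 (0%N, k) w) =
  bit_twist (same_pair (fun k => raw_bit X (n.+1, k) w)) (fun k => raw_bit X (n.+1, k) w)
    (fun k => level_bit X n (0%N, k) w).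
  apply/funext => p; apply: steps_bit_twist => //; apply: contrapT => ne.
  apply: np; exists n.+1, p./2 => l pl; apply: contrapT => h; apply: ne.
  by exists l => //; move: h; rewrite /same_pair; case: raw_bit; case: raw_bit.
have hk : forall k, (k <= K * 4 ^ n)%N ->
    `|signsum R (fun k => level_bit X n.+1 (0%N, k) w) (4 * k)%N -
      2 * signsum R (fun k => level_bit X n (0%N, k) w) k| <= space_gap R n.
  rewrite e; apply: (@time_change_close _ _ _ _ (time_gap R n)).
  - by apply: time_gap_le => //; exact: leq_trans n96.
  - by move=> j jM; rewrite ltNge; apply/negP => h; apply: nt; exists j.
  - by move=> i r iM rM rg; rewrite ltNge; apply/negP => h; apply: ns; exists i; split => //;
      exists r; split => //; split => //; rewrite e.
apply: le_trans (levels_close hk tK) _; apply: le_trans (rate_step R _); last first.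
  exact: leq_trans n96.
(* Half of the allowance [rate R n / 16] goes to the displacement [space_gap], the other half to
   interpolation. *)
have := @rate_lb R n n96; rewrite mulrDr.
have -> : 2 ^- n.+1 * space_gap R n = rate R n / 32.
  by rewrite /space_gap exprS; field; rewrite expf_neq0.
have -> : 2 ^- n.+1 * 6 = 3 * 2 ^- n :> R by rewrite exprS; field; rewrite expf_neq0.
lra.
Qed.

Lemma B_diff K n m t w : ~ bad_values X w -> ~ bad_pairs w -> (0 < K)%N -> (96 <= n)%N ->
  (forall j, (n <= j)%N -> ~ level_event X K j w) -> 0 <= t <= K%:R -> (n <= m)%N ->
  `|B X m t w - B X n t w| <= rate R n / 2 - rate R m / 2.
Proof.
move=> nb np K0 n96 nE tK /subnKC<-; elim: (m - n)%N => [|k IH].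
  by rewrite addn0 !subrr normr0.
rewrite addnS; have h := @B_step K (n + k) t w nb np K0 (leq_trans n96 (leq_addr _ _))
  (nE _ (leq_addr _ _)) tK.
by move: h IH; rewrite !ler_norml; lra.
Qed.

Lemma eventually_close K w : ~ bad_set w -> (0 < K)%N ->
  exists2 n, (96 <= n)%N & forall j, (n <= j)%N -> ~ level_event X K j w.
Proof.
case: K => // K nw _; have nE : ~ lim_sup_set (level_event X K.+1) w.
  by move=> h; apply: nw; right; exists K.
have [n nn] : exists n, ~ (\bigcup_(j >= n) level_event X K.+1 j) w.
  by apply/existsNP => h; apply: nE => n _; exact: h.
exists (maxn 96 n); first exact: leq_maxl.
by move=> j nj Ej; apply: nn; exists j => //=; apply: leq_trans nj; exact: leq_maxr.
Qed.

(** Being 0 on all of [bad_set], it is measurable for each [t], and its path on $[0,\infty)$ is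
    continuous for every [w]. *)
Definition W_fun (t : R) (w : Omega) : R :=
  if (0 <= t) && (w \notin bad_set) then limn (fun n => B X n t w) else 0.

Lemma natK (t : R) : exists2 K : nat, (0 < K)%N & t <= K%:R.
Proof. by exists (Num.truncn t).+1 => //; exact/ltW/truncnS_gt. Qed.

Lemma B_cvg t w : ~ bad_set w -> 0 <= t -> (fun n => B X n t w) @ \oo --> W_fun t w.
Proof.
move=> nw t0; rewrite /W_fun t0 memNset//=.
have [K K0 tK] := natK t; have [n n96 nE] := eventually_close nw K0.
have [nb np] : ~ bad_values X w /\ ~ bad_pairs w.
  by split => h; apply: nw; left; [left|right].
(* By the telescoping bound on differences [u] is nonincreasing and bounded below, so it converges;
   the added term tends to 0. *)
pose u m := B X (m + n) t w + rate R (m + n) / 2.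
have hd m m' : (n <= m)%N -> (m <= m')%N ->
    `|B X m' t w - B X m t w| <= rate R m / 2 - rate R m' / 2.
  move=> nm mm; apply: (@B_diff K) => //; first exact: leq_trans nm.
    by move=> j mj; apply: nE; exact: leq_trans mj.
  by rewrite t0.
have cu : cvgn u.
  apply: nonincreasing_is_cvgn => [m m' mm|].
    have := hd (m + n)%N (m' + n)%N (leq_addl _ _); rewrite leq_add2r => /(_ mm).
    by rewrite /u ler_norml; lra.
  exists (B X n t w - rate R n / 2) => _ [m _ <-].
  have := hd n (m + n)%N (leqnn _) (leq_addl _ _).
  have : 0 <= rate R (m + n) by rewrite /rate mulr_ge0 ?powR_ge0.
  by rewrite /u ler_norml; lra.
have : (fun m => u m - rate R (m + n) / 2) @ \oo --> limn u - 0.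
  apply: cvgB => //; have := @rate_cvg0 R; rewrite -(cvg_shiftn n) //.
rewrite subr0 (_ : (fun m => _) = [sequence B X (m + n) t w]_m); last first.
  by apply/funext => m; rewrite /u /= addrK.
by rewrite (cvg_shiftn n (fun m => B X m t w)) => h; rewrite (cvg_lim _ h).
Qed.

Lemma W_close K n t w : ~ bad_set w -> (0 < K)%N -> (96 <= n)%N ->
  (forall j, (n <= j)%N -> ~ level_event X K j w) -> 0 <= t <= K%:R ->
  `|W_fun t w - B X n t w| <= rate R n / 2.
Proof.
move=> nw K0 n96 nE tK; have /andP[t0 _] := tK.
have [nb np] : ~ bad_values X w /\ ~ bad_pairs w.
  by split => h; apply: nw; left; [left|right].
have c : (fun m => `|B X m t w - B X n t w|) @ \oo --> `|W_fun t w - B X n t w|.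
  by apply: cvg_norm; apply: cvgB; [exact: B_cvg|exact: cvg_cst].
rewrite -(cvg_lim _ c)//; apply: limr_le; first by apply/cvg_ex; eexists; exact: c.
near=> m; have nm : (n <= m)%N by near: m; exists n.
apply: le_trans (@B_diff K n m t w nb np K0 n96 nE tK nm) _.
by rewrite gerBl divr_ge0// mulr_ge0 ?powR_ge0.
Unshelve. all: by end_near. Qed.

Lemma W_null t w : bad_set w -> W_fun t w = 0.
Proof. by move=> h; rewrite /W_fun mem_set//= andbF. Qed.

Lemma measurable_B n t : measurable_fun setT (B X n t).
Proof.
have mw k : measurable_fun setT (fun w => walk (twisted_step (fun i k => X i k w) n) k).
  by apply: (@measurable_walk _ _ _ (steps X n)) => j; exact: measurable_steps.
rewrite /B /shrunk_path; apply: measurable_funM => //.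
rewrite /interpolate; apply: measurable_funD => //.
by apply: measurable_funM => //; apply: measurable_funB.
Qed.

Lemma measurable_W t : measurable_fun setT (W_fun t).
Proof.
have [t0|t0] := leP 0 t; last first.
  by rewrite (_ : W_fun t = cst 0)//; apply/funext => w; rewrite /W_fun leNgt t0.
apply: (@measurable_fun_cvg _ _ _ _ (fun n w => if w \in bad_set then 0 else B X n t w)).
  move=> n; apply: measurable_fun_ifT => //; last exact: measurable_B.
  apply: (measurable_fun_bool true); rewrite setTI.
  rewrite (_ : _ @^-1` _ = bad_set); first exact: measurable_bad_set.
  by apply/seteqP; split => w /=; [exact: set_mem|exact: mem_set].
move=> w _ /=; have [nw|nw] := pselect (bad_set w).
  by rewrite mem_set// W_null//; exact: cvg_cst.
by rewrite memNset//; exact: B_cvg.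
Qed.

Lemma cont_on_W K w : cont_on K (W_fun ^~ w).
Proof.
have [nw|nw] := pselect (bad_set w).
  by move=> t _ e e0; exists 1 => // u _ _; rewrite !W_null// subrr normr0 ltW.
have [k k0 Kk] := natK K; have [n n96 nE] := eventually_close nw k0.
apply: (@cont_on_uniform _ K _ (fun n t => B X n t w) (fun n => rate R n / 2)).
- by move=> m; exact: cont_on_shrunk.
- exact: rate_cvg0.
- exists n => // m nm t /andP[t0 tK].
  apply: (@W_close k) => //; first exact: leq_trans nm.
    by move=> j mj; apply: nE; exact: leq_trans mj.
  by rewrite t0 (le_trans tK).
Qed.

Lemma W0 w : W_fun 0 w = 0.
Proof.
have [nw|nw] := pselect (bad_set w); first exact: W_null.
have := B_cvg nw (lexx 0); rewrite (_ : (fun n => B X n 0 w) = fun=> 0); last first.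
  apply/funext => n; rewrite /B /shrunk_path mul0r /interpolate truncn0.
  by rewrite /walk big_geq// subrr mul0r addr0 mulr0.
by move=> /cvg_lim <- //; rewrite lim_cst.
Qed.

Lemma W_estimate (C K : R) : 3 / 2 <= C -> 0 < K ->
  exists n0 : nat, forall n, (n0 <= n)%N ->
    (P [set w | (rate R n <= max_dist K (W_fun ^~ w) (fun t => B X n t w))%R] <=
     (6 * (K * 2 ^+ (2 * n)) `^ (1 - C))%:E)%E.
Proof.
move=> C32 K0; have [k k0 Kk] := natK K.
(* [L] exceeds $2C+1$: of $2^{-Ln}$, a part $2^{-2Cn}$ is below $2^{2n(1-C)}$, and the remaining
   $2^{-n}$ is below $K^{1-C}$ for large [n]. *)
pose L := (Num.truncn (2 * C + 1)).+1.
have [n0 h] := @level_tail_prob k L k0 isT.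
have Kp : 0 < K `^ (1 - C) by rewrite powR_gt0.
have h1 : `|2^-1 : R| < 1 by rewrite ger0_norm//; lra.
have /cvgrPdist_le/(_ _ Kp)[n1 _ hn1] := cvg_expr h1.
exists (maxn 96 (maxn n0 n1)) => n; rewrite !geq_max => /and3P[n96 n0n n1n].
have r0 : 0 < rate R n by apply: rate_gt0; exact: leq_trans n96.
have mE j : measurable (level_event X k j) by exact: measurable_level_event.
have mU : measurable (\bigcup_(j >= n) level_event X k j) by exact: bigcup_measurable.
apply: (@le_trans _ _ (P (bad_set `|` \bigcup_(j >= n) level_event X k j))).
  apply: le_measure; rewrite ?inE.
  - apply: (@measurable_max_dist _ _ _ K (rate R n) W_fun (B X n)) => //.
    + exact: measurable_W.
    + exact: measurable_B.
    + by move=> w; exact: cont_on_W.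
    + by move=> w; exact: cont_on_shrunk.
  - by apply: measurableU => //; exact: measurable_bad_set.
  move=> w /= rw; have [nw|nw] := pselect (bad_set w); [by left|right].
  (* Off both events the distance is at most half the threshold, and the threshold is positive. *)
  apply: contrapT => nE; have : max_dist K (W_fun ^~ w) (fun t => B X n t w) <= rate R n / 2.
    apply: max_dist_le; first exact: ltW.
    move=> t /andP[t0 tK]; apply: (@W_close k) => //.
      by move=> j nj Ej; apply: nE; exists j.
    by rewrite t0 (le_trans tK).
  lra.
apply: le_trans (measureU2 _ _ _) _ => //; first exact: measurable_bad_set.
rewrite [X in (X + _)%E]bad_set0 add0e; apply: le_trans (h n n0n) _.
rewrite lee_fin powRM; [|exact: ltW|exact: exprn_ge0].
have := hn1 n n1n; rewrite /= sub0r normrN => hK.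
have {}hK : 2^-1 ^+ n <= K `^ (1 - C) by apply: le_trans hK; exact: ler_norm.
have e1 : ((2 : R) ^+ (2 * n)) `^ (1 - C) = 2 `^ (n%:R * (2 - 2 * C)).
  by rewrite -powR_mulrn// -powRrM natrM; congr (_ `^ _); ring.
have e2 : (2^-1 : R) ^+ (L * n) <= 2 `^ (n%:R * (- (2 * C + 1))).
  rewrite exprVn -powR_mulrn// -powRN ler_powR ?ler1n// natrM mulrN lerN2 [leRHS]mulrC.
  by rewrite ler_wpM2l//; exact/ltW/truncnS_gt.
have e3 : (2 : R) `^ (n%:R * (- (2 * C + 1))) = 2^-1 ^+ n * 2 `^ (n%:R * (- (2 * C))).
  rewrite exprVn -powR_mulrn// -powRN -powRD ?pnatr_eq0 ?implybT//.
  by congr (_ `^ _); ring.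
have e4 : (2 : R) `^ (n%:R * (- (2 * C))) <= 2 `^ (n%:R * (2 - 2 * C)).
  by rewrite ler_powR ?ler1n// ler_wpM2l//; lra.
rewrite e1; set p := _ `^ (n%:R * (2 - _)) in e4 *.
apply: (@le_trans _ _ (2 * (K `^ (1 - C) * p))).
  rewrite ler_pM2l//; apply: le_trans e2 _; rewrite e3.
  by apply: ler_pM; rewrite ?exprn_ge0 ?powR_ge0.
by rewrite ler_wpM2r ?ler_nat// mulr_ge0 ?powR_ge0.
Qed.

Lemma W_eventually (K : R) w : 0 < K -> ~ bad_set w ->
  \forall n \near \oo, max_dist K (W_fun ^~ w) (fun t => B X n t w) <= rate R n.
Proof.
move=> K0 nw; have [k k0 Kk] := natK K; have [n n96 nE] := eventually_close nw k0.
exists n => // m nm; apply: (@le_trans _ _ (rate R m / 2)).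
  apply: max_dist_le; first exact: ltW.
  move=> t /andP[t0 tK]; apply: (@W_close k) => //; first exact: leq_trans nm.
    by move=> j mj; apply: nE; exact: leq_trans mj.
  by rewrite t0 (le_trans tK).
have : 0 < rate R m by apply: rate_gt0; apply: leq_trans nm; exact: leq_trans n96.
lra.
Qed.

End limit_process.

(** * Stein's characterization of the normal law *)

Section bounded_limits.
Context d (T : measurableType d) (R : realType) (mu : {measure set T -> \bar R}).

Lemma Rintegral_dominated (f_ : nat -> T -> R) (f G : T -> R) :
  (forall n, measurable_fun setT (f_ n)) -> measurable_fun setT f ->
  {ae mu, forall x, (fun n => f_ n x) @ \oo --> f x} ->
  mu.-integrable setT (EFin \o G) -> (forall n x, `|f_ n x| <= G x) ->
  (fun n => Rintegral mu setT (f_ n)) @ \oo --> Rintegral mu setT f.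
Proof.
move=> mf_ mf f_f iG fG.
have ae1 : {ae mu, forall x, setT x -> (fun n => (f_ n x)%:E) @ \oo --> (f x)%:E}.
  apply: filterS f_f => x h _; apply: cvg_EFin; first exact: nearW.
  exact: h.
have ae2 : {ae mu, forall x n, setT x -> (`|(f_ n x)%:E| <= (G x)%:E)%E}.
  by apply: aeW => x n _; rewrite lee_fin; exact: fG.
have m1 n : measurable_fun setT (EFin \o f_ n) by exact/measurable_EFinP.
have m2 : measurable_fun setT (EFin \o f) by exact/measurable_EFinP.
have [i1 _ c] := @dominated_convergence _ _ _ mu _ measurableT _ _ _ m1 m2 ae1 iG ae2.
apply: fine_cvg; rewrite fineK //.
exact: integrable_fin_num.
Qed.

End bounded_limits.

(** * Continuous approximation of interval indicators *)

Section trapezoid.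
Variable R : realType.

(** It vanishes outside $]a,b[$ for every [m], has slopes of size [m] at the two ends and is capped
    at 1. *)
Definition trap (a b : R) (m : nat) (x : R) : R :=
  Num.min 1 (Num.max 0 (m%:R * Num.min (x - a) (b - x))).

Lemma trap_ge0 a b m x : 0 <= trap a b m x.
Proof. by rewrite le_min ler01 le_max lexx. Qed.

Lemma trap_le1 a b m x : trap a b m x <= 1.
Proof. by rewrite ge_min lexx. Qed.

Lemma trap_norm a b m x : `|trap a b m x| <= 1.
Proof. by rewrite ger0_norm ?trap_ge0 ?trap_le1. Qed.

Lemma trap_out a b m x : ~~ (a < x < b) -> trap a b m x = 0.
Proof.
move=> h; rewrite /trap (_ : Num.max 0 _ = 0); first by rewrite minC min_l.
apply/max_idPl; rewrite mulr_ge0_le0// ge_min !subr_le0.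
by move: h; rewrite negb_and -!leNgt.
Qed.

Lemma trap_continuous a b m : continuous (trap a b m).
Proof.
have cb : continuous (fun x : R => Num.min (x - a) (b - x)).
  move=> x; apply: (@continuous_min _ _ (fun x => x - a) (fun x => b - x)).
    by apply: cvgB => //; exact: cvg_cst.
  by apply: cvgB => //; exact: cvg_cst.
move=> x; apply: (@continuous_min _ _ (cst 1) (fun x => Num.max 0 (m%:R * Num.min (x - a) (b - x)))).
  exact: cvg_cst.
apply: (@continuous_max _ _ (cst 0) (fun x => m%:R * Num.min (x - a) (b - x))).
  exact: cvg_cst.
by apply: cvgM; [exact: cvg_cst|exact: cb].
Qed.

Lemma trap_cvg a b x : (fun m => trap a b m x) @ \oo --> (\1_(`]a, b[) x : R).
Proof.
rewrite indicE mem_setE in_itv/=; have [xab|xab] := boolP (a < x < b); last first.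
  by rewrite (_ : (fun m => _) = fun=> 0); [exact: cvg_cst|apply/funext => m; rewrite trap_out].
apply: cvg_near_cst; pose e := Num.min (x - a) (b - x).
have e0 : 0 < e by rewrite lt_min !subr_gt0.
exists (Num.truncn e^-1).+1 => // m /= me.
have : 1 <= m%:R * e.
  rewrite -ler_pdivrMr// div1r ltW//; apply: lt_le_trans (truncnS_gt _) _.
  by rewrite ler_nat.
rewrite /trap -/e => h; rewrite max_r; last by apply: le_trans h.
by rewrite min_l.
Qed.

(** These functions of compact support stand in for the constant 1 when the two laws are normalized
    against each other. *)
Lemma trap_grow_cvg (x : R) : (fun n : nat => trap (- n%:R) n%:R n x) @ \oo --> (1 : R).
Proof.
apply: cvg_near_cst; exists (Num.truncn `|x|).+2 => // n /= xn.
have h : `|x| + 1 <= n%:R.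
  apply: (@le_trans _ _ (Num.truncn `|x|).+2%:R); last by rewrite ler_nat.
  by rewrite -[_.+2%:R]natr1 lerD2r ltW// truncnS_gt.
have n1 : 1 <= n%:R :> R by rewrite ler1n; exact: leq_ltn_trans xn.
have : 1 <= Num.min (x - - n%:R) (n%:R - x).
  by rewrite le_min; move: (ler_norm x) (ler_norm (- x)); rewrite normrN; lra.
rewrite /trap; set e := Num.min _ _ => e1.
rewrite max_r ?min_l//; nra.
Qed.

End trapezoid.

Lemma measure_unique_itv (R : realType) (m1 m2 : {measure set (measurableTypeR R) -> \bar R}) :
  (forall a b : R, m1 `]a, b[%classic = m2 `]a, b[%classic) ->
  (forall n : nat, (m1 [set` `](- n%:R : R)%R, n%:R%R[%R] < +oo)%E) ->
  forall A, measurable A -> m1 A = m2 A.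
Proof.
move=> heq hfin A mA; pose I (n : nat) := `](- n%:R : R), n%:R[%classic.
have GI : setI_closed (@RGenOpens.G R).
  move=> _ _ [a1 [b1 ->]] [a2 [b2 ->]]; exists (Num.max a1 a2), (Num.min b1 b2).
  apply/seteqP; split => x /=; rewrite !in_itv/= gt_max lt_min.
    by move=> [/andP[-> ->] /andP[-> ->]].
  by move=> /andP[/andP[-> ->] /andP[-> ->]].
have GIn i : RGenOpens.G (I i) by exists (- i%:R), i%:R.
have Icover : \bigcup_k I k = setT.
  apply/seteqP; split => // x _; exists (Num.truncn `|x|).+1 => //=.
  by rewrite /I /= in_itv/= -ltr_norml truncnS_gt.
have heq' B : RGenOpens.G B -> m1 B = m2 B by move=> [a [b ->]]; exact: heq.
exact: (@measure_unique _ R (measurableTypeR R) (@RGenOpens.G R) I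
  (RGenOpens.measurableE R) GI GIn Icover m1 m2 heq' hfin A mA).
Qed.

Section normal_characterization.
Context d (Omega : measurableType d) (R : realType) (P : probability Omega R).
Variables (Z : Omega -> R) (s : R).
Hypotheses (mZ : measurable_fun setT Z) (s0 : 0 < s).

(** The three bounds supply the dominating constants when Stein's identity is obtained as a limit;
    [x * g x] is bounded although [x] is not. *)
Definition stein_test (g dg : R -> R) : Prop :=
  [/\ forall x : R, is_derive x 1 g (dg x), continuous dg
    & exists M, forall x, [/\ `|g x| <= M, `|x * g x| <= M & `|dg x| <= M]].

Hypothesis stein : forall g dg, stein_test g dg ->
  Rintegral P setT (fun w => Z w * g (Z w)) =
  s ^+ 2 * Rintegral P setT (fun w => dg (Z w)).

Local Notation pdf := (normal_pdf 0 s).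
Local Notation leb := (@lebesgue_measure R).
Let sneq0 : s != 0. Proof. by rewrite gt_eqF. Qed.

Let pdfE x : pdf x = normal_peak s * expR (- (x ^+ 2 / (s ^+ 2 *+ 2))).
Proof. by rewrite normal_pdfE// /normal_fun subr0 mulNr. Qed.

Let integrable_mul (k : R -> R) (M : R) : measurable_fun setT k -> (forall x, `|k x| <= M) ->
  leb.-integrable setT (EFin \o (fun x => k x * pdf x)).
Proof.
move=> mk kM.
have := integrableZl measurableT M (integrable_normal_pdf 0 s).
apply: le_integrable => //.
  by apply/measurable_EFinP; apply: measurable_funM => //; exact: measurable_normal_pdf.
move=> x _ /=; rewrite lee_fin !normrM ler_wpM2r ?normr_ge0 //.
by rewrite (le_trans (kM x))// ler_norm.
Qed.

(* With [psi x] the integral of [k * pdf] up to [x], the function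
   [psi / pdf] solves Stein's equation for [k]. *)
Lemma stein_zero (k : R -> R) (A M : R) : 0 < A -> continuous k ->
  (forall x, `|k x| <= M) -> (forall x, ~~ (- A < x < A) -> k x = 0) ->
  Rintegral leb setT (fun x => k x * pdf x) = 0 ->
  Rintegral P setT (fun w => k (Z w)) = 0.
Proof.
move=> A0 ck kM kA k0.
have mk : measurable_fun setT k by exact: continuous_measurable_fun.
have ik := integrable_mul mk kM.
pose psi x := Rintegral leb [set` `]-oo, x]] (fun x => k x * pdf x).
have dpsi (x : R) : is_derive x 1 psi (k x * pdf x).
  have xx : x < x + 1 by rewrite ltrDl.
  have ix : leb.-integrable [set` `]-oo, (x + 1)]] (EFin \o (fun x => k x * pdf x)).
    by apply: integrableS ik.
  have cx : {for x, continuous (fun x => k x * pdf x)}.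
    by apply: cvgM; [exact: ck|exact: continuous_normal_pdf].
  have [d1 d2] : derivable psi x 1 /\ derive1 psi x = k x * pdf x.
    apply: (@continuous_FTC1 _ (fun x => k x * pdf x) -oo%O x (x + 1)) => //.
    by rewrite ltNye.
  have := derivableP d1; rewrite -derive1E d2. exact.
(* Left of [- A] nothing has been integrated yet; right of [A] everything has, and the total is 0.
   Thus [g] below has compact support, from which its bounds follow. *)
have psiA x : ~~ (- A < x < A) -> psi x = 0.
  rewrite negb_and -!leNgt => /orP[xA|Ax].
    rewrite /psi /Rintegral integral0_eq// => y /=; rewrite in_itv/= => yx.
    by rewrite kA ?mul0r// negb_and -!leNgt (le_trans yx).
  rewrite /psi Rintegral_mkcond -[RHS]k0; apply: eq_Rintegral => y _.
  rewrite patchE; case: ifPn => // /negP yx; rewrite kA ?mul0r// negb_and -!leNgt.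
  apply/orP; right; rewrite leNgt; apply/negP => yA; apply: yx.
  by rewrite mem_setE in_itv/=; exact: ltW (lt_le_trans yA Ax).
have M0 : 0 <= M := le_trans (normr_ge0 _) (kM 0).
have psiM x : `|psi x| <= M.
  have ix (f : R -> R) : leb.-integrable setT (EFin \o f) ->
    leb.-integrable [set` `]-oo, x]] (EFin \o f) by apply: integrableS.
  have ip := integrable_normal_pdf 0 s.
  rewrite (le_trans (le_normr_Rintegral _ (ix _ ik)))//.
  apply: (@le_trans _ _ (Rintegral leb [set` `]-oo, x]] (fun y => M * pdf y))).
    apply: le_Rintegral => //; [|apply: ix|] => //.
    - apply: ix; have := integrable_norm ik; apply: eq_integrable => // y _.
    - by have := integrableZl measurableT M ip; apply: eq_integrable.
    by move=> y _; rewrite normrM (ger0_norm (normal_pdf_ge0 _ _ _)) ler_wpM2r// normal_pdf_ge0.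
  rewrite RintegralZl//; last exact: ix.
  rewrite ler_piMr//; rewrite -lee_fin fineK; last exact: integrable_fin_num (ix _ ip).
  exact: (probability_le1 (normal_prob 0 s)).
pose e x := expR (x ^+ 2 / (s ^+ 2 *+ 2)).
have de (x : R) : is_derive x 1 e (x / s ^+ 2 * e x).
  have hid : is_derive x (1 : R) (id : R -> R) 1 by exact: is_derive_id.
  have hc : is_derive x (1 : R) (cst (s ^+ 2 *+ 2)^-1 : R -> R) 0 by exact: is_derive_cst.
  have h := is_derive1_comp (is_derive_expR _) (is_deriveM (is_deriveM hid hid) hc).
  apply: (is_derive_eq h); rewrite /e /= /GRing.scale /=.
  have -> : (id * id * cst (s ^+ 2 *+ 2)^-1 : R -> R) x = x ^+ 2 / (s ^+ 2 *+ 2) by [].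
  by rewrite mulr0 add0r; field.
(* Up to the factor $p=$ [normal_peak s], [g] is [psi / pdf]. It satisfies $s^2g'-xg=s^2p\,k$, so
   Stein's identity forces the mean of [k] to vanish. *)
pose g x := psi x * e x; pose dg x := normal_peak s * k x + x / s ^+ 2 * g x.
have gA x : ~~ (- A < x < A) -> g x = 0 by move=> h; rewrite /g psiA// mul0r.
have gM x : `|g x| <= M * e A.
  have [xA|xA] := boolP (- A < x < A); last first.
    by rewrite gA// normr0 mulr_ge0 ?expR_ge0.
  rewrite /g normrM ler_pM// ger0_norm ?expR_ge0// ler_expR ler_pM2r; last first.
    by rewrite invr_gt0 pmulrn_lgt0// exprn_gt0.
  by rewrite -(real_normK (num_real x)) lerXn2r ?nnegrE ?(ltW A0)//; move: xA; rewrite -ltr_norml => /ltW.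
have xgM x : `|x * g x| <= A * (M * e A).
  have [xA|xA] := boolP (- A < x < A); last first.
    by rewrite gA// mulr0 normr0 !mulr_ge0 ?expR_ge0// ltW.
  by rewrite normrM ler_pM//; move: xA; rewrite -ltr_norml => /ltW.
have p0 : 0 < normal_peak s by exact: normal_peak_gt0.
have s20 : 0 < s ^+ 2 by rewrite exprn_gt0.
have dgM x : `|dg x| <= normal_peak s * M + A * (M * e A) / s ^+ 2.
  rewrite (le_trans (ler_normD _ _))// lerD//.
    by rewrite normrM gtr0_norm// ler_pM2l.
  by rewrite mulrAC normrM [X in _ * X]gtr0_norm ?invr_gt0// ler_pM2r ?invr_gt0.
have gdg (x : R) : is_derive x 1 g (dg x).
  apply: (is_derive_eq (is_deriveM (dpsi x) (de x))); rewrite /GRing.scale /=.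
  rewrite /dg /g pdfE.
  have : expR (- (x ^+ 2 / (s ^+ 2 *+ 2))) * e x = 1 by rewrite /e -expRD addNr expR0.
  set u := expR _ => ue; rewrite [RHS](_ : _ = normal_peak s * k x * (u * e x) + x / s ^+ 2 * (psi x * e x)).
    by ring.
  by rewrite ue mulr1.
have cdg : continuous dg.
  move=> x; apply: cvgD; first by apply: cvgM; [exact: cvg_cst|exact: ck].
  apply: cvgM; first by apply: cvgM; [exact: cvg_id|exact: cvg_cst].
  by apply/differentiable_continuous/derivable1_diffP; have [] := gdg x.
have st : stein_test g dg.
  split => //; exists (M * e A + A * (M * e A) + (normal_peak s * M + A * (M * e A) / s ^+ 2)) => x.
  have := gM x; have := xgM x; have := dgM x.
  have h1 : 0 <= M * e A by rewrite mulr_ge0 ?expR_ge0.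
  have h2 : 0 <= A * (M * e A) by exact: mulr_ge0 (ltW A0) h1.
  have h3 : 0 <= normal_peak s * M + A * (M * e A) / s ^+ 2.
    by apply: addr_ge0; [exact: mulr_ge0 (ltW p0) M0|exact: divr_ge0 h2 (ltW s20)].
  by move=> *; split; lra.
have bint (f : R -> R) (N : R) : measurable_fun setT f -> (forall x, `|f x| <= N) ->
    P.-integrable setT (EFin \o (fun w => f (Z w))).
  move=> mf fN; apply: (@le_integrable _ _ _ _ _ _ _ (EFin \o cst N)) => //.
  - by apply/measurable_EFinP; exact: measurableT_comp.
  - by move=> w _ /=; rewrite lee_fin (le_trans (fN _))// ler_norm.
  - exact: finite_measure_integrable_cst.
have mg : measurable_fun setT g.
  apply: continuous_measurable_fun => x.
  by apply/differentiable_continuous/derivable1_diffP; have [] := gdg x.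
have mxg : measurable_fun setT (fun x : R => x * g x) by exact: measurable_funM.
have := stein st.
rewrite [X in _ = _ * X](_ : _ = normal_peak s * Rintegral P setT (fun w => k (Z w)) +
    (s ^+ 2)^-1 * Rintegral P setT (fun w => Z w * g (Z w))); last first.
  have i1 := bint _ _ mk kM; have i2 := bint _ _ mxg xgM.
  rewrite -RintegralZl// -RintegralZl// -RintegralD//; last 2 first.
  - have := integrableZl measurableT (normal_peak s) i1.
    by apply: eq_integrable.
  - have := integrableZl measurableT (s ^+ 2)^-1 i2.
    by apply: eq_integrable.
  by apply: eq_Rintegral => w _; rewrite /dg mulrAC -mulrA mulrC [in RHS]mulrC; ring.
set J := Rintegral _ _ _; set I := Rintegral _ _ _ => eq1.
have : s ^+ 2 * (normal_peak s * I) = 0.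
  have : s ^+ 2 * ((s ^+ 2)^-1 * J) = J by rewrite mulVKf ?gt_eqF.
  by move: eq1; rewrite mulrDr; lra.
move=> /eqP; rewrite mulf_eq0 (gt_eqF s20)/= mulf_eq0 (gt_eqF p0)/=.
by move/eqP.
Qed.

Let nint (f : R -> R) := Rintegral leb setT (fun x => f x * pdf x).
Let expect (f : R -> R) := Rintegral P setT (fun w => f (Z w)).

Let expect_cvg (f_ : nat -> R -> R) (f : R -> R) :
  (forall n, measurable_fun setT (f_ n)) -> measurable_fun setT f ->
  (forall n x, `|f_ n x| <= 1) -> (forall x, (fun n => f_ n x) @ \oo --> f x) ->
  (fun n => expect (f_ n)) @ \oo --> expect f.
Proof.
move=> mf_ mf f1 ff.
apply: (@Rintegral_dominated _ _ _ P (fun n w => f_ n (Z w)) (fun w => f (Z w)) (cst 1)) => //.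
- by move=> n; exact: measurableT_comp.
- exact: measurableT_comp.
- by apply: aeW => w; exact: ff.
- exact: finite_measure_integrable_cst.
Qed.

Let nint_cvg (f_ : nat -> R -> R) (f : R -> R) :
  (forall n, measurable_fun setT (f_ n)) -> measurable_fun setT f ->
  (forall n x, `|f_ n x| <= 1) -> (forall x, (fun n => f_ n x) @ \oo --> f x) ->
  (fun n => nint (f_ n)) @ \oo --> nint f.
Proof.
move=> mf_ mf f1 ff.
have mp : measurable_fun setT pdf by exact: measurable_normal_pdf.
apply: (@Rintegral_dominated _ _ _ leb (fun n x => f_ n x * pdf x) (fun x => f x * pdf x) pdf) => //.
- by move=> n; exact: (measurable_funM (mf_ n) mp).
- exact: (measurable_funM mf mp).
- by apply: aeW => x; apply: cvgM; [exact: ff|exact: cvg_cst].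
- exact: integrable_normal_pdf.
- move=> n x; rewrite normrM (ger0_norm (normal_pdf_ge0 _ _ _)).
  by rewrite ler_piMl ?normal_pdf_ge0.
Qed.

Let mtrap a b m : measurable_fun setT (@trap R a b m).
Proof. by apply: continuous_measurable_fun; exact: trap_continuous. Qed.

(** [stein_zero] applies only to functions of normal mean 0. The combination [k] of [f] and [f0 n]
    is such a function, which makes the two expectations proportional; letting [f0 n] tend to 1
    shows that the ratio is 1. *)
Let expect_trap a b m : expect (trap a b m) = nint (trap a b m).
Proof.
pose f := trap a b m; pose f0 (n : nat) := @trap R (- n%:R) n%:R n.
have f1 x : `|f x| <= 1 by exact: trap_norm.
have f01 n x : `|f0 n x| <= 1 by exact: trap_norm.
have mf0 n : measurable_fun setT (f0 n) by exact: mtrap.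
have h n : nint (f0 n) * expect f = nint f * expect (f0 n).
  pose k x := nint (f0 n) * f x - nint f * f0 n x.
  have i1 := integrable_mul (mtrap a b m) f1; have i2 := integrable_mul (mf0 n) (f01 n).
  (* $[-A,A]$ contains the supports of both trapezoids. *)
  pose A := `|a| + `|b| + n%:R + 1.
  have k0 : expect k = 0.
    apply: (@stein_zero k A (`|nint (f0 n)| + `|nint f|)).
    - by rewrite /A; have := normr_ge0 a; have := normr_ge0 b; have := ler0n R n; lra.
    - by move=> x; apply: cvgB; apply: cvgM; (exact: cvg_cst || exact: trap_continuous).
    - move=> x; rewrite (le_trans (ler_normB _ _))// lerD// normrM.
        by rewrite ler_piMr.
      by rewrite ler_piMr.
    - move=> x xA; rewrite /k /f /f0 !trap_out ?mulr0 ?subrr//; move: xA; apply: contra.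
        move=> /andP[h1 h2]; apply/andP; rewrite /A; split; move: h1 h2;
        by have := normr_ge0 a; have := normr_ge0 b; lra.
      move=> /andP[h1 h2]; apply/andP; rewrite /A; split; move: h1 h2;
      by have := ler_norm a; have := ler_norm (- a); have := ler_norm b;
         have := ler_norm (- b); rewrite !normrN; have := ler0n R n; lra.
    - rewrite (_ : (fun x => k x * pdf x) = (fun x => nint (f0 n) * (f x * pdf x) - nint f * (f0 n x * pdf x))); last first.
        by apply/funext => x; rewrite /k; ring.
      rewrite RintegralB//; last 2 first.
      + by have := integrableZl measurableT (nint (f0 n)) i1; apply: eq_integrable.
      + by have := integrableZl measurableT (nint f) i2; apply: eq_integrable.
      by rewrite !RintegralZl// -/(nint f) -/(nint (f0 n)) mulrC subrr.
  have bint (g : R -> R) : measurable_fun setT g -> (forall x, `|g x| <= 1) ->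
      P.-integrable setT (EFin \o (fun w => g (Z w))).
    move=> mg g1; apply: (@le_integrable _ _ _ _ _ _ _ (EFin \o cst 1)) => //.
    - by apply/measurable_EFinP; exact: measurableT_comp.
    - by move=> w _ /=; rewrite lee_fin normr1.
    - exact: finite_measure_integrable_cst.
  have j1 := bint _ (mtrap a b m) f1; have j2 := bint _ (mf0 n) (f01 n).
  move: k0; rewrite /expect /k RintegralB//; last 2 first.
  - by have := integrableZl measurableT (nint (f0 n)) j1; apply: eq_integrable.
  - by have := integrableZl measurableT (nint f) j2; apply: eq_integrable.
  by rewrite !RintegralZl// => /eqP; rewrite subr_eq0 => /eqP.
have c1 : (fun n => nint (f0 n)) @ \oo --> nint (cst 1).
  by apply: nint_cvg => // x; exact: trap_grow_cvg.
have c2 : (fun n => expect (f0 n)) @ \oo --> expect (cst 1).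
  by apply: expect_cvg => // x; exact: trap_grow_cvg.
have n1 : nint (cst 1) = 1.
  rewrite /nint /Rintegral; under eq_integral do rewrite mul1r.
  by rewrite integral_normal_pdf.
have e1 : expect (cst 1) = 1.
  have h1 : (\int[P]_w (1 : R)%:E = 1%:E * P setT)%E by exact: integral_cst.
  by rewrite /expect /Rintegral [X in fine X]h1 mul1e [X in fine X]probability_setT.
have c3 : (fun n => nint (f0 n) * expect f) @ \oo --> 1 * expect f.
  by apply: cvgM; [rewrite -n1|exact: cvg_cst].
have c4 : (fun n => nint (f0 n) * expect f) @ \oo --> nint f * 1.
  rewrite (_ : (fun n => _) = fun n => nint f * expect (f0 n)); last first.
    by apply/funext => n; exact: h.
  by apply: cvgM; [exact: cvg_cst|rewrite -e1].
by rewrite -[LHS]mul1r -[RHS]mulr1; exact: (cvg_unique _ c3 c4).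
Qed.

Let prob_itv a b : P (Z @^-1` `]a, b[) = normal_prob 0 s `]a, b[.
Proof.
have mi : measurable_fun setT (\1_`]a, b[ : R -> R) by exact: measurable_indic.
have c1 : (fun m => expect (trap a b m)) @ \oo --> expect (\1_`]a, b[).
  by apply: expect_cvg => // [m x|x]; [exact: trap_norm|exact: trap_cvg].
have c2 : (fun m => expect (trap a b m)) @ \oo --> nint (\1_`]a, b[).
  rewrite (_ : (fun m => _) = fun m => nint (trap a b m)); last first.
    by apply/funext => m; exact: expect_trap.
  by apply: nint_cvg => // [m x|x]; [exact: trap_norm|exact: trap_cvg].
have := cvg_unique _ c1 c2.
have -> : expect (\1_`]a, b[) = fine (P (Z @^-1` `]a, b[)).
  rewrite /expect /Rintegral; congr fine.
  rewrite (_ : (fun w => _) = fun w => (\1_(Z @^-1` `]a, b[) w)%:E).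
    rewrite integral_indic// ?setIT//.
    by rewrite -[X in measurable X]setTI; exact: mZ.
  by apply/funext => w; rewrite !indicE !mem_setE.
have -> : nint (\1_`]a, b[) = fine (normal_prob 0 s `]a, b[).
  rewrite /nint /Rintegral /normal_prob; congr fine.
  rewrite [RHS]integral_mkcond; apply: eq_integral => x _.
  rewrite patchE indicE; case: ifPn => _; first by rewrite mul1r.
  by rewrite mul0r.
have fP : P (Z @^-1` `]a, b[) \is a fin_num.
  by apply: fin_num_measure; rewrite -[X in measurable X]setTI; exact: mZ.
have fN : normal_prob 0 s `]a, b[ \is a fin_num by exact: fin_num_measure.
by move=> h; rewrite -(fineK fP) -(fineK fN) h.
Qed.

Lemma normal_law A : measurable A -> P (Z @^-1` A) = normal_prob 0 s A.
Proof.
move=> mA; have mZ' : (Z : Omega -> measurableTypeR R) \in mfun by exact: mem_set.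
pose zf : {mfun Omega >-> measurableTypeR R} := mfun_Sub mZ'.
apply: (@measure_unique_itv R (distribution P zf) (normal_prob 0 s)) => //.
move=> k; rewrite -ge0_fin_numE//; apply: fin_num_measure; exact: measurable_itv.
Qed.

End normal_characterization.

(** * Increments of the limit *)

Section independence_criterion.
Context d (Omega : measurableType d) (R : realType) (P : probability Omega R).

(** For fixed [E] both sides are finite measures in [A], so agreement on open intervals suffices. *)
Lemma indep_itv (Z : Omega -> R) (E : set Omega) :
  measurable_fun setT Z -> measurable E ->
  (forall a b, P (Z @^-1` `]a, b[ `&` E) = (P (Z @^-1` `]a, b[) * P E)%E) ->
  forall A, measurable A -> P (Z @^-1` A `&` E) = (P (Z @^-1` A) * P E)%E.
Proof.
move=> mZ mE h A mA.
have mZ' : measurable_fun setT (Z : Omega -> measurableTypeR R) by exact: mZ.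
have r0 : 0 <= fine (P E) by exact: fine_ge0.
have PE : P E \is a fin_num by exact: fin_num_measure.
unshelve epose (m1 := pushforward (mrestr P mE) (Z : Omega -> measurableTypeR R) :
  {measure set (measurableTypeR R) -> \bar R}); first exact: mZ'.
unshelve epose (m2 := pushforward (mscale (NngNum r0) P) (Z : Omega -> measurableTypeR R) :
  {measure set (measurableTypeR R) -> \bar R}); first exact: mZ'.
have m2E B : m2 B = (P (Z @^-1` B) * P E)%E.
  by rewrite -[P E in RHS]fineK// muleC.
rewrite -m2E; apply: (@measure_unique_itv R m1 m2) => //.
  by move=> a b; rewrite m2E; exact: h.
move=> n; apply: (@le_lt_trans _ _ (P E)); last by rewrite -ge0_fin_numE.
have -> : m1 [set` `](- n%:R : R)%R, n%:R%R[%R] =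
  P (Z @^-1` [set` `](- n%:R : R)%R, n%:R%R[%R] `&` E) by [].
apply: le_measure; rewrite ?inE//.
by apply: measurableI => //; rewrite -[X in measurable X]setTI; exact: mZ.
Qed.

Lemma independent_itv (Y Z : Omega -> R) :
  measurable_fun setT Y -> measurable_fun setT Z ->
  (forall a b a' b', P (Y @^-1` `]a, b[ `&` Z @^-1` `]a', b'[) =
     (P (Y @^-1` `]a, b[) * P (Z @^-1` `]a', b'[))%E) ->
  independent P Y Z.
Proof.
move=> mY mZ h A B mA mB.
have mYA : measurable (Y @^-1` A) by rewrite -[X in measurable X]setTI; exact: mY.
have mZi a b : measurable (Z @^-1` `]a, b[).
  by rewrite -[X in measurable X]setTI; exact: mZ.
rewrite setIC muleC; apply: indep_itv => // a b.
rewrite setIC [RHS]muleC; apply: indep_itv => // a' b'; exact: h.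
Qed.

End independence_criterion.

Section increments.
Context d (Omega : measurableType d) (R : realType) (P : probability Omega R).
Variable X : nat -> nat -> Omega -> R.
Hypothesis mX : forall m k, measurable_fun setT (X m k).
Hypothesis X_law : forall m k : nat, (1 <= k)%N ->
  P (X m k @^-1` [set 1]) = (1 / 2)%:E /\ P (X m k @^-1` [set -1]) = (1 / 2)%:E.
Hypothesis X_indep : mutually_independent P [set i : nat * nat | (1 <= i.2)%N]
  (fun i : nat * nat => X i.1 i.2).

Local Notation bits n w := (fun k => level_bit X n (0%N, k) w).

(** Where the steps are signs, this is the increment of $B_n$ over [m] grid intervals from time
    $a4^{-n}$ on. *)
Definition block n a m w : R := 2 ^- n * signsum R (fun k => level_bit X n (0%N, a + k)%N w) m.

Lemma signsum_shift (x : nat -> bool) a m :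
  signsum R (fun k => x (a + k)%N) m = signsum R x (a + m) - signsum R x a.
Proof. by rewrite /signsum big_split_ord/= addrAC subrr add0r. Qed.

Let mbit n k : measurable [set w | level_bit X n (0%N, k) w].
Proof. exact: measurable_level_bit. Qed.

Lemma fair_row n : fair P (fun k => level_bit X n (0%N, k)).
Proof.
exact: (@fair_relabel _ _ _ _ _ _ (pair 0%N) snd _ _ (fair_level_bit mX X_law X_indep n)).
Qed.

Lemma measurable_block n a m : measurable_fun setT (block n a m).
Proof.
apply: measurable_funM => //.
exact: (@measurable_signsum _ _ _ (fun k w => level_bit X n (0%N, a + k)%N w)).
Qed.

Lemma fair_shift n a m e :
  P (setT `&` [set w | agree (iota 0 m) e (fun k => level_bit X n (0%N, a + k)%N w)]) =
  (1 * 2^-1 ^+ m)%:E.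
Proof.
rewrite setTI mul1r -[in RHS](size_iota a m).
rewrite -(fair_row n (fun k => e (k - a)%N) (iota_uniq a m)).
congr (P _); apply/seteqP; split => w /allP h; apply/allP => k; rewrite mem_iota => kn.
  by have := h (k - a)%N; rewrite mem_iota subnKC//=; [apply; lia|lia].
by have := h (a + k)%N; rewrite mem_iota addKn/=; apply; lia.
Qed.

Lemma block_integral n a m (f : R -> R) : measurable_fun setT f ->
  Rintegral P setT (fun w => f (block n a m w)) = mean m (fun x => f (2 ^- n * x)).
Proof.
move=> mf; have mf' : measurable_fun setT (fun x : R => f (2 ^- n * x)).
  by apply: measurableT_comp => //; exact: measurable_funM.
have := @mean_integral _ _ _ P _ (fun k => mbit n (a + k)) m setT 1 _ measurableT mf' (fair_shift n a m).
by rewrite mul1r /Rintegral => ->.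
Qed.

(** [mean_prob] is used twice: for the second block with the event of the first fixed, then for the
    first block with a pattern of the second fixed. What remains is the probability of one pattern
    on disjoint positions. *)
Lemma block_indep n a m a' m' (A B : set R) : measurable A -> measurable B ->
  (a + m <= a')%N ->
  P (block n a m @^-1` A `&` block n a' m' @^-1` B) =
  (P (block n a m @^-1` A) * P (block n a' m' @^-1` B))%E.
Proof.
move=> mA mB am.
pose A' := [set x : R | A (2 ^- n * x)]; pose B' := [set x : R | B (2 ^- n * x)].
have mscaled (C : set R) : measurable C -> measurable [set x : R | C (2 ^- n * x)].
  move=> mC; have ms : measurable_fun setT (fun x : R => 2 ^- n * x) by exact: measurable_funM.
  by rewrite -[X in measurable X]setTI; exact: ms.
have mA' : measurable A' by exact: mscaled.
have mB' : measurable B' by exact: mscaled.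
have PA : P (block n a m @^-1` A) = (mean m \1_A')%:E.
  have := @mean_prob _ _ _ P _ (fun k => mbit n (a + k)) m setT 1 A' measurableT mA' (fair_shift n a m).
  by rewrite mul1r setTI => <-.
have PB : P (block n a' m' @^-1` B) = (mean m' \1_B')%:E.
  have := @mean_prob _ _ _ P _ (fun k => mbit n (a' + k)) m' setT 1 B' measurableT mB' (fair_shift n a' m').
  by rewrite mul1r setTI => <-.
have mblock b l (C : set R) : measurable C -> measurable (block n b l @^-1` C).
  by move=> mC; rewrite -[X in measurable X]setTI; exact: (measurable_block n b l).
rewrite PB PA -EFinM.
apply: (@mean_prob _ _ _ P _ (fun k => mbit n (a' + k)) m' (block n a m @^-1` A) (mean m \1_A') B') => //.
  exact: mblock.
move=> e; rewrite setIC mulrC.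
apply: (@mean_prob _ _ _ P _ (fun k => mbit n (a + k)) m _ (2^-1 ^+ m') A') => //.
  by apply: measurable_agree => k.
move=> e'; have -> : 2^-1 ^+ m' * 2^-1 ^+ m = 2^-1 ^+ size (iota a' m' ++ iota a m) :> R.
  by rewrite size_cat !size_iota exprD.
(* The two patterns are glued at [a'], which separates the blocks. *)
rewrite -(fair_row n (fun k => if (k < a')%N then e' (k - a)%N else e (k - a')%N)); last first.
  rewrite cat_uniq !iota_uniq andbT/=; apply/hasPn => k; rewrite !mem_iota; lia.
congr (P _); apply/seteqP; split => w.
  move=> [/allP h /allP h']; apply/allP => k; rewrite mem_cat !mem_iota => /orP[]kn.
    rewrite ltnNge (_ : (a' <= k)%N)/=; last by case/andP: kn.
    have := h (k - a')%N; rewrite mem_iota subnKC//=; last by case/andP: kn.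
    by apply; lia.
  rewrite (_ : (k < a')%N); last lia.
  have := h' (k - a)%N; rewrite mem_iota subnKC//=; last by case/andP: kn.
  by apply; lia.
move=> /allP h; split; apply/allP => k; rewrite mem_iota => kn.
  have := h (a' + k)%N; rewrite mem_cat !mem_iota addKn.
  by rewrite (_ : (a' + k < a')%N = false); [apply; lia|lia].
have := h (a + k)%N; rewrite mem_cat !mem_iota addKn.
by rewrite (_ : (a + k < a')%N = true); [apply; lia|lia].
Qed.

Definition grid_index n (t : R) : nat := Num.truncn (t * 2 ^+ (2 * n)).

Lemma grid_index_itv n t : 0 <= t ->
  (grid_index n t)%:R * 2 ^- (2 * n) <= t <= (grid_index n t)%:R * 2 ^- (2 * n) + 2 ^- (2 * n).
Proof.
move=> t0; have p0 : 0 < 2 ^+ (2 * n) :> R by rewrite exprn_gt0.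
have u0 : 0 <= t * 2 ^+ (2 * n) by rewrite mulr_ge0// ltW.
have /andP[h1 h2] := truncn_itv u0; rewrite -/(grid_index n t) in h1 h2.
rewrite ler_pdivrMr// h1/= -{2}[2 ^- _]mul1r -mulrDl ler_pdivlMr// natr1.
exact: ltW.
Qed.

Lemma grid_index_le n s t : 0 <= s -> s <= t -> (grid_index n s <= grid_index n t)%N.
Proof. by move=> s0 st; apply: le_truncn; rewrite ler_wpM2r// exprn_ge0. Qed.


Lemma inv_pow_cvg0 (p : nat) : (fun n => 2 ^- (p.+1 * n)) @ \oo --> (0 : R).
Proof.
rewrite (_ : (fun n => _) = fun n => (2 ^- p.+1) ^+ n); last first.
  by apply/funext => n; rewrite exprM exprVn.
apply: cvg_expr; rewrite ger0_norm ?invr_ge0 ?exprn_ge0//.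
by rewrite invf_lt1 ?exprn_gt0// exprn_egt1// ltr1n.
Qed.

Lemma norm_cvg0 (u : nat -> R) (l : R) (v : nat -> R) :
  (forall n, `|u n - l| <= v n) -> v @ \oo --> (0 : R) -> u @ \oo --> l.
Proof.
move=> uv v0; apply/cvgrPdist_le => e e0.
have /cvgrPdist_le/(_ _ e0)[n _ h] := v0; exists n => // m nm.
rewrite distrC (le_trans (uv m))//; apply: le_trans (h m nm).
by rewrite sub0r normrN ler_norm.
Qed.

(** [m n] may fall one short of the full number of steps, because discrete integration by parts
    leaves one sign fewer on one side. *)
Lemma block_cvg (s t : R) (m : nat -> nat) w : ~ bad_set X w -> 0 <= s -> s <= t ->
  (forall n, (m n <= grid_index n t - grid_index n s <= (m n).+1)%N) ->
  (fun n => block n (grid_index n s) (m n) w) @ \oo --> W_fun X t w - W_fun X s w.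
Proof.
move=> nw s0 st hm; have t0 : 0 <= t by exact: le_trans st.
have nb : ~ bad_values X w by move=> h; apply: nw; left; left.
have cB : (fun n => B X n t w - B X n s w) @ \oo --> W_fun X t w - W_fun X s w.
  by apply: cvgB; exact: B_cvg.
have c0 : (fun n => block n (grid_index n s) (m n) w - (B X n t w - B X n s w)) @ \oo --> (0 : R).
  (* One $2^{-n}$ for the interpolation at each of [s] and [t], and one for the step that [m n] may
     omit. *)
  have v0 : (fun n => 3 * 2 ^- (1 * n)) @ \oo --> (0 : R).
    by have := @cvgMl_tmp _ _ _ _ _ 3 _ (inv_pow_cvg0 0); rewrite mulr0; apply.
  apply: norm_cvg0 v0 => n; rewrite subr0 mul1n.
  set S := signsum R (bits n w).
  have hB u : 0 <= u -> `|B X n u w - 2 ^- n * S (grid_index n u)| <= 2 ^- n.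
    move=> u0; rewrite (B_signsum _ _ nb) -mulrBr normrM ger0_norm ?invr_ge0 ?exprn_ge0//.
    rewrite ler_piMr ?invr_ge0 ?exprn_ge0//.
    have v1 : 0 <= u * 2 ^+ (2 * n) by rewrite mulr_ge0// exprn_ge0.
    have /andP[h1 h2] := truncn_itv v1.
    apply: le_trans (interpolate_lip _ v1 h1) _.
    by rewrite -natr1 in h2; lra.
  have -> : block n (grid_index n s) (m n) w =
    2 ^- n * S (grid_index n s + m n)%N - 2 ^- n * S (grid_index n s).
    by rewrite /block (signsum_shift (bits n w)) mulrBr.
  have hS : `|2 ^- n * S (grid_index n t) - 2 ^- n * S (grid_index n s + m n)%N| <= 2 ^- n.
    rewrite -mulrBr normrM ger0_norm ?invr_ge0 ?exprn_ge0// ler_piMr ?invr_ge0 ?exprn_ge0//.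
    have /andP[h1 h2] := hm n; have := grid_index_le n s0 st => h3.
    have -> : grid_index n t = (grid_index n s + m n + (grid_index n t - grid_index n s - m n))%N by lia.
    apply: le_trans (signsum_lip _ _ _ _) _; rewrite -[leRHS](mulr1n 1) ler_nat; lia.
  by move: hS (hB s s0) (hB t t0); rewrite !ler_norml; lra.
rewrite (_ : (fun n => block _ _ _ _) = (fun n =>
   (block n (grid_index n s) (m n) w - (B X n t w - B X n s w)) + (B X n t w - B X n s w))); last first.
  by apply/funext => n; rewrite subrK.
by have := cvgD c0 cB; rewrite add0r; apply.
Qed.

Lemma ae_not_null : {ae P, forall w, ~ bad_set X w}.
Proof.
exists (bad_set X); split.
- exact: measurable_bad_set.
- exact: bad_set0.
- by move=> w /=; apply: contra_notP.
Qed.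

(** Integration by parts produces this symmetric quotient. As a value of [dg] near [y] it inherits
    the bound of [dg] and, by continuity, its limit. *)
Lemma mean_value (g dg : R -> R) (y h : R) : (forall x : R, is_derive x 1 g (dg x)) ->
  0 < h -> exists2 c, `|c - y| < h & (g (y + h) - g (y - h)) / (2 * h) = dg c.
Proof.
move=> gdg h0; have yy : y - h < y + h by lra.
have [c] := @MVT R g dg _ _ yy (fun x _ => gdg x)
  (derivable_within_continuous (fun x _ => @ex_derive _ _ _ _ _ _ _ (gdg x))).
rewrite in_itv/= => /andP[c1 c2] e; exists c; first by rewrite ltr_norml; lra.
rewrite e; have -> : y + h - (y - h) = 2 * h by ring.
by rewrite mulfK// mulf_neq0// gt_eqF.
Qed.

Lemma increment_stein (s t : R) (g dg : R -> R) : 0 <= s -> s < t -> stein_test g dg ->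
  Rintegral P setT (fun w => (W_fun X t w - W_fun X s w) * g (W_fun X t w - W_fun X s w)) =
  (t - s) * Rintegral P setT (fun w => dg (W_fun X t w - W_fun X s w)).
Proof.
move=> s0 st [gdg cdg [M gM]]; have t0 : 0 <= t by exact: ltW (le_lt_trans s0 st).
pose Z w := W_fun X t w - W_fun X s w.
have mZ : measurable_fun setT Z by apply: measurable_funB; exact: measurable_W.
have cg : continuous g.
  by move=> x; apply/differentiable_continuous/derivable1_diffP; exact: (@ex_derive _ _ _ _ _ _ _ (gdg x)).
have mg : measurable_fun setT g by exact: continuous_measurable_fun.
have mdg : measurable_fun setT dg by exact: continuous_measurable_fun.
pose h n : R := 2 ^- n.
have h0 n : 0 < h n by rewrite invr_gt0 exprn_gt0.
pose N n := (grid_index n t - grid_index n s)%N.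
pose q n y := (g (y + h n) - g (y - h n)) / (2 * h n).
pose D n w := block n (grid_index n s) (N n) w.
(* One sign fewer than in [D], as on the right of [mean_id_mul]. *)
pose D' n w := block n (grid_index n s) (N n).-1 w.
have mxg : measurable_fun setT (fun x : R => x * g x) by exact: measurable_funM.
have mq n : measurable_fun setT (q n).
  apply: measurable_funM => //; apply: measurable_funB;
    apply: measurableT_comp => //; [exact: measurable_funD|exact: measurable_funB].
have qM n y : `|q n y| <= M.
  by rewrite /q; have [c _ ->] := mean_value y gdg (h0 n); have [] := gM c.
have cN : (fun n => (N n)%:R * h n ^+ 2) @ \oo --> t - s.
  apply: norm_cvg0 (inv_pow_cvg0 1) => n.
  have := grid_index_itv n s0; have := grid_index_itv n t0.
  rewrite /N natrB ?(grid_index_le n s0 (ltW st))// /h mulrBl.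
  rewrite exprVn -exprM (mulnC n 2) ler_norml; lra.
have Nbig : \forall n \near \oo, (0 < N n)%N.
  have ts : 0 < t - s by rewrite subr_gt0.
  have /cvgrPdist_lt/(_ _ ts)[n _ hn] := cN; exists n => // m nm.
  rewrite lt0n; apply/negP => /eqP N0; have := hn m nm.
  by rewrite /= N0 mul0r subr0 gtr0_norm// ltxx.
(* Integration by parts puts $Nh/2$ in front of a difference of [g]; this is $Nh^2$ times the
   quotient with denominator $2h$, and $Nh^2$ tends to $t-s$. [N n] has to be a successor here. *)
have eqn : \forall n \near \oo, Rintegral P setT (fun w => D n w * g (D n w)) =
    (N n)%:R * h n ^+ 2 * Rintegral P setT (fun w => q n (D' n w)).
  apply: filterS Nbig => n Nn.
  rewrite (@block_integral n _ _ (fun x => x * g x))//.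
  rewrite (@block_integral n _ _ (q n))//.
  have -> : mean (N n) (fun x => 2 ^- n * x * g (2 ^- n * x)) =
      h n * mean (N n).-1.+1 (fun x => x * g (h n * x)).
    by rewrite -meanZ prednK//; apply: eq_mean => x; rewrite mulrA.
  have -> : mean (N n).-1 (fun x => q n (2 ^- n * x)) = (2 * h n)^-1 *
      (mean (N n).-1 (fun x => g (h n * (x + 1))) - mean (N n).-1 (fun x => g (h n * (x - 1)))).
    rewrite -meanN -meanD -meanZ; apply: eq_mean => x.
    by rewrite /q [LHS]mulrC; congr (_ * (g _ - g _)); rewrite /h; ring.
  by rewrite mean_id_mul prednK//; field; rewrite gt_eqF.
have lim1 : (fun n => Rintegral P setT (fun w => D n w * g (D n w))) @ \oo -->
    Rintegral P setT (fun w => Z w * g (Z w)).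
  apply: (@Rintegral_dominated _ _ _ P _ _ (cst M)).
  - by move=> n; apply: (measurableT_comp mxg); exact: measurable_block.
  - exact: (measurableT_comp mxg).
  - apply: filterS ae_not_null => w nw.
    have cD : D n w @[n --> \oo] --> Z w.
      by apply: block_cvg => //; [exact: ltW|move=> n; rewrite leqnn leqnSn].
    by apply: cvgM => //; apply: continuous_cvg => //; exact: cg.
  - exact: finite_measure_integrable_cst.
  - by move=> n w; have [] := gM (D n w).
have lim2 : (fun n => Rintegral P setT (fun w => q n (D' n w))) @ \oo -->
    Rintegral P setT (fun w => dg (Z w)).
  apply: (@Rintegral_dominated _ _ _ P _ _ (cst M)).
  - by move=> n; apply: (measurableT_comp (mq n)); exact: measurable_block.
  - exact: (measurableT_comp mdg).
  - apply: filterS ae_not_null => w nw.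
    have cD : D' n w @[n --> \oo] --> Z w.
      by apply: block_cvg => //; [exact: ltW|move=> n; rewrite /N; lia].
    apply/cvgrPdist_le => e e0.
    have /cvgrPdist_le/(_ _ e0)[dl /= dl0 hdl] := cdg (Z w).
    have dl20 : 0 < dl / 2 by rewrite divr_gt0.
    have ch : h @ \oo --> (0 : R).
      by have := inv_pow_cvg0 0; rewrite (_ : (fun n => _) = h)//; apply/funext => n; rewrite mul1n.
    have /cvgrPdist_lt/(_ _ dl20) near1 := cD.
    have /cvgrPdist_lt/(_ _ dl20) near2 := ch.
    apply: filterS2 near1 near2 => n n1 n2.
    rewrite /q; have [c cD' ->] := mean_value (D' n w) gdg (h0 n).
    apply: hdl => /=; move: n1 n2 cD'; rewrite sub0r normrN (gtr0_norm (h0 n)).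
    by rewrite !ltr_norml; lra.
  - exact: finite_measure_integrable_cst.
  - by move=> n w; exact: qM.
have lim3 : (fun n => (N n)%:R * h n ^+ 2 * Rintegral P setT (fun w => q n (D' n w))) @ \oo -->
    (t - s) * Rintegral P setT (fun w => dg (Z w)) by exact: cvgM.
have lim4 : (fun n => Rintegral P setT (fun w => D n w * g (D n w))) @ \oo -->
    (t - s) * Rintegral P setT (fun w => dg (Z w)).
  apply/cvgrPdist_le => e e0; have /cvgrPdist_le/(_ _ e0) := lim3.
  by apply: filterS2 eqn => n ->.
exact: (cvg_unique _ lim1 lim4).
Qed.

Lemma increment_law (s t : R) : 0 <= s -> s < t -> forall A : set R, measurable A ->
  P ((fun w => W_fun X t w - W_fun X s w) @^-1` A) = normal_prob 0 (Num.sqrt (t - s)) A.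
Proof.
move=> s0 st; apply: normal_law.
- by apply: measurable_funB; exact: measurable_W.
- by rewrite sqrtr_gt0 subr_gt0.
- move=> g dg gdg; rewrite sqr_sqrtr; last by rewrite subr_ge0 ltW.
  exact: increment_stein.
Qed.

Let Zmeas (s t : R) : measurable_fun setT (fun w => W_fun X t w - W_fun X s w).
Proof. by apply: measurable_funB; exact: measurable_W. Qed.

Lemma increment_noatom (s t x : R) : 0 <= s -> s < t ->
  {ae P, forall w, W_fun X t w - W_fun X s w <> x}.
Proof.
move=> s0 st; exists [set w | W_fun X t w - W_fun X s w = x]; split.
- exact: measurable_preimage1.
- rewrite (increment_law s0 st (measurable_set1 x)).
  by rewrite /normal_prob integral_set1.
- by move=> w /=; apply: contra_notP.
Qed.

Lemma indic_itv_cvg (u : nat -> R) (x a b : R) : u @ \oo --> x -> x <> a -> x <> b ->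
  (fun n => \1_(`]a, b[) (u n) : R) @ \oo --> (\1_(`]a, b[) x : R).
Proof.
move=> ux /eqP xa /eqP xb; apply: cvg_near_cst.
have e0 : 0 < Num.min `|x - a| `|x - b|.
  by rewrite lt_min !normr_gt0 !subr_eq0 xa.
have /cvgrPdist_lt/(_ _ e0) := ux; apply: filterS => n.
rewrite lt_min => /andP[ha hb]; rewrite !indicE !mem_setE !in_itv/=; congr (_%:R); congr nat_of_bool.
have side c : `|x - u n| < `|x - c| -> (u n < c) = (x < c) /\ (c < u n) = (c < x).
  move=> hc; have [xc|xc|xc] := ltgtP x c.
  - have uc : u n < c by move: hc; rewrite (ltr0_norm (_ : x - c < 0)) ?subr_lt0// ltr_norml; lra.
    by rewrite uc ltNge ltW.
  - have uc : c < u n by move: hc; rewrite (gtr0_norm (_ : 0 < x - c)) ?subr_gt0// ltr_norml; lra.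
    by rewrite uc ltNge ltW.
  - by move: hc; rewrite xc subrr normr0 normr_lt0.
by have [_ ->] := side a ha; have [-> _] := side b hb.
Qed.

Lemma increments_independent (s t u v : R) : 0 <= s -> s < t -> t <= u -> u < v ->
  independent P (fun w => W_fun X t w - W_fun X s w) (fun w => W_fun X v w - W_fun X u w).
Proof.
move=> s0 st tu uv; apply: independent_itv => // a b a' b'.
have t0 : 0 <= t by exact: ltW (le_lt_trans s0 st).
have u0 : 0 <= u by exact: le_trans tu.
pose Y w := W_fun X t w - W_fun X s w; pose Z w := W_fun X v w - W_fun X u w.
pose Yn n w := block n (grid_index n s) (grid_index n t - grid_index n s) w.
pose Zn n w := block n (grid_index n u) (grid_index n v - grid_index n u) w.
have mYn n : measurable_fun setT (Yn n) by exact: measurable_block.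
have mZn n : measurable_fun setT (Zn n) by exact: measurable_block.
have mpre (f : Omega -> R) c e : measurable_fun setT f -> measurable (f @^-1` `]c, e[).
  by move=> mf; rewrite -[X in measurable X]setTI; exact: mf.
have RE (f : Omega -> R) c e : measurable_fun setT f ->
    Rintegral P setT (fun w => \1_(`]c, e[) (f w)) = fine (P (f @^-1` `]c, e[)).
  move=> mf; rewrite /Rintegral; congr fine.
  rewrite (_ : (fun w => _) = fun w => (\1_(f @^-1` `]c, e[) w)%:E).
    by rewrite integral_indic// ?setIT//; exact: mpre.
  by apply/funext => w; rewrite !indicE !mem_setE.
have RE2 (f g : Omega -> R) : measurable_fun setT f -> measurable_fun setT g ->
    Rintegral P setT (fun w => \1_(`]a, b[) (f w) * \1_(`]a', b'[) (g w)) =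
    fine (P (f @^-1` `]a, b[ `&` g @^-1` `]a', b'[)).
  move=> mf mg'; rewrite /Rintegral; congr fine.
  rewrite (_ : (fun w => _) = fun w => (\1_(f @^-1` `]a, b[ `&` g @^-1` `]a', b'[) w)%:E).
    by rewrite integral_indic// ?setIT//; apply: measurableI; exact: mpre.
  by apply/funext => w; rewrite !indicE in_setI !mem_setE -natrM mulnb.
have mind (f : Omega -> R) c e : measurable_fun setT f ->
    measurable_fun setT (fun w => \1_(`]c, e[) (f w) : R).
  by move=> mf; apply: (@measurableT_comp _ _ _ _ _ _ (\1_(`]c, e[) : R -> R)).
have ind1 c e (x : R) : 0 <= (\1_(`]c, e[) x : R) <= 1.
  by rewrite indicE; case: (_ \in _); rewrite ?lexx ?ler01.
have i1 : P.-integrable setT (EFin \o cst 1) by exact: finite_measure_integrable_cst.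
have cY : {ae P, forall w, (fun n => \1_(`]a, b[) (Yn n w) : R) @ \oo --> (\1_(`]a, b[) (Y w) : R)}.
  apply: filterS3 ae_not_null (increment_noatom a s0 st) (increment_noatom b s0 st).
  move=> w nw wa wb; apply: indic_itv_cvg => //.
  by apply: block_cvg => //; [exact: ltW|move=> n; rewrite leqnn leqnSn].
have cZ : {ae P, forall w, (fun n => \1_(`]a', b'[) (Zn n w) : R) @ \oo --> (\1_(`]a', b'[) (Z w) : R)}.
  apply: filterS3 ae_not_null (increment_noatom a' u0 uv) (increment_noatom b' u0 uv).
  move=> w nw wa wb; apply: indic_itv_cvg => //.
  by apply: block_cvg => //; [exact: ltW|move=> n; rewrite leqnn leqnSn].
have l1 : (fun n => fine (P (Yn n @^-1` `]a, b[))) @ \oo --> fine (P (Y @^-1` `]a, b[)).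
  have -> : (fun n => fine (P (Yn n @^-1` `]a, b[))) =
      fun n => Rintegral P setT (fun w => \1_(`]a, b[) (Yn n w)).
    by apply/funext => n; rewrite RE.
  rewrite -RE; last exact: Zmeas.
  apply: (@Rintegral_dominated _ _ _ P (fun n w => \1_(`]a, b[) (Yn n w)) _ (cst 1)) => //.
  - by move=> n; apply: mind.
  - by apply: mind; exact: Zmeas.
  - by move=> n w; have /andP[h1 h2] := ind1 a b (Yn n w); rewrite ger0_norm.
have l2 : (fun n => fine (P (Zn n @^-1` `]a', b'[))) @ \oo --> fine (P (Z @^-1` `]a', b'[)).
  have -> : (fun n => fine (P (Zn n @^-1` `]a', b'[))) =
      fun n => Rintegral P setT (fun w => \1_(`]a', b'[) (Zn n w)).
    by apply/funext => n; rewrite RE.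
  rewrite -RE; last exact: Zmeas.
  apply: (@Rintegral_dominated _ _ _ P (fun n w => \1_(`]a', b'[) (Zn n w)) _ (cst 1)) => //.
  - by move=> n; apply: mind.
  - by apply: mind; exact: Zmeas.
  - by move=> n w; have /andP[h1 h2] := ind1 a' b' (Zn n w); rewrite ger0_norm.
have l3 : (fun n => fine (P (Yn n @^-1` `]a, b[ `&` Zn n @^-1` `]a', b'[))) @ \oo -->
    fine (P (Y @^-1` `]a, b[ `&` Z @^-1` `]a', b'[)).
  have -> : (fun n => fine (P (Yn n @^-1` `]a, b[ `&` Zn n @^-1` `]a', b'[))) =
      fun n => Rintegral P setT (fun w => \1_(`]a, b[) (Yn n w) * \1_(`]a', b'[) (Zn n w)).
    by apply/funext => n; rewrite RE2.
  rewrite -RE2; [|exact: Zmeas|exact: Zmeas].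
  apply: (@Rintegral_dominated _ _ _ P
    (fun n w => \1_(`]a, b[) (Yn n w) * \1_(`]a', b'[) (Zn n w)) _ (cst 1)) => //.
  - by move=> n; apply: measurable_funM; apply: mind.
  - by apply: measurable_funM; apply: mind; exact: Zmeas.
  - by apply: filterS2 cY cZ => w; exact: cvgM.
  - move=> n w; have /andP[h1 h2] := ind1 a b (Yn n w); have /andP[h3 h4] := ind1 a' b' (Zn n w).
    by rewrite ger0_norm ?mulr_ge0//= mulr_ile1.
have fP E : measurable E -> P E \is a fin_num by exact: fin_num_measure.
have l4 : (fun n => fine (P (Yn n @^-1` `]a, b[)) * fine (P (Zn n @^-1` `]a', b'[))) @ \oo -->
    fine (P (Y @^-1` `]a, b[)) * fine (P (Z @^-1` `]a', b'[)) by exact: cvgM.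
have e34 : (fun n => fine (P (Yn n @^-1` `]a, b[ `&` Zn n @^-1` `]a', b'[))) =
  (fun n => fine (P (Yn n @^-1` `]a, b[)) * fine (P (Zn n @^-1` `]a', b'[))).
  apply/funext => n; rewrite -fineM; [|exact/fP/mpre|exact/fP/mpre].
  congr fine; apply: block_indep => //.
  (* The first block ends at [grid_index n t], which [t <= u] places at or before the start of the
     second. *)
  by rewrite subnKC grid_index_le// ltW.
rewrite e34 in l3; have := cvg_unique (@norm_hausdorff _ _) l3 l4.
have fpre (f : Omega -> R) c e : measurable_fun setT f -> P (f @^-1` `]c, e[) \is a fin_num.
  by move=> mf; exact/fP/mpre.
move=> e; rewrite -[LHS]fineK; last first.
  by apply: fP; apply: measurableI; apply: mpre; exact: Zmeas.
rewrite e EFinM (fineK (fpre Y a b (Zmeas s t))).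
by rewrite (fineK (fpre Z a' b' (Zmeas u v))).
Qed.

End increments.

Theorem theorem3 (d : measure_display) (Omega : measurableType d)
    (R : realType) (P : probability Omega R) (X : nat -> nat -> {RV P >-> R})
    (X_law : forall m k : nat, (1 <= k)%N ->
       P (X m k @^-1` [set 1]) = (1 / 2)%:E /\
       P (X m k @^-1` [set -1]) = (1 / 2)%:E)
    (X_indep : mutually_independent P [set i : nat * nat | (1 <= i.2)%N]
       (fun i : nat * nat => X i.1 i.2 : Omega -> R)) :
  exists (N : set Omega) (W : R -> {RV P >-> R}),
    [/\ (* convergence off the null set N, and W = 0 on N *)
        [/\ measurable N, P N = 0%E,
            forall w, ~ N w -> forall t : R, 0 <= t ->
              (fun n => B X n t w) @ \oo --> W t w
          & forall w, N w -> forall t : R, 0 <= t -> W t w = 0],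
        (* (i), (ii), (iii) *)
        [/\ forall w, W 0 w = 0 /\
              {within `[0, +oo[, continuous (fun t => W t w)},
            forall s t : R, 0 <= s -> s < t ->
              forall A : set R, measurable A ->
                pushforward P (W t \- W s)%R A =
                normal_prob 0 (Num.sqrt (t - s)) A
          & forall s t u v : R, 0 <= s -> s < t -> t <= u -> u < v ->
              independent P (W t \- W s) (W v \- W u)],
        (* (a) *)
        forall C K : R, 3 / 2 <= C -> 0 < K ->
          exists n0 : nat, forall n, (n0 <= n)%N ->
            (P [set w | (n%:R * 2 `^ (- (n%:R / 2)) <=
                 max_dist K (fun t => W t w) (fun t => B X n t w))%R] <=
             (6 * (K * 2 ^+ (2 * n)) `^ (1 - C))%:E)%E
      & (* (b) *)
        forall K : R, 0 < K ->
          {ae P, forall w, \forall n \near \oo,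
             max_dist K (fun t => W t w) (fun t => B X n t w) <=
             n%:R * 2 `^ (- (n%:R / 2))}].
Proof.
pose x m k : Omega -> R := X m k.
have mx m k : measurable_fun setT (x m k) by exact: measurable_funPT.
(* One null set serves all times and all [K], since it was formed over all integer horizons at
   once. *)
exists (bad_set x), (fun t => mfun_Sub (mem_set (measurable_W mx t))); split.
- split; first exact: measurable_bad_set.
  + exact: (bad_set0 mx X_law X_indep).
  + by move=> w nw t t0; exact: B_cvg.
  + by move=> w nw t t0; exact: W_null.
- split.
  + move=> w; split; first exact: W0.
    by apply: cont_on_within => K K0; exact: cont_on_W.
  + by move=> s t s0 st A mA; exact: (increment_law mx X_law X_indep s0 st mA).
  + by move=> s t u v s0 st tu uv; exact: (increments_independent mx X_law X_indep s0 st tu uv).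
- by move=> C K C32 K0; exact: (W_estimate mx X_law X_indep).
- move=> K K0; apply: filterS (ae_not_null mx X_law X_indep) => w nw.
  exact: W_eventually.
Qed.
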